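(* Let $\psi:[0,\infty)\to[0,\infty)$ be an increasing function satisfying $$\lim_{u\to0}\psi(u)=\psi(0)=0,\qquad \limsup_{u\to\infty}\frac{\log\psi(u)}{u}<\infty.$$ Then for any $f\in L\log L(\mathbb{T}^2)$ we have $$\lim_{m\to\infty}\frac{1}{m+1}\sum_{n=0}^{m}\psi\left(\left|S_{nn}(x,y,f)-f(x,y)\right|\right)=0$$ for almost every $(x,y)\in\mathbb{T}^2$.
   Context: $\mathbb{T}=[-\pi,\pi)=\mathbb{R}/2\pi\mathbb{Z}$; functions on $\mathbb{T}^2$ are identified with functions on $\mathbb{R}^2$ that are $2\pi$-periodic in each variable. Integrals and ''almost every'' are with respect to Lebesgue measure. $\log^+u=\log u$ if $u>1$ and $\log^+u=0$ otherwise. $L\log L(\mathbb{T}^2)$ is the class of measurable functions $f$ on $\mathbb{T}^2$ with $\iint_{\mathbb{T}^2}|f|\log^+|f|<\infty$ (such $f$ are integrable). Fourier coefficients: $\widehat f(j,k)=\frac{1}{4\pi^2}\iint_{\mathbb{T}^2}f(x,y)e^{-i(jx+ky)}\,dx\,dy$. Quadratic partial sums, for $n=0,1,2,\dots$: $S_{nn}(x,y,f)=\sum_{j=-n}^{n}\sum_{k=-n}^{n}\widehat f(j,k)e^{i(jx+ky)}$. *)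

(* Defs.v *)
From mathcomp Require Import all_boot all_order all_algebra.
From mathcomp Require Import all_classical all_reals all_analysis.
From mathcomp Require Export complex.
Import Order.TTheory GRing.Theory Num.Theory.
Import numFieldNormedType.Exports.

Set Implicit Arguments.
Unset Strict Implicit.
Unset Printing Implicit Defensive.

Local Open Scope classical_set_scope.
Local Open Scope ring_scope.
Local Open Scope complex_scope.

Notation cabs := ComplexField.Normc.normc.

Section Defs.
Variable R : realType.

(* The product measure lives on the Borel sigma-algebra of R * R; its
   completion, on [plane], is Lebesgue measure on the Lebesgue sets. *)
Definition borel2 :
    {measure set (measurableTypeR R * measurableTypeR R) -> \bar R} :=
  (@lebesgue_measure R \x @lebesgue_measure R)%E.

(* A copy of R * R carrying the Lebesgue sigma-algebra. *)
Definition plane := caratheodory_type (borel2^*)%mu.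

Definition lebesgue2 : {measure set plane -> \bar R} :=
  @completed_measure_extension _ _ _ borel2.

Definition torus2 : set plane := `[- pi, pi[ `*` `[- pi, pi[.

Definition periodic2 (f : R * R -> R[i]) : Prop :=
  (forall y, periodic (fun x => f (x, y)) (pi *+ 2)) /\
  (forall x, periodic (fun y => f (x, y)) (pi *+ 2)).

Definition logplus (u : R) : R := if 1 < u then ln u else 0.

Definition LlogL (f : R * R -> R[i]) : Prop :=
  [/\ measurable_fun torus2 (fun z : plane => complex.Re (f z)),
      measurable_fun torus2 (fun z : plane => complex.Im (f z)) &
      (\int[lebesgue2]_(z in torus2) (cabs (f z) * logplus (cabs (f z)))%:E
        < +oo)%E].

Definition cintegral (D : set plane) (g : R * R -> R[i]) : R[i] :=
  (\int[lebesgue2]_(z in D) complex.Re (g z)) +i*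
  (\int[lebesgue2]_(z in D) complex.Im (g z)).

Definition expi (t : R) : R[i] := cos t +i* sin t.

Definition fourier (f : R * R -> R[i]) (j k : int) : R[i] :=
  ((4 * pi ^+ 2)^-1)%:C *
  cintegral torus2 (fun z => f z * expi (- (j%:~R * z.1 + k%:~R * z.2))).

(* The shift by n makes the indices of each sum run over -n, ..., n. *)
Definition Snn (n : nat) (x y : R) (f : R * R -> R[i]) : R[i] :=
  \sum_(0 <= a < n.*2.+1) \sum_(0 <= b < n.*2.+1)
    let j := a%:Z - n%:Z in
    let k := b%:Z - n%:Z in
    fourier f j k * expi (j%:~R * x + k%:~R * y).

End Defs.

(* Main.v *)
(* The theorem follows from a weak-type estimate: for a trigonometric polynomial
   q, off a set of measure at most (A / lam) \iint (eps + llog eps |q|), where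
   llog eps u = u (1 + ln (1 + u / eps)), all dyadic means of
   exp (|S_tt q| / lam) are at most 16. Since trigonometric polynomials are
   dense for the functional \iint llog eps |.|, splitting f = q + h with h small
   and letting lam tend to 0 gives the convergence.

   Averaging over the translates of the grid of mesh 2 pi / 2^l reduces the
   estimate to the grid. There, up to quarter turns, S_nn is a one-dimensional
   partial sum along rows, applied to half-plane projections of q; these
   projections are bounded from L log L to L^1, again by one-dimensional
   estimates. The one-dimensional ingredient is a Calderon-Zygmund argument: off
   a set of measure O(|g|_1 / lam) the sequence n |-> S_n g (x) has dyadic mean
   oscillation O(lam), and John-Nirenberg turns this into exponential moments. *)

(* Two weak type (1,1) bounds cannot be composed, and a square sum composes a projection with a
   partial sum. The logarithm is spent on the projections: the sector [side n] truncates by [n] in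
   the first frequency only, so up to quarter turns and the constant term $S_{nn}$ is a combination
   of row partial sums of functions that do not depend on [n], and only this last step is of weak
   type.

   John-Nirenberg in the index needs the oscillation over every dyadic block of N indices. At a
   fixed point, nodes at chordal distance below L / N contribute O(lam). For the others the
   geometric series is summed: this leaves a constant, which oscillation ignores, and an exponential
   sum in the index, whose mean square is bounded by a large sieve argument wherever a Marcinkiewicz
   integral is at most lam.

   The grid depends on the frequencies of the polynomial but not on its coefficients. This permits
   averaging over translates of the grid, since a translation only multiplies the coefficients by
   phases. *)
Require Import Defs.
From mathcomp Require Import all_boot all_order all_algebra.
From mathcomp Require Import all_classical all_reals all_analysis.
From mathcomp Require Import measurable_realfun zify ring lra.
Import Order.TTheory GRing.Theory Num.Theory.
Import numFieldNormedType.Exports.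

Set Implicit Arguments.
Unset Strict Implicit.
Unset Printing Implicit Defensive.

Local Open Scope ring_scope.
Local Open Scope complex_scope.

(** * Complex modulus and roots of unity *)

Section ComplexModulus.
Variable R : realType.
Implicit Types (z w : R[i]) (t : R).

Lemma cabs_ge0 z : 0 <= cabs z.
Proof. by case: z => a b; exact: sqrtr_ge0. Qed.

Lemma cabs0 : cabs (0 : R[i]) = 0.
Proof. exact: ComplexField.Normc.normc0. Qed.

Lemma cabs1 : cabs (1 : R[i]) = 1.
Proof. exact: ComplexField.Normc.normc1. Qed.

Lemma cabsM z w : cabs (z * w) = cabs z * cabs w.
Proof. exact: ComplexField.Normc.normcM. Qed.

Lemma cabsV z : cabs z^-1 = (cabs z)^-1.
Proof. exact: ComplexField.Normc.normcV. Qed.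

Lemma cabsN z : cabs (- z) = cabs z.
Proof. exact: normcN. Qed.

Lemma cabs_le_add z w : cabs (z + w) <= cabs z + cabs w.
Proof. exact: le_normcD. Qed.

Lemma cabs_le_sub z w : cabs (z - w) <= cabs z + cabs w.
Proof. by rewrite -[cabs w]cabsN; exact: cabs_le_add. Qed.

Lemma cabs_subC z w : cabs (z - w) = cabs (w - z).
Proof. by rewrite -cabsN opprB. Qed.

Lemma cabs_real t : cabs t%:C = `|t|.
Proof. by rewrite /= expr0n addr0 sqrtr_sqr. Qed.

Lemma cabs_realM t z : 0 <= t -> cabs (t%:C * z) = t * cabs z.
Proof. by move=> t0; rewrite cabsM cabs_real ger0_norm. Qed.

Lemma cabs_eq0 z : (cabs z == 0) = (z == 0).
Proof.
apply/eqP/eqP; last by move=> ->; exact: cabs0.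
exact: ComplexField.Normc.eq0_normc.
Qed.

Lemma cabs_gt0 z : z != 0 -> 0 < cabs z.
Proof. by rewrite lt_def cabs_ge0 cabs_eq0 andbT. Qed.

Lemma cabs_sum I (r : seq I) (P : pred I) (F : I -> R[i]) :
  cabs (\sum_(i <- r | P i) F i) <= \sum_(i <- r | P i) cabs (F i).
Proof.
elim/big_ind2: _; rewrite ?cabs0 // => x1 y1 x2 y2 h1 h2.
by apply: le_trans (cabs_le_add _ _) _; exact: lerD.
Qed.

Lemma sqr_cabs z : cabs z ^+ 2 = complex.Re z ^+ 2 + complex.Im z ^+ 2.
Proof. by case: z => a b /=; rewrite sqr_sqrtr // addr_ge0 // sqr_ge0. Qed.

Lemma sqr_cabsE z : (cabs z ^+ 2)%:C = z * conjc z.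
Proof.
rewrite sqr_cabs; case: z => a b /=.
by apply/eqP; rewrite eq_complex /=; apply/andP; split; apply/eqP; ring.
Qed.

Lemma cabs_conj z : cabs (conjc z) = cabs z.
Proof. by case: z => a b /=; rewrite sqrrN. Qed.

Lemma conjcM z w : conjc (z * w) = conjc z * conjc w.
Proof. exact: rmorphM. Qed.

Lemma conjc_sum I (r : seq I) (P : pred I) (F : I -> R[i]) :
  conjc (\sum_(i <- r | P i) F i) = \sum_(i <- r | P i) conjc (F i).
Proof. exact: rmorph_sum. Qed.

Lemma cabs_1_sub_conj z : cabs (1 - conjc z) = cabs (1 - z).
Proof.
rewrite -[RHS]cabs_conj; congr cabs.
by case: z => a b; apply/eqP; rewrite eq_complex /=; apply/andP; split; apply/eqP; ring.
Qed.

Lemma normr_Re_le z : `|complex.Re z| <= cabs z.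
Proof.
rewrite -(@ler_pXn2r _ 2) ?nnegrE ?cabs_ge0 // sqr_cabs.
by rewrite -normrX ger0_norm ?sqr_ge0 // lerDl sqr_ge0.
Qed.

Lemma normr_Im_le z : `|complex.Im z| <= cabs z.
Proof.
rewrite -(@ler_pXn2r _ 2) ?nnegrE ?cabs_ge0 // sqr_cabs.
by rewrite -normrX ger0_norm ?sqr_ge0 // lerDr sqr_ge0.
Qed.

Lemma cabs_le_ReIm z : cabs z <= `|complex.Re z| + `|complex.Im z|.
Proof.
rewrite -(@ler_pXn2r _ 2) ?nnegrE ?cabs_ge0 ?addr_ge0 // sqr_cabs sqrrD.
have := real_normK (num_real (complex.Re z)); have := real_normK (num_real (complex.Im z)).
have := mulr_ge0 (normr_ge0 (complex.Re z)) (normr_ge0 (complex.Im z)).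
by rewrite !expr2; lra.
Qed.

Lemma ReD z w : complex.Re (z + w) = complex.Re z + complex.Re w.
Proof. by case: z; case: w. Qed.

Lemma ImD z w : complex.Im (z + w) = complex.Im z + complex.Im w.
Proof. by case: z; case: w. Qed.

Lemma ReB z w : complex.Re (z - w) = complex.Re z - complex.Re w.
Proof. by case: z; case: w. Qed.

Lemma ImB z w : complex.Im (z - w) = complex.Im z - complex.Im w.
Proof. by case: z; case: w. Qed.

Lemma Re_sum I (r : seq I) (P : pred I) (F : I -> R[i]) :
  complex.Re (\sum_(i <- r | P i) F i) = \sum_(i <- r | P i) complex.Re (F i).
Proof. by elim/big_rec2: _ => //= i y1 y2 _ <-; rewrite ReD. Qed.

Lemma Im_sum I (r : seq I) (P : pred I) (F : I -> R[i]) :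
  complex.Im (\sum_(i <- r | P i) F i) = \sum_(i <- r | P i) complex.Im (F i).
Proof. by elim/big_rec2: _ => //= i y1 y2 _ <-; rewrite ImD. Qed.

Lemma Re_realM t z : complex.Re (t%:C * z) = t * complex.Re z.
Proof. by case: z => a b /=; rewrite mul0r subr0. Qed.

Lemma sqr_cabs_le_add z w :
  cabs (z + w) ^+ 2 <= 2 * cabs z ^+ 2 + 2 * cabs w ^+ 2.
Proof.
rewrite !sqr_cabs ReD ImD.
move: (complex.Re z) (complex.Re w) (complex.Im z) (complex.Im w) => a b c d.
by have := sqr_ge0 (a - b); have := sqr_ge0 (c - d); lra.
Qed.

Lemma expi0 : expi (0 : R) = 1.
Proof. by rewrite /expi cos0 sin0. Qed.

Lemma expiD s t : expi (s + t) = expi s * expi t.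
Proof.
by apply/eqP; rewrite /expi eq_complex /= cosD sinD [X in _ && (X == _)]addrC !eqxx.
Qed.

Lemma expiN t : expi (- t) = conjc (expi t).
Proof. by rewrite /expi cosN sinN. Qed.

Lemma cabs_expi t : cabs (expi t) = 1.
Proof. by rewrite /= cos2Dsin2 sqrtr1. Qed.

Lemma expiM t n : expi (t *+ n) = expi t ^+ n.
Proof. by elim: n => [|n IH]; rewrite ?expi0 // mulrS exprS expiD IH. Qed.

Lemma expi2pi : expi (pi *+ 2 : R) = 1.
Proof. by rewrite /expi cos2pi sin2pi. Qed.

Lemma expi_2pi_int (k : int) : expi (2 * pi * k%:~R : R) = 1.
Proof.
have nat_case (n : nat) : expi (2 * pi * n%:R : R) = 1.
  have -> : 2 * pi * n%:R = pi *+ 2 *+ n :> R by rewrite -mulrnA mul2n -mul2n mulnC -[RHS]mulr_natr natrM; ring.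
  by rewrite expiM expi2pi expr1n.
case: k => n; first exact: nat_case.
by rewrite NegzE mulrNz mulrN expiN nat_case conjc1.
Qed.

Lemma abs_sin_le t : `|sin t| <= `|t|.
Proof.
wlog t0 : t / 0 <= t => [h|].
  have [/h//|/ltW t0] := leP 0 t.
  by rewrite -(normrN t) -(normrN (sin t)) -sinN; apply: h; rewrite oppr_ge0.
have [x _] := @MVT_segment R sin cos 0 t t0
  (fun x _ => is_derive_sin x)
  (continuous_subspaceT (@continuous_sin R)).
rewrite sin0 !subr0 => ->; rewrite normrM.
by rewrite ler_piMl // cos_max.
Qed.

Lemma cabs_1_sub_expi t : cabs (1 - expi t) <= `|t|.
Proof.
rewrite -(@ler_pXn2r _ 2) ?nnegrE ?cabs_ge0 // sqr_cabs /=.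
have -> : (1 - cos t) ^+ 2 + (0 - sin t) ^+ 2 = (2 * sin (t / 2)) ^+ 2.
  have := cos2Dsin2 t; have := cos2Dsin2 (t / 2).
  have -> : cos t = cos (t / 2) ^+ 2 *+ 2 - 1.
    by rewrite -cos_mulr2n; congr cos; rewrite -mulr_natr; field.
  nra.
rewrite -[leLHS](real_normK (num_real _)) ler_pXn2r ?nnegrE //.
have := abs_sin_le (t / 2); rewrite !normrM normfV (ger0_norm (ler0n _ 2)).
lra.
Qed.

End ComplexModulus.

Section RootsOfUnity.
Variables (R : realType) (L : nat).
Hypothesis L_gt0 : (0 < L)%N.
Implicit Types (u v : int).

Definition zeta u : R[i] := expi (2 * pi * (u%:~R / L%:R)).

(** A substitute for the distance from [u] to the multiples of [L]: it is exactly periodic,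
    satisfies the triangle inequality, and lies between 2 and 8 times that distance. It is also what
    appears in the denominator of geometric sums of [zeta]. *)
Definition chordal u : R := L%:R * cabs (1 - zeta u).

Let Lr_gt0 : 0 < L%:R :> R. Proof. by rewrite ltr0n. Qed.
Let Lr_neq0 : L%:R != 0 :> R. Proof. by rewrite gt_eqF. Qed.

Lemma zetaD u v : zeta (u + v) = zeta u * zeta v.
Proof. by rewrite /zeta intrD (mulrDl u%:~R) (mulrDr (2 * pi)) expiD. Qed.

Lemma zeta0 : zeta 0 = 1.
Proof. by rewrite /zeta mul0r mulr0 expi0. Qed.

Lemma zetaN u : zeta (- u) = conjc (zeta u).
Proof. by rewrite /zeta mulrNz mulNr mulrN expiN. Qed.

Lemma cabs_zeta u : cabs (zeta u) = 1.
Proof. exact: cabs_expi. Qed.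

Lemma zeta_period u k : zeta (u + k * L%:Z) = zeta u.
Proof.
rewrite zetaD [X in _ * X](_ : _ = 1) ?mulr1 //.
by rewrite /zeta intrM -pmulrn mulfK // expi_2pi_int.
Qed.

Lemma chord_ge0 u : 0 <= chordal u.
Proof. by rewrite mulr_ge0 ?cabs_ge0 // ltW. Qed.

Lemma chordN u : chordal (- u) = chordal u.
Proof.
by rewrite /chordal zetaN cabs_1_sub_conj.
Qed.

Lemma chord_subC u v : chordal (u - v) = chordal (v - u).
Proof. by rewrite -chordN opprB. Qed.

Lemma chord_period u k : chordal (u + k * L%:Z) = chordal u.
Proof. by rewrite /chordal zeta_period. Qed.

Lemma chord_zetaB u v : L%:R * cabs (zeta u - zeta v) = chordal (u - v).
Proof.
rewrite /chordal; congr (_ * _).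
have -> : zeta u - zeta v = - (zeta v * (1 - zeta (u - v))).
  by rewrite mulrBr -zetaD mulr1 (addrC v) subrK opprB.
by rewrite cabsN cabsM cabs_zeta mul1r.
Qed.

Lemma chord_add u v : chordal (u + v) <= chordal u + chordal v.
Proof.
rewrite -(opprK v) chordN -chord_zetaB -mulrDr ler_pM2l //.
rewrite zetaN.
have -> : zeta u - conjc (zeta v) = (1 - conjc (zeta v)) - (1 - zeta u) by ring.
apply: le_trans (cabs_le_sub _ _) _; rewrite addrC lerD2l.
by rewrite cabs_1_sub_conj.
Qed.

Lemma chord_sub u v : chordal (u - v) <= chordal u + chordal v.
Proof. by rewrite -[chordal v]chordN chord_add. Qed.

Lemma chord_le u : chordal u <= 8 * `|u|%N%:R.
Proof.
have := cabs_1_sub_expi (2 * pi * (u%:~R / L%:R) : R).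
rewrite -[expi _]/(zeta u) => /(ler_wpM2l (ltW Lr_gt0)) /le_trans; apply.
rewrite !normrM normfV (ger0_norm (pi_ge0 R)) (ger0_norm (ltW Lr_gt0)).
rewrite (ger0_norm (ler0n _ 2)).
have -> : L%:R * (2 * pi * (`|u%:~R| / L%:R)) = 2 * pi * `|u%:~R| :> R.
  by field.
rewrite natr_absz intr_norm ler_wpM2r //.
by have := @pihalf_lt2 R; lra.
Qed.

(** Doubling: while [4 n < L], subadditivity reduces the claim for [n] to the one for [2 n].
    Afterwards the angle is at least a right angle, so the real part of [1 - zeta] is at least 1 and
    the chord is at least [L >= 2 n]. *)
Lemma chord_ge u : (`|u| * 2 <= L)%N -> 2 * `|u|%N%:R <= chordal u.
Proof.
wlog [n ->] : u / exists n : nat, u = n%:Z => [h|].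
  case: (intP u) => [|n|n]; [exact: (h 0 (ex_intro _ 0%N _))| |].
    by apply: h; exists n.+1.
  by rewrite -chordN -abszN opprK; apply: h; exists n.+1.
rewrite absz_nat; have [k] := ubnP (L - n)%N; elim: k n => // k IH n hk hn.
have [->|n0] := posnP n; first by rewrite mulr0 chord_ge0.
have [small|big] := ltnP (4 * n) L.
  have := IH (2 * n)%N ltac:(lia) ltac:(lia).
  rewrite PoszM mulr_natl.
  have -> : (2%:Z * n%:Z)%R = n%:Z + n%:Z by lia.
  by have := chord_add n n; rewrite natrM; lra.
have cos_le0 : cos (2 * pi * (n%:Z%:~R / L%:R)) <= 0 :> R.
  have q0 : 0 <= pi / 2 :> R by rewrite divr_ge0 ?pi_ge0.
  have -> : 0 = cos (pi / 2) :> R by rewrite cos_pihalf.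
  have p0 := @pi_gt0 R.
  have a1 : (4^-1 : R) <= n%:R / L%:R.
    by rewrite ler_pdivlMr // mulrC ler_pdivrMr // -natrM ler_nat mulnC.
  have a2 : (n%:R / L%:R : R) <= 2^-1.
    by rewrite ler_pdivrMr // mulrC ler_pdivlMr // -natrM ler_nat.
  rewrite leNgt ltr_cos ?in_itv /= -?pmulrn -?leNgt; first by nra.
  - by apply/andP; split; nra.
  - by apply/andP; split; nra.
have one_le : 1 <= cabs (1 - zeta n).
  apply: le_trans (normr_Re_le _); rewrite ReB /= ler_normr; apply/orP; left.
  by rewrite lerBrDl -lerBrDr subrr.
apply: (@le_trans _ _ L%:R); first by rewrite -natrM ler_nat mulnC.
by rewrite /chordal ler_peMr // ltW.
Qed.

Lemma centered_residue u : exists v k, u = v + k * L%:Z /\ (`|v| * 2 <= L)%N.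
Proof.
have L0 : L%:Z != 0 by lia.
have := divz_eq u L; have := modz_ge0 u L0; have := ltz_pmod u (_ : 0 < L%:Z).
set r := (u %% L)%Z; set q := (u %/ L)%Z => /(_ ltac:(lia)) h1 h2 h3.
have [small|big] := leqP (`|r| * 2) L; first by exists r, q; split=> //; lia.
exists (r - L%:Z), (q + 1); split; last by lia.
by rewrite h3 mulrDl; ring.
Qed.

Lemma chord_eq0 u : chordal u = 0 -> (L%:Z %| u)%Z.
Proof.
have [v [k [-> vL]]] := centered_residue u; rewrite chord_period => v0.
have := chord_ge vL; rewrite v0 -natrM (ler_nat R _ 0) leqn0 muln_eq0 /= absz_eq0.
by move=> /eqP ->; rewrite add0r dvdz_mull.
Qed.

Lemma zeta_geom u p : (1 - zeta u) * \sum_(m < p) zeta (u * m%:Z) = 1 - zeta (u * p%:Z).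
Proof.
elim: p => [|p IH]; first by rewrite big_ord0 mulr0 mulr0 zeta0 subrr.
rewrite big_ord_recr /= mulrDr IH intS mulrDr mulr1 addrC zetaD.
by ring.
Qed.

Lemma sum_zeta u : \sum_(n < L) zeta (n%:Z * u) = if (L%:Z %| u)%Z then L%:R else 0.
Proof.
under eq_bigr do rewrite mulrC.
case: ifPn => [/dvdzP[k ->]|ndvd].
  rewrite (eq_bigr (fun=> 1)) ?sumr_const ?card_ord // => i _.
  by rewrite mulrAC -[k * i * _]add0r zeta_period zeta0.
have := zeta_geom u L; rewrite -[u * L]add0r zeta_period zeta0 subrr => /eqP.
rewrite mulf_eq0 => /orP[/eqP h|/eqP //].
by move/negP: ndvd; case; apply: chord_eq0; rewrite /chordal h cabs0 mulr0.
Qed.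

(* Frequencies that agree modulo [L] may repeat among the [p i]. *)
Lemma parseval_le I (r : seq I) (a : I -> R[i]) (p : I -> int) :
  \sum_(n < L) cabs (\sum_(i <- r) a i * zeta (n%:Z * p i)) ^+ 2 <=
  L%:R * \sum_(i <- r) \sum_(j <- r | (L%:Z %| p i - p j)%Z)
    cabs (a i) * cabs (a j).
Proof.
set S := \sum_(n < L) _.
have S0 : 0 <= S by apply: sumr_ge0 => n _; exact: sqr_ge0.
have SE : S%:C = \sum_(i <- r) \sum_(j <- r | (L%:Z %| p i - p j)%Z)
    a i * conjc (a j) * L%:R.
  pose G n i j : R[i] := a i * conjc (a j) * zeta (n%:Z * (p i - p j)).
  transitivity (\sum_(n < L) \sum_(i <- r) \sum_(j <- r) G n i j).
    rewrite /S rmorph_sum; apply: eq_bigr => n _.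
    rewrite /= sqr_cabsE conjc_sum big_distrlr /=.
    apply: eq_bigr => i _; apply: eq_bigr => j _.
    by rewrite /G conjcM -zetaN mulrACA -zetaD -mulrN -mulrDr.
  rewrite exchange_big /=; apply: eq_bigr => i _.
  rewrite exchange_big [RHS]big_mkcond /=; apply: eq_bigr => j _.
  by rewrite /G -mulr_sumr sum_zeta; case: ifP; rewrite ?mulr0.
rewrite -(ger0_norm S0) -cabs_real SE mulr_sumr.
apply: le_trans (cabs_sum _ _ _) _; apply: ler_sum => i _; rewrite mulr_sumr.
apply: le_trans (cabs_sum _ _ _) _; apply: ler_sum => j _.
rewrite !cabsM cabs_conj [X in _ * X](_ : _ = L%:R) 1?mulrC //.
by rewrite -(rmorph_nat (real_complex R)) cabs_real normr_nat.
Qed.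

End RootsOfUnity.
Arguments zeta : simpl never.

(** * Calderon-Zygmund decomposition on the grid *)

Section CalderonZygmund.
Variables (R : realType) (g : nat -> R[i]) (lam : R).
Hypothesis lam_gt0 : 0 < lam.

Let lam_ge0 : 0 <= lam. Proof. exact: ltW. Qed.

(* Each stopped interval I is recorded pointwise: on I, [D] is the length of I,
   [sig] its left end and [b] the mean of [g]; elsewhere [D = 0], [sig c = c]
   and [b = g].  The list [O] enumerates the union of the tripled intervals. *)
Record cz_spec (a n : nat) (D sig : nat -> nat) (b : nat -> R[i])
    (O : seq int) : Prop := CZSpec {
  cz_bound : forall c, (a <= c < a + n)%N -> cabs (b c) <= 2 * lam;
  cz_norm1 : \sum_(a <= c < a + n) cabs (b c) <= \sum_(a <= c < a + n) cabs (g c);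
  cz_mean0 : forall H : nat -> R[i],
    \sum_(a <= c < a + n) H (sig c) * (g c - b c) = 0;
  cz_sig : forall c, (a <= c < a + n)%N ->
    (a <= sig c)%N && (sig c <= c <= sig c + D c)%N;
  cz_packing : forall (u v : int) (t : nat),
    \sum_(a <= c < a + n | (u <= c%:Z < v) && (D c <= t)%N) cabs (g c) <=
    2 * lam * \sum_(a <= c < a + n | (u <= c%:Z + t%:Z) && (c%:Z < v + t%:Z)) 1;
  cz_size : (size O)%:R * lam <= 3 * \sum_(a <= c < a + n) cabs (g c);
  cz_far : forall x : int, x \notin O -> forall c, (a <= c < a + n)%N ->
    (D c <= `|x - c%:Z|)%N /\ (D c <= `|x - (sig c)%:Z|)%N }.

(** Every clause is pointwise or additive over the interval, so data on adjacent intervals are glued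
    by a case distinction on [c < a + n]. *)
Lemma cz_glue a n m D1 sig1 b1 O1 D2 sig2 b2 O2 :
  cz_spec a n D1 sig1 b1 O1 -> cz_spec (a + n) m D2 sig2 b2 O2 ->
  exists D sig b O, cz_spec a (n + m) D sig b O.
Proof.
move=> s1 s2; set k := (a + n)%N.
exists (fun c => if (c < k)%N then D1 c else D2 c).
exists (fun c => if (c < k)%N then sig1 c else sig2 c).
exists (fun c => if (c < k)%N then b1 c else b2 c).
exists (O1 ++ O2).
have inside c : (a <= c < a + (n + m))%N ->
    if (c < k)%N then (a <= c < a + n)%N else (a + n <= c < a + n + m)%N.
  by rewrite /k; case: (ltnP c (a + n)) => h; lia.
have split_sum (V : nmodType) (F1 F2 : nat -> V)
    (P1 P2 : pred nat) :
    \sum_(a <= c < a + (n + m) | (if (c < k)%N then P1 c else P2 c))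
      (if (c < k)%N then F1 c else F2 c) =
    \sum_(a <= c < a + n | P1 c) F1 c + \sum_(a + n <= c < a + n + m | P2 c) F2 c.
  rewrite (@big_cat_nat _ _ _ (a + n)) ?leq_addr ?addnA //=; last lia.
  congr (_ + _); rewrite big_nat_cond [RHS]big_nat_cond; apply: eq_big => c.
  - by rewrite /k; case: (ltnP c (a + n)) => //; rewrite ?andbF.
  - by rewrite /k => /andP[/andP[_ ->]].
  - by rewrite /k; case: (leqP (a + n) c) => //; rewrite ?andbF.
  - by move=> /andP[/andP[kc _] _]; rewrite /k ltnNge kc.
have split_sumT (V : nmodType) (F1 F2 : nat -> V) :
    \sum_(a <= c < a + (n + m)) (if (c < k)%N then F1 c else F2 c) =
    \sum_(a <= c < a + n) F1 c + \sum_(a + n <= c < a + n + m) F2 c.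
  by rewrite -split_sum; apply: eq_bigl => c; case: ifP.
have cat_sum (F : nat -> R) P0 : \sum_(a <= c < a + (n + m) | P0 c) F c =
    \sum_(a <= c < a + n | P0 c) F c + \sum_(a + n <= c < a + n + m | P0 c) F c.
  by rewrite (@big_cat_nat _ _ _ (a + n)) ?leq_addr ?addnA //=; lia.
split.
- move=> c /inside; case: ifP => _; [exact: (cz_bound s1)|exact: (cz_bound s2)].
- under eq_bigr do rewrite (fun_if (fun z => cabs z)).
  rewrite (split_sumT _ (fun c => cabs (b1 c)) (fun c => cabs (b2 c))) cat_sum.
  by apply: lerD; [exact: cz_norm1 s1|exact: cz_norm1 s2].
- move=> H.
  have := split_sumT _ (fun c => H (sig1 c) * (g c - b1 c))
    (fun c => H (sig2 c) * (g c - b2 c)).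
  rewrite (cz_mean0 s1) (cz_mean0 s2) addr0 => sum0; rewrite -[RHS]sum0.
  by apply: eq_bigr => c _; case: ifP.
- move=> c /inside; case: ifP => _; first exact: (cz_sig s1).
  by move=> /(cz_sig s2); lia.
- move=> u v t; rewrite [X in _ <= _ * X]cat_sum mulrDr.
  apply: le_trans (lerD (cz_packing s1 u v t) (cz_packing s2 u v t)).
  rewrite -split_sum le_eqVlt; apply/orP; left; apply/eqP.
  by apply: eq_big => c; [case: ifP|rewrite if_same].
- rewrite size_cat natrD mulrDl cat_sum mulrDr.
  by apply: lerD; [exact: cz_size s1|exact: cz_size s2].
- move=> x; rewrite mem_cat negb_or => /andP[x1 x2] c /inside.
  by case: ifP => _; [exact: (cz_far s1)|exact: (cz_far s2)].
Qed.

(** The stopping case: [b] is the mean of [g] on the whole interval. The lower bound on the mean of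
    [|g|] pays for the tripled interval; the upper one bounds [b] and gives the packing. *)
Lemma cz_stop a n : lam * n%:R < \sum_(a <= c < a + n) cabs (g c) ->
  \sum_(a <= c < a + n) cabs (g c) <= 2 * lam * n%:R ->
  exists D sig b O, cz_spec a n D sig b O.
Proof.
move=> lo hi.
have n0 : (0 < n)%N.
  by rewrite lt0n; apply/negP => /eqP n0; move: lo; rewrite n0 addn0 big_geq // mulr0 ltxx.
have nr0 : 0 < n%:R :> R by rewrite ltr0n.
have sum_const (V : nmodType) (x : V) : \sum_(a <= c < a + n) x = x *+ n.
  by rewrite sumr_const_nat addKn.
set mean : R[i] := (n%:R^-1)%:C * \sum_(a <= c < a + n) g c.
have mean_le : n%:R * cabs mean <= \sum_(a <= c < a + n) cabs (g c).
  rewrite cabs_realM ?invr_ge0 ?ler0n // mulrA divff ?gt_eqF // mul1r.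
  exact: cabs_sum.
exists (fun=> n), (fun=> a), (fun=> mean).
exists [seq (a%:Z - n%:Z + i%:Z)%R | i <- iota 0 (3 * n)].
split.
- move=> c _; rewrite -(ler_pM2l nr0); apply: le_trans mean_le _.
  by rewrite mulrC.
- by rewrite sum_const -mulr_natl.
- move=> H; rewrite -mulr_sumr sumrB sum_const -mulr_natl /mean mulrA.
  rewrite -(rmorph_nat (real_complex R)) -rmorphM divff ?gt_eqF //.
  by rewrite rmorph1 mul1r subrr mulr0.
- by move=> c hc; lia.
- move=> u v t.
  (* An interval longer than [t] does not enter the packing sum; one of length at most [t] that
     meets the window lies in the window enlarged by [t]. *)
  have [big_t|small_t] := leqP n t; last first.
    rewrite big_pred0; last by move=> c; rewrite andbF.
    by rewrite mulr_ge0 ?sumr_ge0 // mulr_ge0.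
  have [/hasP[c0 c0in /andP[c0uv _]]|/hasPn none] :=
      boolP (has (fun c => (u <= c%:Z < v) && true) (index_iota a (a + n))).
    rewrite [X in _ <= _ * X](_ : _ = n%:R).
      apply: le_trans hi; rewrite [leRHS](bigID (fun c => (u <= c%:Z < v) && true)) /=.
      by rewrite lerDl sumr_ge0 // => c _; exact: cabs_ge0.
    rewrite -[RHS]sum_const big_nat_cond [RHS]big_nat_cond; apply: eq_bigl => c.
    by move: c0in c0uv; rewrite mem_index_iota andbT; case: (boolP (a <= c < a + n)%N) => //=; lia.
  rewrite big_nat_cond big_pred0; last first.
    move=> c; apply/negP => /andP[cin cuv].
    by have := none c; rewrite mem_index_iota cin cuv => /(_ isT).
  by rewrite mulr_ge0 ?sumr_ge0 // mulr_ge0.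
- rewrite size_map size_iota natrM -mulrA ler_pM2l // mulrC.
  exact: ltW.
- move=> x xO c hc.
  suff : (x < a%:Z - n%:Z) || (a%:Z + 2 * n%:Z <= x) by lia.
  apply: contraR xO; rewrite negb_or -leNgt -ltNge => /andP[h1 h2].
  apply/mapP; exists (absz (x - (a%:Z - n%:Z))%R); last lia.
  by rewrite mem_iota; lia.
Qed.

(** Stopping time on dyadic halving. A parent mean of at most [lam] forces both halves to have mean
    at most [2 lam], so each half is either stopped or split again. Points that are never stopped
    satisfy [|g c| <= lam] and keep [D c = 0]. *)
Lemma cz_decomposition s a :
  \sum_(a <= c < a + 2 ^ s) cabs (g c) <= lam * (2 ^ s)%:R ->
  exists D sig b O, cz_spec a (2 ^ s) D sig b O.
Proof.
elim: s a => [|s IH] a.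
  rewrite expn0 addn1 big_nat1 mulr1 => ga.
  exists (fun=> 0%N), id, g, [::]; split => //.
  - move=> c hc; have -> : c = a by lia.
    by apply: le_trans ga _; rewrite ler_peMl // ler1n.
  - by move=> H; apply: big1 => c _; rewrite subrr mulr0.
  - by move=> c hc; rewrite /= addn0 leqnn; lia.
  - move=> u v t; have single (P : pred nat) (F : nat -> R) :
        \sum_(a <= c < a.+1 | P c) F c = if P a then F a else 0.
      by rewrite big_mkcond big_nat1.
    rewrite addn1 !single.
    case: ifPn => [/andP[uv _]|_]; last first.
      by rewrite mulr_ge0 ?mulr_ge0 //; case: ifP.
    rewrite ifT; last lia.
    by rewrite mulr1; apply: le_trans ga _; rewrite ler_peMl // ler1n.
  - by rewrite mul0r mulr_ge0 // sumr_ge0 // => c _; exact: cabs_ge0.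
have half x : \sum_(x <= c < x + 2 ^ s) cabs (g c) <= 2 * lam * (2 ^ s)%:R ->
    exists D sig b O, cz_spec x (2 ^ s) D sig b O.
  by move=> hi; case: (leP (\sum_(x <= c < x + 2 ^ s) cabs (g c)) (lam * (2 ^ s)%:R)) => [/IH|/cz_stop] //; exact.
have nonneg x y : 0 <= \sum_(x <= c < y) cabs (g c).
  by apply: sumr_ge0 => c _; exact: cabs_ge0.
rewrite expnS mul2n -addnn => tot.
have tot' : \sum_(a <= c < a + 2 ^ s) cabs (g c) +
    \sum_(a + 2 ^ s <= c < a + 2 ^ s + 2 ^ s) cabs (g c) <= 2 * lam * (2 ^ s)%:R.
  rewrite -big_cat_nat ?leq_addr //= -addnA (le_trans tot) //.
  by rewrite natrD; lra.
have [D1 [g1 [b1 [l1 s1]]]] := half a ltac:(have := nonneg (a + 2 ^ s)%N (a + 2 ^ s + 2 ^ s)%N; lra).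
have [D2 [g2 [b2 [l2 s2]]]] := half (a + 2 ^ s)%N ltac:(have := nonneg a (a + 2 ^ s)%N; lra).
exact: cz_glue s1 s2.
Qed.

End CalderonZygmund.

Lemma count_int_interval (R : realType) (n : nat) (u v : int) :
  \sum_(0 <= c < n | (u <= c%:Z) && (c%:Z < v)) 1 <= `|v - u|%N%:R :> R.
Proof.
rewrite big_const_seq iter_addr addr0 ler_nat.
have [uv|vu] := leP u v; last first.
  by rewrite (eq_count (a2 := pred0)) ?count_pred0 // => c /=; apply/negP; lia.
rewrite -size_filter -(size_map (fun c : nat => absz (c%:Z - u))).
rewrite -[leqRHS](size_iota 0); apply: uniq_leq_size.
  rewrite map_inj_in_uniq ?filter_uniq ?iota_uniq // => c d.
  by rewrite !mem_filter => /andP[/andP[? ?] _] /andP[/andP[? ?] _]; lia.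
move=> _ /mapP[c + ->]; rewrite mem_filter mem_iota => /andP[/andP[? ?] _].
by lia.
Qed.

(** * Chordal balls and Lorentzian sums on the cyclic grid *)

Section Grid.
Variables (R : realType) (l : nat).
Let L := (2 ^ l)%N.
Implicit Types (y : 'I_L) (r t eta : nat).
Notation chord := (chordal R L).

Let L_gt0 : (0 < L)%N. Proof. by rewrite expn_gt0. Qed.

(** A ball of the cyclic distance lifts to three windows of integers: [y - c] lies strictly between
    [- L] and [L], so at most one period is wrapped in either direction. *)
Lemma sum_chord_ball (y : 'I_L) r (P : pred 'I_L) (F : 'I_L -> R) :
  (forall c, 0 <= F c) ->
  \sum_(c < L | (chord (y%:Z - c%:Z) < 2 * r%:R) && P c) F c <=
  \sum_(k <- [:: -1; 0; 1 : int])
    \sum_(c < L | (y%:Z - k * L%:Z - r%:Z + 1 <= c%:Z < y%:Z - k * L%:Z + r%:Z)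
                  && P c) F c.
Proof.
move=> F0; under [leRHS]eq_bigr do rewrite big_mkcond /=.
rewrite exchange_big big_mkcond /=; apply: ler_sum => c _.
have terms k : 0 <= (if (y%:Z - k * L%:Z - r%:Z + 1 <= c%:Z < y%:Z - k * L%:Z + r%:Z)
    && P c then F c else 0) by case: ifP.
case: ifPn => [/andP[near Pc]|_]; last by apply: sumr_ge0.
have [v [k [vk vL]]] := centered_residue R L_gt0 (y%:Z - c%:Z).
have vr : (`|v| < r)%N.
  rewrite -(@ltr_nat R); move: near; rewrite vk chord_period //.
  by have := chord_ge R L_gt0 vL; lra.
have inwin : y%:Z - k * L%:Z - r%:Z + 1 <= c%:Z < y%:Z - k * L%:Z + r%:Z.
  by lia.
have kin : k \in [:: -1; 0; 1 : int].
  rewrite !inE; have := ltn_ord y; have := ltn_ord c.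
  case: (ltrgtP k 0) => [k0|k0|->]; last by [].
    have [->//|kn] := eqVneq k (-1); have : k <= -2 by lia.
    by nia.
  have [->//|?] := eqVneq k 1; have : 2 <= k by lia.
  by nia.
rewrite (big_rem k) //= [X in X + _]ifT ?inwin // lerDl.
by apply: sumr_ge0 => k' _; exact: terms.
Qed.

Lemma card_chord_ball (y : 'I_L) r :
  \sum_(c < L | chord (y%:Z - c%:Z) < 2 * r%:R) 1 <= 6 * r%:R :> R.
Proof.
have [->|r0] := posnP r.
  by rewrite !mulr0 big_pred0 // => c; rewrite ltNge chord_ge0.
have := @sum_chord_ball y r xpredT (fun=> 1) (fun=> ler01).
under eq_bigl do rewrite andbT.
move=> /le_trans; apply.
apply: (@le_trans _ _ (\sum_(k <- [:: -1; 0; 1 : int]) 2 * r%:R)); last first.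
  by rewrite !big_cons big_nil; lra.
apply: ler_sum => k _; under eq_bigl do rewrite andbT.
rewrite -(big_mkord (fun c => (_ <= Posz c) && (Posz c < _)) (fun=> 1)).
apply: le_trans (count_int_interval _ _ _ _) _.
by rewrite -natrM ler_nat; lia.
Qed.

(** Only the smallest dyadic ball containing [x] matters: outside the ball of index [i], the kernel
    is at most the single term [(eta * 4 ^ i.+1)^-1]. *)
Lemma lorentz_le_dyadic (eta : nat) (x : R) K : (0 < eta)%N -> 0 <= x ->
  x < 2 * (2 ^ K * eta)%:R ->
  eta%:R / (eta%:R ^+ 2 + x ^+ 2) <=
  \sum_(i < K.+1) (if x < 2 * (2 ^ i * eta)%:R
                   then (eta%:R * 4 ^+ i)^-1 else 0).
Proof.
move=> e0 x0; have er0 : 0 < eta%:R :> R by rewrite ltr0n.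
have den : 0 < eta%:R ^+ 2 + x ^+ 2 by rewrite ltr_wpDr ?exprn_gt0 ?sqr_ge0.
elim: K => [|K IH] xK.
  rewrite big_ord1 /= xK expr0 mulr1 ler_pdivrMr // mulrC ler_pdivlMr //.
  by rewrite -expr2 lerDl sqr_ge0.
rewrite big_ord_recr /=.
have [small|big] := ltP x (2 * (2 ^ K * eta)%:R).
  by apply: le_trans (IH small) _; rewrite lerDl; case: ifP => // _;
     rewrite invr_ge0 mulr_ge0 ?exprn_ge0.
rewrite xK; apply: ler_wpDl.
  by apply: sumr_ge0 => i _; case: ifP => // _; rewrite invr_ge0 mulr_ge0 ?exprn_ge0.
rewrite ler_pdivrMr // mulrC ler_pdivlMr ?mulr_gt0 ?exprn_gt0 //.
have big' : 2 ^+ K.+1 * eta%:R <= x.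
  by move: big; rewrite natrM natrX exprS -mulrA.
have : (2 ^+ K.+1 * eta%:R) ^+ 2 <= x ^+ 2.
  by rewrite ler_pXn2r ?nnegrE // mulr_ge0 ?exprn_ge0 ?ler0n.
rewrite exprMn -exprM mulnC exprM (_ : 2 ^+ 2 = 4 :> R); last by ring.
by have := sqr_ge0 (eta%:R : R); rewrite !expr2; lra.
Qed.

(* Dyadic summation over annuli. *)
Lemma sum_lorentz_le (y : 'I_L) (gam : 'I_L -> R) (B : R) eta :
  (0 < eta)%N -> (forall c, 0 <= gam c) ->
  (forall r, \sum_(c < L | chord (y%:Z - c%:Z) < 2 * r%:R) gam c <= B * r%:R) ->
  \sum_(c < L) gam c * (eta%:R / (eta%:R ^+ 2 + chord (y%:Z - c%:Z) ^+ 2)) <= 2 * B.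
Proof.
move=> e0 gam0 ball; have er0 : 0 < eta%:R :> R by rewrite ltr0n.
have B0 : 0 <= B.
  have h : 0 <= B * 1%:R by apply: le_trans (ball 1%N); apply: sumr_ge0.
  by rewrite mulr1 in h.
pose w i (c : 'I_L) : R := if chord (y%:Z - c%:Z) < 2 * (2 ^ i * eta)%:R
  then (eta%:R * 4 ^+ i)^-1 else 0.
(* Chords are at most [2 L], so the dyadic balls of index up to [l.+1] exhaust the grid. *)
apply: (@le_trans _ _ (\sum_(c < L) gam c * \sum_(i < l.+2) w i c)).
  apply: ler_sum => c _; apply: ler_wpM2l => //.
  apply: lorentz_le_dyadic => //; first exact: chord_ge0.
  have : chord (y%:Z - c%:Z) <= 2 * L%:R.
    rewrite /chord mulrC ler_wpM2r ?ler0n //.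
    by apply: le_trans (cabs_le_sub _ _) _; rewrite cabs1 cabs_zeta.
  move=> /le_lt_trans; apply.
  rewrite ltr_pM2l // ltr_nat expnS -/L.
  by have := e0; have := L_gt0; nia.
under eq_bigr do rewrite mulr_sumr.
rewrite exchange_big /=.
apply: (@le_trans _ _ (\sum_(i < l.+2) B / 2 ^+ i)).
  apply: ler_sum => i _; rewrite (eq_bigr (fun c : 'I_L =>
     (if chord (y%:Z - c%:Z) < 2 * (2 ^ i * eta)%:R then gam c else 0)
     * (eta%:R * 4 ^+ i)^-1)); last first.
    by move=> c _; rewrite /w; case: ifP; rewrite ?mulr0 ?mul0r.
  rewrite -mulr_suml -big_mkcond /= ler_pdivrMr ?mulr_gt0 ?exprn_gt0 //.
  apply: le_trans (ball _) _; rewrite natrM natrX.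
  rewrite (_ : 4 = 2 ^+ 2 :> R); last by ring.
  rewrite -exprM mulnC exprM expr2 le_eqVlt; apply/orP; left; apply/eqP.
  by field; rewrite expf_neq0.
rewrite -mulr_sumr mulrC ler_wpM2r //.
have : \sum_(i < l.+2) (2 ^+ i)^-1 = 2 - (2 ^+ l.+1)^-1 :> R.
  elim: l.+1 => [|n IH]; first by rewrite big_ord1 expr0 invr1; ring.
  by rewrite big_ord_recr /= IH exprS; field; rewrite expf_neq0.
by move=> ->; rewrite lerBlDr lerDl invr_ge0 exprn_ge0.
Qed.

End Grid.

Section GridDecomposition.
Variables (R : realType) (l : nat) (lam : R).
Let L := (2 ^ l)%N.
Hypothesis lam_gt0 : 0 < lam.
Notation chord := (chordal R L).

Let L_gt0 : (0 < L)%N. Proof. by rewrite expn_gt0. Qed.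
Let lam_ge0 : 0 <= lam. Proof. exact: ltW. Qed.

(** [cz_spec] carried over to the cyclic grid, with distances measured by [chordal]. The 2 in
    [czg_far] is the constant of [chord_ge]; the 12 in [czg_packing] is 4 for each of the three
    windows of [sum_chord_ball]. *)
Record cz_grid (g : 'I_L -> R[i]) (D : 'I_L -> nat) (sig : 'I_L -> int)
    (b : 'I_L -> R[i]) (Om : {set 'I_L}) : Prop := CZGrid {
  czg_bound : forall c, cabs (b c) <= 2 * lam;
  czg_norm1 : \sum_c cabs (b c) <= \sum_c cabs (g c);
  czg_mean0 : forall H : int -> R[i], \sum_c H (sig c) * (g c - b c) = 0;
  czg_sig : forall c : 'I_L, (`|c%:Z - sig c| <= D c)%N;
  czg_packing : forall (y : 'I_L) (r t : nat),
    \sum_(c : 'I_L | (chord (y%:Z - c%:Z) < 2 * r%:R) && (D c <= t)%N) cabs (g c) <=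
    12 * lam * (r%:R + t%:R);
  czg_size : #|Om|%:R * lam <= 3 * \sum_c cabs (g c);
  czg_far : forall x : 'I_L, x \notin Om -> forall c,
    2 * (D c)%:R <= chord (x%:Z - c%:Z) /\ 2 * (D c)%:R <= chord (x%:Z - sig c) }.

Lemma cz_grid_exists (g : 'I_L -> R[i]) :
  \sum_c cabs (g c) <= lam * L%:R -> exists D sig b Om, cz_grid g D sig b Om.
Proof.
move=> small; pose G n := oapp g 0 (insub n).
have GE (c : 'I_L) : G c = g c by rewrite /G valK.
have sumG : \sum_(0 <= c < 0 + L) cabs (G c) = \sum_c cabs (g c).
  by rewrite add0n big_mkord; apply: eq_bigr => c _; rewrite GE.
have [D [sig [b [ O s]]]] : exists D sig b O, cz_spec G lam 0 L D sig b O.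
  by apply: cz_decomposition => //; rewrite sumG.
(* Tripled intervals may stick out of [[0, L)], by less than one period; they are wrapped around.
   The size bound survives because every element of [Om] is the residue of an element of [O]. *)
pose Om := [set x : 'I_L | [|| x%:Z \in O, x%:Z + L%:Z \in O | x%:Z - L%:Z \in O]].
have inL (c : 'I_L) : (0 <= c < 0 + L)%N by rewrite add0n ltn_ord.
exists (fun c => D c), (fun c => (sig c)%:Z), (fun c => b c), Om; split.
- by move=> c; apply: (cz_bound s).
- by have := cz_norm1 s; rewrite sumG add0n big_mkord.
- move=> H; have := cz_mean0 s (fun n => H n%:Z); rewrite add0n big_mkord.
  by under eq_bigr do rewrite GE.
- by move=> c; have := cz_sig s (inL c); lia.
- move=> y r t.
  have [->|r0] := posnP r.
    rewrite big_pred0; last by move=> c; rewrite mulr0 ltNge chord_ge0.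
    by rewrite mulr_ge0 ?addr_ge0 ?ler0n // mulr_ge0.
  apply: le_trans (sum_chord_ball _ _ _ _) _; first by move=> c; exact: cabs_ge0.
  apply: (@le_trans _ _ (\sum_(k <- [:: -1; 0; 1 : int]) 4 * lam * (r%:R + t%:R))).
    apply: ler_sum => k _; set u := (y%:Z - k * L%:Z - r%:Z + 1); set v := _ + r%:Z.
    have := cz_packing s u v t; rewrite !add0n !big_mkord.
    under eq_bigr do rewrite GE.
    move=> /le_trans; apply.
    rewrite (_ : 4 * lam * _ = 2 * lam * (2 * (r%:R + t%:R))); last by ring.
    rewrite ler_wpM2l ?mulr_ge0 //.
    rewrite -(big_mkord (fun c => (u <= c%:Z + t%:Z) && (c%:Z < v + t%:Z)) (fun=> 1)).
    under eq_bigl do rewrite -lerBlDr.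
    apply: le_trans (count_int_interval _ _ _ _) _.
    by rewrite -natrD -natrM ler_nat /u /v -/L; lia.
  by rewrite !big_cons big_nil; lra.
- have := cz_size s; rewrite sumG; apply: le_trans.
  rewrite ler_pM2r // ler_nat -(size_map (fun o => (o %% L%:Z)%Z) O).
  rewrite cardE -(size_map (fun x : 'I_L => x%:Z)); apply: uniq_leq_size.
    by rewrite map_inj_uniq ?enum_uniq // => x1 x2 [] /val_inj.
  move=> _ /mapP[x + ->]; rewrite mem_enum inE => xO; apply/mapP.
  have xmod (k : int) : (x%:Z = (x%:Z + k * L%:Z) %% L%:Z)%Z.
    by rewrite addrC modzMDl modz_nat modn_small.
  case/or3P: xO => xO; first by exists x%:Z => //; have := xmod 0; rewrite mul0r addr0.
    by exists (x%:Z + L%:Z) => //; have := xmod 1; rewrite mul1r.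
  by exists (x%:Z - L%:Z) => //; have := xmod (-1); rewrite mulN1r.
- move=> x; rewrite inE !negb_or => /and3P[x0 x1 x2] c.
  suff far (d : int) (e : nat) :
      (e <= `|x%:Z - d|)%N -> (e <= absz (x%:Z + L%:Z - d)%R)%N ->
      (e <= absz (x%:Z - L%:Z - d)%R)%N -> -1 <= d <= L%:Z ->
      2 * e%:R <= chord (x%:Z - d).
    have sig_in : -1 <= (sig c)%:Z <= L%:Z.
      by have := cz_sig s (inL c); have := ltn_ord c; lia.
    split; apply: far; rewrite ?(proj1 (cz_far s _ _)) ?(proj2 (cz_far s _ _)) //.
    by have := ltn_ord c; lia.
  move=> e0 e1 e2 dL.
  have [v [k [vk vL]]] := centered_residue R L_gt0 (x%:Z - d).
  rewrite vk chord_period //; apply: le_trans (chord_ge R L_gt0 vL).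
  rewrite ler_pM2l // ler_nat.
  have := ltn_ord x; rewrite -/L => xL.
  have : k = 0 \/ k = 1 \/ k = -1 by nia.
  by case=> [k0|[k0|k0]]; subst k; lia.
Qed.

End GridDecomposition.

(** * Oscillation of partial sums on the grid *)

Section FejerKernel.
Variables (R : realType) (L : nat).
Hypothesis L_gt0 : (0 < L)%N.
Notation zeta := (zeta R L).
Notation chord := (chordal R L).

(** The kernel of the Cesaro means of [psum]: its coefficient at [m] is [(N - m) / (L N)] for
    [0 <= m < N]. It is the analytic half of the Fejer kernel, hence complex valued. *)
Definition fejer_kernel (N : nat) (u : int) : R[i] :=
  ((L%:R * N%:R)^-1)%:C * \sum_(p < N) \sum_(m < p.+1) zeta (u * m%:Z).

Lemma cabs_zetaB_mul u v (n : nat) :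
  cabs (zeta (u * n%:Z) - zeta (v * n%:Z)) <= n%:R * cabs (zeta u - zeta v).
Proof.
elim: n => [|n IH]; first by rewrite !mulr0 subrr cabs0 mul0r.
have -> : zeta (u * n.+1%:Z) - zeta (v * n.+1%:Z) =
    zeta (u * n%:Z) * (zeta u - zeta v) + (zeta (u * n%:Z) - zeta (v * n%:Z)) * zeta v.
  by rewrite intS !mulrDr !mulr1 !zetaD; ring.
apply: le_trans (cabs_le_add _ _) _; rewrite !cabsM !cabs_zeta mul1r mulr1.
by rewrite -natr1 mulrDl mul1r addrC lerD2r.
Qed.

(** Hormander regularity, uniform in [N]. Multiplying by [(1 - zeta u) (1 - zeta v)] and summing the
    geometric series twice leaves differences of equal powers of [zeta u] and [zeta v], whose bounds
    add up to [4 N + 2 <= 6 N] times [|zeta u - zeta v|]. *)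
Lemma fejer_kernel_smooth (N : nat) (u v : int) : (0 < N)%N ->
  cabs (fejer_kernel N u - fejer_kernel N v) * (chord u * chord v) <= 6 * chord (u - v).
Proof.
move=> N0; set A := fun u => \sum_(p < N) \sum_(m < p.+1) zeta (u * m%:Z).
pose S u := \sum_(p < N) zeta (u * p.+1%:Z).
have AE w : (1 - zeta w) * A w = N%:R - S w.
  rewrite /A mulr_sumr; under eq_bigr do rewrite zeta_geom.
  by rewrite sumrB sumr_const card_ord.
have SE w : (1 - zeta w) * S w = zeta w - zeta (w * N.+1%:Z).
  rewrite /S; under eq_bigr do rewrite intS mulrDr mulr1 zetaD.
  by rewrite -mulr_sumr mulrCA zeta_geom mulrBr mulr1 intS mulrDr mulr1 zetaD.
have SN w : cabs (S w) <= N%:R.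
  apply: le_trans (cabs_sum _ _ _) _; under eq_bigr do rewrite cabs_zeta.
  by rewrite sumr_const card_ord.
set d := cabs (zeta u - zeta v).
have main : cabs ((1 - zeta u) * (1 - zeta v) * (A u - A v)) <= 6 * N%:R * d.
  have -> : (1 - zeta u) * (1 - zeta v) * (A u - A v) =
      (N%:R - S u) * (zeta u - zeta v) + S v * (zeta v - zeta u)
      + ((zeta v - zeta u) + (zeta (u * N.+1%:Z) - zeta (v * N.+1%:Z))).
    transitivity ((1 - zeta v) * ((1 - zeta u) * A u) -
                  (1 - zeta u) * ((1 - zeta v) * A v)); first by ring.
    rewrite !AE.
    transitivity ((N%:R - S u) * (zeta u - zeta v) + S v * (zeta v - zeta u)
        + ((1 - zeta v) * S v - (1 - zeta u) * S u)); first by ring.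
    by rewrite !SE; ring.
  apply: le_trans (cabs_le_add _ _) _.
  have h1 : cabs ((N%:R - S u) * (zeta u - zeta v)) <= 2 * N%:R * d.
    rewrite cabsM ler_wpM2r ?cabs_ge0 //; apply: le_trans (cabs_le_sub _ _) _.
    rewrite -(rmorph_nat (real_complex R)) cabs_real normr_nat.
    by have := SN u; lra.
  have h2 : cabs (S v * (zeta v - zeta u)) <= N%:R * d.
    by rewrite cabsM cabs_subC ler_wpM2r ?cabs_ge0.
  have h3 : cabs ((zeta v - zeta u) + (zeta (u * N.+1%:Z) - zeta (v * N.+1%:Z)))
      <= d + N.+1%:R * d.
    apply: le_trans (cabs_le_add _ _) _.
    by rewrite cabs_subC lerD2l cabs_zetaB_mul.
  have := cabs_le_add ((N%:R - S u) * (zeta u - zeta v)) (S v * (zeta v - zeta u)).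
  have d0 : 0 <= d by exact: cabs_ge0.
  have N1 : 1 <= N%:R :> R by rewrite ler1n.
  by rewrite -natr1 in h3; nra.
have Lr : 0 < L%:R :> R by rewrite ltr0n.
have Nr : 0 < N%:R :> R by rewrite ltr0n.
rewrite /fejer_kernel -mulrBr cabs_realM ?invr_ge0 ?mulr_ge0 ?ler0n //.
rewrite -(chord_zetaB R) -/d {1}/chordal {1}/chordal.
move: main; rewrite !cabsM; set a := cabs (1 - _); set b := cabs (1 - _); set e := cabs (_ - _) => main.
have -> : (L%:R * N%:R)^-1 * e * (L%:R * a * (L%:R * b)) = (N%:R^-1 * L%:R) * (a * b * e).
  by field; rewrite !gt_eqF.
rewrite mulrC -ler_pdivlMr ?mulr_gt0 ?invr_gt0 //.
apply: le_trans main _; rewrite le_eqVlt; apply/orP; left; apply/eqP.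
by field; rewrite !gt_eqF.
Qed.

End FejerKernel.

Section ExceptionalSet.
Variables (R : realType) (l : nat) (lam : R).
Let L := (2 ^ l)%N.
Hypothesis lam_gt0 : 0 < lam.
Notation zeta := (zeta R L).
Notation chord := (chordal R L).
Let L_gt0 : (0 < L)%N. Proof. by rewrite expn_gt0. Qed.
Let lam_ge0 : 0 <= lam. Proof. exact: ltW. Qed.

(** The Marcinkiewicz integral of the stopped intervals with weight [gam]. It bounds, off the
    tripled intervals, what a regular kernel makes of a function with mean 0 on each of them. *)
Definition marcinkiewicz (D : 'I_L -> nat) (gam : 'I_L -> R) (x : 'I_L) : R :=
  \sum_(c < L) gam c * ((D c)%:R / chord (x%:Z - c%:Z) ^+ 2).

Lemma marcinkiewicz_ge0 D gam x : (forall c, 0 <= gam c) -> 0 <= marcinkiewicz D gam x.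
Proof.
move=> gam0; apply: sumr_ge0 => c _; apply: mulr_ge0 => //.
by apply: divr_ge0; rewrite ?ler0n ?sqr_ge0.
Qed.

Variables (g : 'I_L -> R[i]) (D : 'I_L -> nat) (sig : 'I_L -> int)
  (b : 'I_L -> R[i]) (Om : {set 'I_L}).
Hypothesis cz : cz_grid lam g D sig b Om.

(** A maximal function bound off [Om]: by [czg_far], [D c < r] at every point [c] of the ball, so
    the restriction on lengths in the packing bound with [t = r] excludes nothing. *)
Lemma ball_sum_le (x : 'I_L) (r : nat) : x \notin Om ->
  \sum_(c < L | chord (x%:Z - c%:Z) < 2 * r%:R) cabs (g c) <= 24 * lam * r%:R.
Proof.
move=> xOm; have := czg_packing cz x r r.
rewrite (_ : 12 * lam * (r%:R + r%:R) = 24 * lam * r%:R); last by ring.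
apply: le_trans; rewrite le_eqVlt; apply/orP; left; apply/eqP.
apply: eq_bigl => c; case: ltP => //= near; apply/esym.
rewrite -(ler_nat R); have [far _] := czg_far cz xOm c.
by lra.
Qed.

Lemma lorentz_sum_le (x : 'I_L) (eta : nat) : x \notin Om -> (0 < eta)%N ->
  \sum_(c < L) cabs (g c) * (eta%:R / (eta%:R ^+ 2 + chord (x%:Z - c%:Z) ^+ 2))
    <= 48 * lam.
Proof.
move=> xOm e0; have := @sum_lorentz_le R l x (fun c => cabs (g c)) (24 * lam) eta e0
  (fun c => cabs_ge0 _) (fun r => ball_sum_le r xOm).
by move=> /le_trans; apply; lra.
Qed.

(** Off [Om] the chord is at least [2 D], so [1 / chord ^ 2] is at most 5/4 of
    [1 / (D ^ 2 + chord ^ 2)]. The Lorentzian of width [D] sums to at most 12, hence 15. *)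
Lemma sum_marcinkiewicz_le (gam : 'I_L -> R) : (forall c, 0 <= gam c) ->
  \sum_(x < L | x \notin Om) marcinkiewicz D gam x <= 15 * \sum_(c < L) gam c.
Proof.
move=> gam0; rewrite /marcinkiewicz exchange_big /= mulr_sumr.
apply: ler_sum => c _; rewrite -mulr_sumr mulrC ler_wpM2r //.
have [D0|D0] := posnP (D c).
  by rewrite big1 // => x _; rewrite D0 mul0r.
have := @sum_lorentz_le R l c (fun=> 1) 6 (D c) D0 (fun=> ler01)
  (@card_chord_ball R l c).
move=> lor; apply: (@le_trans _ _ (5 / 4 *  \sum_(x < L) 1 * ((D c)%:R /
    ((D c)%:R ^+ 2 + chord (c%:Z - x%:Z) ^+ 2)))); last by lra.
rewrite mulr_sumr big_mkcond /=; apply: ler_sum => x _.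
rewrite mul1r [chord (c%:Z - _)]chord_subC.
have Dr : 0 < (D c)%:R :> R by rewrite ltr0n.
have den : 0 < (D c)%:R ^+ 2 + chord (x%:Z - c%:Z) ^+ 2.
  by rewrite ltr_wpDr ?exprn_gt0 ?sqr_ge0.
case: ifPn => [xOm|_]; last first.
  have den0 := ltW den; apply: mulr_ge0; first by lra.
  by apply: divr_ge0.
have [far _] := czg_far cz xOm c.
have ch0 : 0 < chord (x%:Z - c%:Z) by lra.
rewrite mulrCA ler_pM2l // ler_pdivlMr // mulrC ler_pdivrMr ?exprn_gt0 //.
by rewrite !expr2; nra.
Qed.

(** As [g - b] has mean 0 on each stopped interval, the kernel may be replaced by its difference
    with the value at the left end [sig c], which [fejer_kernel_smooth] controls. *)
Lemma bad_part_le (N : nat) (x : 'I_L) : (0 < N)%N -> x \notin Om ->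
  cabs (\sum_(c < L) fejer_kernel R L N (x%:Z - c%:Z) * (g c - b c)) <=
  240 * marcinkiewicz D (fun c => cabs (g c) + cabs (b c)) x.
Proof.
move=> N0 xOm.
have -> : \sum_(c < L) fejer_kernel R L N (x%:Z - c%:Z) * (g c - b c) =
    \sum_(c < L) (fejer_kernel R L N (x%:Z - c%:Z) -
                  fejer_kernel R L N (x%:Z - sig c)) * (g c - b c).
  under [RHS]eq_bigr do rewrite mulrBl.
  by rewrite sumrB (czg_mean0 cz (fun d => fejer_kernel R L N (x%:Z - d))) subr0.
apply: le_trans (cabs_sum _ _ _) _; rewrite mulr_sumr.
apply: ler_sum => c _; rewrite cabsM mulrC mulrCA.
apply: ler_pM; rewrite ?cabs_ge0 //; first exact: cabs_le_sub.
have sigc := czg_sig cz c.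
have [D0|D0] := posnP (D c).
  have -> : sig c = c%:Z.
    by apply/esym/eqP; rewrite -subr_eq0 -absz_eq0 -leqn0 -D0.
  by rewrite subrr cabs0 D0 mul0r mulr0.
have sigc' : (absz (sig c - c%:Z)%R <= D c)%N by rewrite -abszN opprB.
have [far far'] := czg_far cz xOm c.
have Dr : 0 < (D c)%:R :> R by rewrite ltr0n.
set u := chord (x%:Z - c%:Z) in far *; set v := chord (x%:Z - sig c) in far'.
(* From [2 D <= v] and a displacement of chord at most [8 D] follows [u <= 5 v]. The smoothness
   bound [6 * 8 D] on [k u v] then yields [240 D] on [k u ^ 2]. *)
have uv : u <= 5 * v.
  have : u <= v + chord (sig c - c%:Z).
    by rewrite /u (_ : x%:Z - c%:Z = (x%:Z - sig c) + (sig c - c%:Z)) ?chord_add //; ring.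
  have := chord_le R L_gt0 (sig c - c%:Z).
  have : `|sig c - c%:Z|%N%:R <= (D c)%:R :> R by rewrite ler_nat.
  by lra.
have := @fejer_kernel_smooth R L L_gt0 N (x%:Z - c%:Z) (x%:Z - sig c) N0.
rewrite -/u -/v; set k := cabs _ => smooth.
have : chord (x%:Z - c%:Z - (x%:Z - sig c)) <= 8 * (D c)%:R.
  have -> : x%:Z - c%:Z - (x%:Z - sig c) = sig c - c%:Z by ring.
  by apply: le_trans (chord_le R L_gt0 _) _; rewrite ler_pM2l // ler_nat.
move=> cD; rewrite mulrA ler_pdivlMr ?exprn_gt0 //; last by lra.
have k0 : 0 <= k by exact: cabs_ge0.
have : k * (u * v) <= 48 * (D c)%:R by lra.
have u0 : 0 <= u by apply: le_trans far; rewrite mulr_ge0 // ler0n.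
have : 0 <= k * u * (5 * v - u).
  by apply: mulr_ge0; [exact: mulr_ge0|rewrite subr_ge0].
by rewrite expr2; lra.
Qed.

End ExceptionalSet.

(** * One-sided partial sums and their Cesaro means *)

Section PartialSums.
Variables (R : realType) (L : nat).
Hypothesis L_gt0 : (0 < L)%N.
Notation zeta := (zeta R L).
Notation chord := (chordal R L).
Implicit Types (g b : 'I_L -> R[i]) (x : int).

Let Lr : 0 < L%:R :> R. Proof. by rewrite ltr0n. Qed.

(** The projection of a function on Z/L onto the frequencies [0, ..., p]. One-sided sums suffice
    because [side n] confines the first frequency to [[0, n]]. *)
Definition psum (p : nat) g x : R[i] :=
  (L%:R^-1)%:C * \sum_(c < L) g c * \sum_(m < p.+1) zeta ((x - c%:Z) * m%:Z).

Definition fmean (N : nat) g x : R[i] :=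
  (N%:R^-1)%:C * \sum_(p < N) psum p g x.

Lemma fmeanE N g x : fmean N g x = \sum_(c < L) fejer_kernel R L N (x - c%:Z) * g c.
Proof.
rewrite /fmean /psum /fejer_kernel -mulr_sumr exchange_big /= mulrA mulr_sumr.
apply: eq_bigr => c _; rewrite -mulr_sumr mulrCA mulrC; congr (_ * _ * _).
by rewrite -rmorphM invfM mulrC.
Qed.

Lemma psum_sum p I (r : seq I) (F : I -> 'I_L -> R[i]) x :
  psum p (fun c => \sum_(i <- r) F i c) x = \sum_(i <- r) psum p (F i) x.
Proof.
rewrite /psum -mulr_sumr; congr (_ * _); rewrite exchange_big /=.
by apply: eq_bigr => c _; rewrite mulr_suml.
Qed.

Lemma psumZ p (a : R[i]) g x : psum p (fun c => a * g c) x = a * psum p g x.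
Proof.
rewrite /psum mulrCA; congr (_ * _); rewrite mulr_sumr.
by apply: eq_bigr => c _; rewrite mulrA.
Qed.

Lemma parseval_inj (I : finType) (a : I -> R[i]) (p : I -> int) :
  (forall i j, (L%:Z %| p i - p j)%Z -> i = j) ->
  \sum_(n < L) cabs (\sum_i a i * zeta (n%:Z * p i)) ^+ 2 <=
  L%:R * \sum_i cabs (a i) ^+ 2.
Proof.
move=> inj; apply: le_trans (parseval_le L_gt0 _ _ _) _; rewrite ler_pM2l //.
apply: ler_sum => i _; rewrite (bigD1 i) /=; last by rewrite subrr dvdz0.
rewrite big1 ?addr0 // => j /andP[/inj -> ji].
by rewrite eqxx in ji.
Qed.

Lemma dvdz_ord_eq (n : nat) (i j : 'I_n) : (n <= L)%N -> (L%:Z %| i%:Z - j%:Z)%Z -> i = j.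
Proof.
move=> nL /dvdzP[k hk]; apply: val_inj => /=.
have := ltn_ord i; have := ltn_ord j => hj hi.
have : k = 0 by nia.
by move=> k0; move: hk; rewrite k0 mul0r; lia.
Qed.

Lemma psum_l2 p g : (p < L)%N ->
  \sum_(x < L) cabs (psum p g x) ^+ 2 <= \sum_(c < L) cabs (g c) ^+ 2.
Proof.
move=> pL; pose G (m : nat) := \sum_(c < L) g c * zeta (m%:Z * - c%:Z).
have psumE x : psum p g x =
    (L%:R^-1)%:C * \sum_(m < p.+1) G m * zeta (x * m%:Z).
  rewrite /psum; congr (_ * _); under eq_bigr do rewrite mulr_sumr.
  rewrite exchange_big /=; apply: eq_bigr => m _; rewrite mulr_suml.
  by apply: eq_bigr => c _; rewrite -mulrA -zetaD; congr (_ * zeta _); ring.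
have Li0 : 0 <= L%:R^-1 :> R by rewrite invr_ge0 ltW.
under eq_bigr do rewrite psumE cabs_realM // exprMn.
rewrite -mulr_sumr.
have step1 := @parseval_inj 'I_p.+1 (fun m => G m) (fun m => m%:Z)
  (fun i j => @dvdz_ord_eq _ i j pL).
have step2 := @parseval_inj 'I_L g (fun c => - c%:Z).
have inj2 i j : (L%:Z %| - (i : 'I_L)%:Z - - (j : 'I_L)%:Z)%Z -> i = j.
  by rewrite opprK addrC => /(@dvdz_ord_eq _ j i (leqnn _)).
have step3 : \sum_(m < p.+1) cabs (G m) ^+ 2 <= \sum_(m < L) cabs (G m) ^+ 2.
  rewrite (big_ord_widen _ (fun m => cabs (G m) ^+ 2) pL) big_mkcond /=.
  by apply: ler_sum => m _; case: ifP => // _; exact: sqr_ge0.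
have := step2 inj2; rewrite -/(G _) => step2'.
rewrite exprVn -mulrC ler_pdivrMr ?exprn_gt0 //.
apply: le_trans step1 _; rewrite mulrC expr2 mulrA ler_pM2r //.
by apply: le_trans step3 _; rewrite mulrC.
Qed.

(** The two-sided Fejer kernel. Unlike [fejer_kernel] it is nonnegative, and it has a pointwise
    Lorentzian bound. *)
Definition fejer (N : nat) (v : int) : R :=
  (L%:R * N%:R)^-1 * cabs (\sum_(p < N) zeta (v * p%:Z)) ^+ 2.

Lemma fejer_ge0 N v : 0 <= fejer N v.
Proof. by rewrite mulr_ge0 ?sqr_ge0 // invr_ge0 mulr_ge0. Qed.

(** The geometric sum [S] satisfies both [S <= N] and [S * chord <= 2 L]; with [L = 16 N eta] the
    two balance at width of order [eta]. *)
Lemma fejer_le (N eta : nat) (v : int) : (0 < N)%N -> (0 < eta)%N ->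
  (16 * N * eta = L)%N ->
  fejer N v <= 128 * (eta%:R / (eta%:R ^+ 2 + chord v ^+ 2)).
Proof.
move=> N0 e0 NeL.
have Nr : 0 < N%:R :> R by rewrite ltr0n.
have er : 0 < eta%:R :> R by rewrite ltr0n.
have LE : L%:R = 16 * N%:R * eta%:R :> R by rewrite -NeL !natrM.
have den : 0 < eta%:R ^+ 2 + chord v ^+ 2 by rewrite ltr_wpDr ?exprn_gt0 ?sqr_ge0.
set S := cabs (\sum_(p < N) zeta (v * p%:Z)).
have S0 : 0 <= S by exact: cabs_ge0.
have SN : S <= N%:R.
  apply: le_trans (cabs_sum _ _ _) _; under eq_bigr do rewrite cabs_zeta.
  by rewrite sumr_const card_ord.
have Sgeom : S * chord v <= 2 * L%:R.
  rewrite /chordal mulrCA mulrC ler_wpM2r ?ler0n // mulrC -cabsM zeta_geom.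
  by apply: le_trans (cabs_le_sub _ _) _; rewrite cabs1 cabs_zeta.
rewrite mulrA ler_pdivlMr // /fejer -/S -mulrA mulrC ler_pdivrMr ?mulr_gt0 //.
have h1 : S ^+ 2 <= N%:R ^+ 2 by rewrite ler_pXn2r ?nnegrE.
have h2 : (S * chord v) ^+ 2 <= (2 * L%:R) ^+ 2.
  apply: lerXn2r => //; rewrite nnegrE; apply: mulr_ge0.
  all: rewrite ?chord_ge0 ?ler0n //.
have h3 : eta%:R ^+ 2 * S ^+ 2 <= eta%:R ^+ 2 * N%:R ^+ 2.
  by rewrite ler_wpM2l ?sqr_ge0.
have h4 : 0 < eta%:R ^+ 2 * N%:R ^+ 2 :> R by rewrite mulr_gt0 ?exprn_gt0.
rewrite mulrDl; move: h2; rewrite exprMn (mulrC (S ^+ 2)) LE.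
rewrite [X in _ <= X -> _](_ : _ = 1024 * (eta%:R ^+ 2 * N%:R ^+ 2)); last by ring.
rewrite [X in _ -> _ <= X](_ : _ = 2048 * (eta%:R ^+ 2 * N%:R ^+ 2)); last by ring.
by lra.
Qed.

(** The Fejer multiplier [1 - |m| / N] vanishes beyond [N <= M], so cutting it to [[0, M)] gives the
    multiplier of [fejer_kernel]. The condition [M + M <= L] prevents [d - (p - q)] from wrapping
    around. *)
Lemma fejer_conv (M N : nat) (x c : int) : (0 < N)%N -> (N <= M)%N -> (M + M <= L)%N ->
  \sum_(y < L) (fejer N (x - y%:Z))%:C * \sum_(d < M) zeta ((y%:Z - c) * d%:Z) =
  L%:R * fejer_kernel R L N (x - c).
Proof.
move=> N0 NM ML.
pose G (p q : 'I_N) (d : 'I_M) (y : 'I_L) :=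
  zeta (x * (p%:Z - q%:Z) - c * d%:Z) * zeta (y%:Z * (d%:Z - (p%:Z - q%:Z))).
transitivity (((L%:R * N%:R)^-1)%:C * \sum_(p < N) \sum_(q < N) \sum_(d < M) \sum_(y < L) G p q d y).
  have fejE y : (fejer N (x - (y : 'I_L)%:Z))%:C = ((L%:R * N%:R)^-1)%:C *
      \sum_(p < N) \sum_(q < N) zeta ((x - y%:Z) * (p%:Z - q%:Z)).
    rewrite /fejer rmorphM /= sqr_cabsE conjc_sum big_distrlr; congr (_ * _).
    apply: eq_bigr => p _; apply: eq_bigr => q _.
    rewrite -zetaN; apply: etrans (esym (zetaD R L _ _)) _.
    by congr (zeta _); ring.
  under eq_bigr do rewrite fejE -mulrA.
  rewrite -mulr_sumr; congr (_ * _).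
  under eq_bigr do rewrite mulr_suml.
  rewrite exchange_big; apply: eq_bigr => p _.
  under eq_bigr do rewrite mulr_suml.
  rewrite exchange_big; apply: eq_bigr => q _.
  under eq_bigr do rewrite mulr_sumr.
  rewrite exchange_big; apply: eq_bigr => d _; apply: eq_bigr => y _.
  by rewrite /G -!zetaD; congr (zeta _); ring.
rewrite /fejer_kernel mulrCA; congr (_ * _); rewrite mulr_sumr.
apply: eq_bigr => p _.
have inner q : \sum_(d < M) \sum_(y < L) G p q d y =
    if (q <= p)%N then L%:R * zeta ((x - c) * (p%:Z - q%:Z)) else 0.
  rewrite /G; under eq_bigr do rewrite -mulr_sumr sum_zeta //.
  have pN := ltn_ord p; have qN := ltn_ord q.
  case: leqP => qp.
    have pqM : (p - q < M)%N by lia.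
    rewrite (bigD1 (Ordinal pqM)) //= ifT; last by rewrite subzn // subrr dvdz0.
    rewrite big1 ?addr0; last first.
      move=> d dpq; rewrite ifF ?mulr0 //; apply/negP => /dvdzP[k hk].
      have dM := ltn_ord d; have k0 : k = 0 by nia.
      by move/eqP: dpq; apply; apply: val_inj => /=; lia.
    by rewrite mulrC; congr (_ * zeta _); rewrite -subzn //; ring.
  rewrite big1 // => d _; rewrite ifF ?mulr0 //; apply/negP => /dvdzP[k hk].
  have dM := ltn_ord d; have k0 : k = 0 by nia.
  by lia.
under eq_bigr do rewrite inner.
rewrite -big_mkcond /= -mulr_sumr; congr (_ * _).
rewrite -(big_mkord (fun q => (q <= p)%N) (fun q => zeta ((x - c) * (p%:Z - q%:Z)))).
rewrite -[in RHS](big_mkord xpredT (fun m => zeta ((x - c) * m%:Z))) [RHS]big_nat_rev /=.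
have -> : \sum_(0 <= q < N | (q <= p)%N) zeta ((x - c) * (p%:Z - q%:Z)) =
   \sum_(0 <= q < p.+1) zeta ((x - c) * (p%:Z - q%:Z)).
  rewrite [RHS](@big_nat_widen _ _ _ 0 p.+1 N) //.
apply: eq_big_nat => q qp.
by congr (zeta (_ * _)); lia.
Qed.

(** All Cesaro means with [N <= M] are averages of one function, [psum M.-1 b], against positive
    kernels. Their maximal function is thus controlled through the [L^2] bound of a single
    projection. *)
Lemma fmean_conv (M N : nat) b x : (0 < N)%N -> (N <= M)%N -> (M + M <= L)%N ->
  fmean N b x = \sum_(y < L) (fejer N (x - y%:Z))%:C * psum M.-1 b y%:Z.
Proof.
move=> N0 NM ML; rewrite fmeanE /psum (ltn_predK (leq_trans N0 NM)).
transitivity ((L%:R^-1)%:C * \sum_(c < L) b c *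
   \sum_(y < L) (fejer N (x - y%:Z))%:C * \sum_(d < M) zeta ((y%:Z - c%:Z) * d%:Z)).
  rewrite mulr_sumr; apply: eq_bigr => c _.
  rewrite fejer_conv // mulrCA (mulrA _ L%:R) -(rmorph_nat (real_complex R)).
  by rewrite -rmorphM mulVf ?gt_eqF // rmorph1 mul1r mulrC.
rewrite mulr_sumr; under eq_bigr do rewrite mulr_sumr mulr_sumr.
rewrite exchange_big /=; apply: eq_bigr => y _; rewrite mulrCA.
by rewrite !mulr_sumr; apply: eq_bigr => c _; ring.
Qed.

End PartialSums.

Section WeakType.
Variables (R : realType) (l : nat).
Let L := (2 ^ l)%N.
Notation zeta := (zeta R L).
Notation chord := (chordal R L).
Let L_gt0 : (0 < L)%N. Proof. by rewrite expn_gt0. Qed.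
Let Lr : 0 < L%:R :> R. Proof. by rewrite ltr0n. Qed.

(** With [u] the projection of [b] from [fmean_conv], the sum of [|u| ^ 2] is at most [2 lam |b|_1].
    A Calderon-Zygmund decomposition of [|u| ^ 2] at height [lam ^ 2] bounds all its Lorentzian
    averages off a small set. *)
Lemma fmean_good (lam : R) (b : 'I_L -> R[i]) : 0 < lam ->
  (forall c, cabs (b c) <= 2 * lam) ->
  exists Xi : {set 'I_L}, #|Xi|%:R * lam <= 6 * \sum_c cabs (b c) /\
    forall x, x \notin Xi -> forall N eta, (16 * N * eta = L)%N ->
      cabs (fmean N b x%:Z) <= 3840 * lam.
Proof.
move=> lam0 bb; have l0 := ltW lam0; set S := \sum_c cabs (b c).
have S0 : 0 <= S by apply: sumr_ge0 => c _; exact: cabs_ge0.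
pose M := (L./2)%N; pose u (y : 'I_L) := psum M.-1 b y%:Z.
pose v (y : 'I_L) : R[i] := (cabs (u y) ^+ 2)%:C.
have vE y : cabs (v y) = cabs (u y) ^+ 2 by rewrite cabs_real ger0_norm ?sqr_ge0.
have vS : \sum_y cabs (v y) <= 2 * lam * S.
  under eq_bigr do rewrite vE.
  apply: le_trans (psum_l2 L_gt0 _ _) _; first by rewrite /M; lia.
  rewrite mulr_sumr; apply: ler_sum => c _.
  by rewrite expr2 ler_wpM2r ?cabs_ge0.
(* If even the mean of [|u| ^ 2] exceeds [lam ^ 2], the bound on its sum allows the whole grid as
   exceptional set. *)
have [big|small] := ltP (lam ^+ 2 * L%:R) (\sum_y cabs (v y)).
  exists [set: 'I_L]; split; last by move=> x; rewrite inE.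
  rewrite cardsT card_ord -(ler_pM2l lam0).
  by move: big; rewrite expr2; nra.
have lam20 : 0 < lam ^+ 2 by rewrite exprn_gt0.
have [D [sig [b' [Om cz]]]] := cz_grid_exists lam20 small.
exists Om; split.
  have := czg_size cz; rewrite -(ler_pM2l lam0) expr2 => h.
  by have := vS; nra.
move=> x xOm N eta NeL.
have N0 : (0 < N)%N by have := L_gt0; rewrite -NeL !muln_gt0 => /andP[].
have e0 : (0 < eta)%N by have := L_gt0; rewrite -NeL !muln_gt0 => /andP[].
have NM : (N <= M)%N by rewrite /M; nia.
have ML : (M + M <= L)%N by rewrite addnn -[leqRHS]odd_double_half leq_addl.
rewrite (fmean_conv L_gt0 _ _ N0 NM ML).
(* Linearized Cauchy-Schwarz: averages of [|u|] are bounded by averages of [|u| ^ 2] and of 1. *)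
have amgm (a : R) : a <= (2 * lam)^-1 * a ^+ 2 + lam / 2.
  have -> : (2 * lam)^-1 * a ^+ 2 + lam / 2 = a + (2 * lam)^-1 * (a - lam) ^+ 2.
    by field; rewrite gt_eqF.
  by rewrite lerDl mulr_ge0 ?sqr_ge0 // invr_ge0 mulr_ge0.
pose w (y : 'I_L) := eta%:R / (eta%:R ^+ 2 + chord (x%:Z - y%:Z) ^+ 2).
have w0 y : 0 <= w y by rewrite divr_ge0 ?addr_ge0 ?sqr_ge0.
have w1 : \sum_y w y <= 12.
  have := @sum_lorentz_le R l x (fun=> 1) 6 eta e0 (fun=> ler01) (@card_chord_ball R l x).
  by rewrite (eq_bigr w) => [h|y _]; [lra|rewrite mul1r].
have w2 : \sum_y cabs (v y) * w y <= 48 * lam ^+ 2 := lorentz_sum_le cz xOm e0.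
apply: le_trans (cabs_sum _ _ _) _.
apply: (@le_trans _ _ (\sum_y (128 * (2 * lam)^-1 * (cabs (v y) * w y) + 64 * lam * w y))).
  apply: ler_sum => y _; rewrite cabs_realM ?fejer_ge0 //.
  apply: (@le_trans _ _ (128 * w y * ((2 * lam)^-1 * cabs (u y) ^+ 2 + lam / 2))).
    by apply: ler_pM; rewrite ?fejer_ge0 ?cabs_ge0 ?fejer_le.
  by rewrite vE le_eqVlt; apply/orP; left; apply/eqP; field; rewrite gt_eqF.
have -> : \sum_y (128 * (2 * lam)^-1 * (cabs (v y) * w y) + 64 * lam * w y) =
    128 * (2 * lam)^-1 * (\sum_y cabs (v y) * w y) + 64 * lam * \sum_y w y.
  by rewrite big_split !mulr_sumr.
have : 128 * (2 * lam)^-1 * \sum_y cabs (v y) * w y <= 128 * (2 * lam)^-1 * (48 * lam ^+ 2).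
  by rewrite ler_wpM2l // mulr_ge0 // invr_ge0 mulr_ge0.
have -> : 128 * (2 * lam)^-1 * (48 * lam ^+ 2) = 3072 * lam.
  by field; rewrite gt_eqF.
have : 64 * lam * \sum_y w y <= 64 * lam * 12 by rewrite ler_wpM2l // mulr_ge0.
by lra.
Qed.

(** Phases stay small: [16 |i| r <= L] keeps each term within 1/2 of 1, so the real part of the sum
    is at least [eta / 2]. *)
Lemma cabs_geom_ge (N eta : nat) (i : int) : (16 * N * eta = L)%N -> (`|i| <= N)%N ->
  eta%:R / 2 <= cabs (\sum_(r < eta) zeta (i * r%:Z)).
Proof.
move=> NeL iN; apply: le_trans (normr_Re_le _); rewrite Re_sum.
apply: le_trans (ler_norm _).
apply: (@le_trans _ _ (\sum_(r < eta) 2^-1)).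
  by rewrite sumr_const card_ord -[2^-1 *+ eta]mulr_natl.
apply: ler_sum => r _.
have := chord_le R L_gt0 (i * r%:Z).
have : (`|(i * r%:Z)%R|%:R : R) * 16 <= L%:R.
  rewrite -natrM ler_nat abszM absz_nat -NeL.
  by have := ltn_ord r; nia.
rewrite /chordal => h1 h2.
have h3 : L%:R * cabs (1 - zeta (i * r%:Z)) <= L%:R * 2^-1 by lra.
rewrite ler_pM2l // in h3.
have := normr_Re_le (1 - zeta (i * r%:Z)); rewrite ReB -[complex.Re 1]/(1 : R).
have := ler_norm (1 - complex.Re (zeta (i * r%:Z))).
by lra.
Qed.

(** For given [r] at most one [s] solves the congruence, and a solution puts [c] and [d] at distance
    less than [eta] modulo [L]. *)
Lemma count_shift (eta : nat) (c d : 'I_L) : (eta <= L)%N ->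
  \sum_(r < eta) \sum_(s < eta | (L%:Z %| (r%:Z - c%:Z) - (s%:Z - d%:Z))%Z) 1
   <= (if chord (c%:Z - d%:Z) < 8 * eta%:R then eta%:R else 0) :> R.
Proof.
move=> eL.
have near (r s : 'I_eta) : (L%:Z %| (r%:Z - c%:Z) - (s%:Z - d%:Z))%Z ->
    chord (c%:Z - d%:Z) < 8 * eta%:R.
  move=> /dvdzP[k hk].
  have -> : c%:Z - d%:Z = (r%:Z - s%:Z) + (- k) * L%:Z.
    by rewrite mulNr -hk; ring.
  rewrite chord_period //; apply: le_lt_trans (chord_le R L_gt0 _) _.
  rewrite ltr_pM2l // ltr_nat.
  by have := ltn_ord r; have := ltn_ord s; lia.
have [cd|cd] := ltP (chord (c%:Z - d%:Z)) (8 * eta%:R); last first.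
  rewrite big1 // => r _; rewrite big_pred0 // => s; apply/negP => /near.
  by rewrite ltNge cd.
rewrite -[leRHS](_ : \sum_(r < eta) 1 = _); last by rewrite sumr_const card_ord.
apply: ler_sum => r _.
have [/existsP[s hs]|/existsPn none] := boolP [exists s : 'I_eta,
    (L%:Z %| (r%:Z - c%:Z) - (s%:Z - d%:Z))%Z]; last first.
  by rewrite big_pred0 // => s; apply/negbTE.
rewrite (bigD1 s) //= big1 ?addr0 // => s' /andP[hs' ss'].
have := rpredB hs hs'.
have -> : (r%:Z - c%:Z - (s%:Z - d%:Z)) - (r%:Z - c%:Z - (s'%:Z - d%:Z)) = s'%:Z - s%:Z by ring.
by move=> /(dvdz_ord_eq R L_gt0 eL) e; rewrite e eqxx in ss'.
Qed.

Section Oscillation.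
Variables (lam : R) (g : 'I_L -> R[i]) (D : 'I_L -> nat) (sig : 'I_L -> int)
  (b : 'I_L -> R[i]) (Om : {set 'I_L}).
Hypothesis lam_gt0 : 0 < lam.
Hypothesis cz : cz_grid lam g D sig b Om.
Let lam_ge0 : 0 <= lam. Proof. exact: ltW. Qed.

Variables (N eta : nat).
Hypothesis NeL : (16 * N * eta = L)%N.
Let N_gt0 : (0 < N)%N.
Proof. by have := L_gt0; rewrite -NeL !muln_gt0 => /andP[]. Qed.
Let eta_gt0 : (0 < eta)%N.
Proof. by have := L_gt0; rewrite -NeL !muln_gt0 => /andP[]. Qed.
Let etaL : (eta <= L)%N. Proof. by rewrite -NeL; nia. Qed.

Variable x : 'I_L.
Hypothesis xOm : x \notin Om.
(** The threshold [16 eta] is [L / N]: below it a sum of at most [N] exponentials is bounded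
    trivially, above it the geometric series is summed. *)
Let far (c : 'I_L) := 16 * eta%:R <= chord (x%:Z - c%:Z).
Let Q := marcinkiewicz D (fun c => cabs (g c)) x.
Let a (c : 'I_L) : R := if far c then cabs (g c) / chord (x%:Z - c%:Z) else 0.

Let a_ge0 c : 0 <= a c.
Proof. by rewrite /a; case: ifP => // _; rewrite divr_ge0 ?cabs_ge0 ?chord_ge0. Qed.

(* Ordering each pair by the length of its stopped intervals lets the packing
   property absorb the inner sum. *)
Lemma pair_sum_le :
  \sum_(c < L) \sum_(d < L | chord (c%:Z - d%:Z) < 8 * eta%:R) a c * a d
  <= 48 * lam * (384 * lam + Q).
Proof.
have er : 0 < eta%:R :> R by rewrite ltr0n.
pose T c := \sum_(d < L | (chord ((c : 'I_L)%:Z - d%:Z) < 8 * eta%:R) && (D d <= D c)%N) a c * a d.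
apply: (@le_trans _ _ (2 * \sum_c T c)).
  have dup : \sum_c T c = \sum_(c < L) \sum_(d < L |
      (chord (c%:Z - d%:Z) < 8 * eta%:R) && (D c <= D d)%N) a c * a d.
    rewrite /T (exchange_big_dep predT) //=; apply: eq_bigr => c _.
    by apply: eq_big => [d|d _]; [rewrite chord_subC|rewrite mulrC].
  rewrite (_ : 2 * \sum_c T c = \sum_c T c + \sum_c T c); last by ring.
  rewrite {2}dup.
  rewrite -big_split /=; apply: ler_sum => c _.
  rewrite /T [leLHS]big_mkcond [X in _ <= X + _]big_mkcond [X in _ <= _ + X]big_mkcond /=.
  rewrite -big_split /=; apply: ler_sum => d _.
  have := mulr_ge0 (a_ge0 c) (a_ge0 d); set ad := a c * a d => ad0.
  case: ifP => //= _.
  by case: (leqP (D d) (D c)) => h; case: (leqP (D c) (D d)) => h'; lra || lia.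
pose w c := eta%:R / (eta%:R ^+ 2 + chord (x%:Z - (c : 'I_L)%:Z) ^+ 2).
have Tle c : T c <= 24 * lam * (8 * (cabs (g c) * w c) +
    cabs (g c) * ((D c)%:R / chord (x%:Z - c%:Z) ^+ 2)).
  have rhs0 : 0 <= 24 * lam * (8 * (cabs (g c) * w c) +
    cabs (g c) * ((D c)%:R / chord (x%:Z - c%:Z) ^+ 2)).
    apply: mulr_ge0; first by rewrite mulr_ge0.
    have w0 : 0 <= w c by apply: divr_ge0; rewrite ?addr_ge0 ?sqr_ge0.
    apply: addr_ge0; apply: mulr_ge0; rewrite ?cabs_ge0 //.
      by apply: mulr_ge0 => //; exact: cabs_ge0.
    by apply: divr_ge0; rewrite ?ler0n ?sqr_ge0.
  rewrite /T -mulr_sumr {1}/a; case: ifPn => [farc|_]; last by rewrite mul0r.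
  set rho := chord (x%:Z - c%:Z) in farc rhs0 *.
  have rho0 : 0 < rho by apply: lt_le_trans farc; rewrite mulr_gt0.
  have farc' : 16 * eta%:R <= rho by exact: farc.
  (* A far [d] within [8 eta] of [c] has chord at least [rho / 2] to [x], so the denominators are
     frozen and the packing bound applies with radius [4 eta] and length [D c]. The [eta] part goes
     into a Lorentzian sum, the [D c] part into the Marcinkiewicz integral. *)
  have inner : \sum_(d < L | (chord (c%:Z - d%:Z) < 8 * eta%:R) && (D d <= D c)%N) a d
      <= 2 / rho * (12 * lam * (4 * eta%:R + (D c)%:R)).
    have := czg_packing cz c (4 * eta) (D c).
    rewrite natrM mulrA (_ : 2 * 4 = 8 :> R); last by ring.
    have r20 : 0 <= 2 / rho by rewrite divr_ge0 // ltW.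
    move=> /(ler_wpM2l r20); apply: le_trans; rewrite mulr_sumr.
    apply: ler_sum => d /andP[cd _]; rewrite /a; case: ifP => fard; last first.
      by rewrite mulr_ge0 ?cabs_ge0.
    rewrite mulrC ler_wpM2r ?cabs_ge0 //.
    have tri : rho <= chord (x%:Z - d%:Z) + chord (c%:Z - d%:Z).
      rewrite /rho (_ : x%:Z - c%:Z = (x%:Z - d%:Z) - (c%:Z - d%:Z)); last by ring.
      exact: chord_sub.
    have rd : rho <= 2 * chord (x%:Z - d%:Z).
      by move: fard cd tri; rewrite /far; set z := chord _; lra.
    have d0 : 0 < chord (x%:Z - d%:Z) by lra.
    by rewrite -[leLHS]mul1r ler_pdivrMr // mulrAC ler_pdivlMr // mul1r.
  apply: (@le_trans _ _ (cabs (g c) / rho * (2 / rho * (12 * lam * (4 * eta%:R + (D c)%:R))))).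
    by rewrite ler_wpM2l // divr_ge0 ?cabs_ge0 // ltW.
  have -> : cabs (g c) / rho * (2 / rho * (12 * lam * (4 * eta%:R + (D c)%:R))) =
     24 * lam * (4 * (cabs (g c) * (eta%:R / rho ^+ 2)) + cabs (g c) * ((D c)%:R / rho ^+ 2)).
    by field; rewrite gt_eqF.
  rewrite ler_wpM2l ?mulr_ge0 // lerD2r.
  have : eta%:R / rho ^+ 2 <= 2 * w c.
    rewrite /w -/rho mulrA ler_pdivlMr; last by rewrite ltr_wpDr ?exprn_gt0 ?sqr_ge0.
    rewrite mulrAC ler_pdivrMr ?exprn_gt0 //.
    rewrite (mulrC 2) -[leRHS]mulrA ler_pM2l //.
    have : eta%:R ^+ 2 <= rho ^+ 2 by apply: lerXn2r; rewrite ?nnegrE ?(ltW rho0) ?(ltW er) //; lra.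
    by lra.
  move=> /(ler_wpM2l (cabs_ge0 (g c))).
  by lra.
apply: (@le_trans _ _ (2 * \sum_c 24 * lam * (8 * (cabs (g c) * w c) +
    cabs (g c) * ((D c)%:R / chord (x%:Z - c%:Z) ^+ 2)))).
  by rewrite ler_wpM2l //; apply: ler_sum.
pose W := \sum_c cabs (g c) * w c.
have -> : \sum_c 24 * lam * (8 * (cabs (g c) * w c) +
    cabs (g c) * ((D c)%:R / chord (x%:Z - c%:Z) ^+ 2)) = 24 * lam * (8 * W + Q).
  by rewrite -mulr_sumr big_split -mulr_sumr.
have lor : W <= 48 * lam := lorentz_sum_le cz xOm eta_gt0.
have : 24 * lam * (8 * W) <= 24 * lam * (8 * (48 * lam)).
  by rewrite ler_wpM2l ?mulr_ge0 // ler_pM2l.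
by lra.
Qed.

(** At a far node the frequencies [n, ..., n + i - 1] contribute [h n c] times
    [1 - zeta ((x - c) i)]. The first part does not depend on [i]; the second is collected in
    [dual_sum], up to the unimodular factor [zeta (i x)]. *)
Let h (n : nat) (c : 'I_L) : R[i] :=
  if far c then g c * zeta ((x%:Z - c%:Z) * n%:Z) / (L%:R * (1 - zeta (x%:Z - c%:Z)))
  else 0.

Let natrC (n : nat) : n%:R = (n%:R : R)%:C.
Proof. by rewrite -(rmorph_nat (real_complex R)). Qed.

Let natrVC (n : nat) : ((n%:R : R)^-1)%:C = (n%:R : R[i])^-1.
Proof. by rewrite natrC; exact: fmorphV. Qed.

Let cabs_h n c : cabs (h n c) = a c.
Proof.
rewrite /h /a; case: ifP; rewrite ?cabs0 // => _.
by rewrite !cabsM cabsV cabsM cabs_zeta mulr1 natrC cabs_real normr_nat.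
Qed.

Let dual_sum n (i : nat) := \sum_(c < L) h n c * zeta (i%:Z * - c%:Z).

(** A large sieve inequality. For [i < N] the sum is multiplied by a geometric sum of modulus at
    least [eta / 2], the range is enlarged to all [i < L], and Parseval leaves only pairs of nodes
    at chordal distance below [8 eta]. *)
Lemma dual_sum_le n :
  \sum_(i < N) cabs (dual_sum n i) ^+ 2 <= N%:R * (64 * (48 * lam * (384 * lam + Q))).
Proof.
have er : 0 < eta%:R :> R by rewrite ltr0n.
have Nr : 0 < N%:R :> R by rewrite ltr0n.
have LE : L%:R = 16 * N%:R * eta%:R :> R by rewrite -NeL !natrM.
have NL : (N <= L)%N by rewrite -NeL; nia.
pose F (i : nat) := \sum_(r < eta) zeta (i%:Z * r%:Z).
have step1 : \sum_(i < N) cabs (dual_sum n i) ^+ 2 * (eta%:R / 2) ^+ 2 <=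
    \sum_(i < L) cabs (\sum_(rc : 'I_eta * 'I_L) h n rc.2 * zeta (i%:Z * (rc.1%:Z - rc.2%:Z))) ^+ 2.
  have FE i : F i * dual_sum n i =
      \sum_(rc : 'I_eta * 'I_L) h n rc.2 * zeta (i%:Z * (rc.1%:Z - rc.2%:Z)).
    rewrite /F /dual_sum big_distrlr pair_big /=; apply: eq_bigr => rc _.
    by rewrite mulrCA -zetaD -mulrDr.
  under [leRHS]eq_bigr do rewrite -FE.
  rewrite (big_ord_widen _ (fun i => cabs (dual_sum n i) ^+ 2 * (eta%:R / 2) ^+ 2) NL).
  rewrite big_mkcond /=; apply: ler_sum => i _; case: ifP => iN; last exact: sqr_ge0.
  rewrite cabsM [leRHS]exprMn [leLHS]mulrC ler_wpM2r ?sqr_ge0 //.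
  apply: lerXn2r; rewrite ?nnegrE ?cabs_ge0 ?divr_ge0 //.
  by apply: cabs_geom_ge NeL _; rewrite absz_nat ltnW.
have step2 : \sum_(i < L) cabs (\sum_(rc : 'I_eta * 'I_L)
      h n rc.2 * zeta (i%:Z * (rc.1%:Z - rc.2%:Z))) ^+ 2 <=
    L%:R * (eta%:R * \sum_(c < L) \sum_(d < L | chord (c%:Z - d%:Z) < 8 * eta%:R) a c * a d).
  apply: le_trans (parseval_le L_gt0 _ _ _) _; rewrite ler_pM2l //.
  rewrite (eq_bigr (fun rc : 'I_eta * 'I_L => \sum_(s < eta) \sum_(d < L)
     if (L%:Z %| (rc.1%:Z - rc.2%:Z) - (s%:Z - d%:Z))%Z then a rc.2 * a d else 0)); last first.
    move=> rc _; rewrite pair_big /= big_mkcond; apply: eq_bigr => sd _.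
    by rewrite !cabs_h.
  rewrite -(pair_bigA _ (fun (r : 'I_eta) (c : 'I_L) => \sum_(s < eta) \sum_(d < L)
     if (L%:Z %| (r%:Z - c%:Z) - (s%:Z - d%:Z))%Z then a c * a d else 0)) /=.
  rewrite exchange_big mulr_sumr /=; apply: ler_sum => c _.
  under eq_bigr do rewrite exchange_big /=.
  rewrite exchange_big mulr_sumr [leRHS]big_mkcond /=; apply: ler_sum => d _.
  have := ler_wpM2l (mulr_ge0 (a_ge0 c) (a_ge0 d)) (count_shift c d etaL).
  rewrite mulr_sumr.
  rewrite (eq_bigr (fun r : 'I_eta => \sum_(s < eta)
     if (L%:Z %| (r%:Z - c%:Z) - (s%:Z - d%:Z))%Z then a c * a d else 0)); last first.
    move=> r _; rewrite mulr_sumr big_mkcond; apply: eq_bigr => s _.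
    by case: ifP; rewrite ?mulr1.
  move=> /le_trans; apply.
  by case: ifP => _; rewrite ?mulr0 ?lexx // mulrC.
rewrite -mulr_suml in step1.
have := pair_sum_le; set P := \sum_(c < L) _ => pair.
have := le_trans step1 step2; rewrite -/P -ler_pdivlMr ?exprn_gt0 ?divr_gt0 //.
move=> /le_trans; apply.
have -> : L%:R * (eta%:R * P) / (eta%:R / 2) ^+ 2 = N%:R * (64 * P).
  by rewrite LE; field; rewrite gt_eqF.
by rewrite ler_pM2l // ler_pM2l.
Qed.

(** [kappa] gathers what does not depend on [i]: the sum at index [n] and the constant parts of the
    far geometric series. Near nodes contribute at most [N / L * 24 lam * 8 eta = 12 lam] by
    [ball_sum_le]. *)
Lemma psum_oscillation_le (n : nat) : exists kappa : R[i],
  \sum_(i < N) cabs (psum (n + i) g x%:Z - kappa) ^+ 2 <=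
  N%:R * (288 * lam ^+ 2 + 128 * (48 * lam * (384 * lam + Q))).
Proof.
have LE : L%:R = 16 * N%:R * eta%:R :> R by rewrite -NeL !natrM.
pose near (i : nat) := (L%:R^-1)%:C * \sum_(c < L | ~~ far c)
  g c * zeta ((x%:Z - c%:Z) * n.+1%:Z) * \sum_(m < i) zeta ((x%:Z - c%:Z) * m%:Z).
exists (psum n g x%:Z + \sum_(c < L) h n.+1 c).
have decomp (i : nat) : psum (n + i) g x%:Z - (psum n g x%:Z + \sum_(c < L) h n.+1 c) =
    near i - zeta (i%:Z * x%:Z) * dual_sum n.+1 i.
  have -> : psum (n + i) g x%:Z = psum n g x%:Z + (L%:R^-1)%:C * \sum_(c < L)
      g c * zeta ((x%:Z - c%:Z) * n.+1%:Z) * \sum_(m < i) zeta ((x%:Z - c%:Z) * m%:Z).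
    rewrite /psum -mulrDr -big_split /=; congr (_ * _); apply: eq_bigr => c _.
    rewrite -mulrA -mulrDr -addSn big_split_ord /= mulr_sumr; congr (_ * (_ + _)).
    by apply: eq_bigr => m _; rewrite -zetaD -mulrDr.
  rewrite (bigID far) /= mulrDr -/(near i).
  have -> : (L%:R^-1)%:C * \sum_(c < L | far c) g c * zeta ((x%:Z - c%:Z) * n.+1%:Z)
      * \sum_(m < i) zeta ((x%:Z - c%:Z) * m%:Z) =
      \sum_(c < L) h n.+1 c - zeta (i%:Z * x%:Z) * dual_sum n.+1 i.
    rewrite /dual_sum [X in _ = _ - X]mulr_sumr -sumrB mulr_sumr big_mkcond /=.
    apply: eq_bigr => c _; rewrite /h; case: ifP => farc; last by rewrite mul0r mulr0 subrr.
    have z1 : 1 - zeta (x%:Z - c%:Z) != 0.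
      apply/eqP => z0; move: farc; rewrite /far /chordal z0 cabs0 mulr0 leNgt.
      by rewrite mulr_gt0 // ltr0n.
    have Lc : (L%:R : R[i]) != 0 by rewrite pnatr_eq0 -lt0n.
    have -> : \sum_(m < i) zeta ((x%:Z - c%:Z) * m%:Z) =
       (1 - zeta ((x%:Z - c%:Z) * i%:Z)) / (1 - zeta (x%:Z - c%:Z)).
      by rewrite -zeta_geom mulrC mulKf.
    have -> : zeta (i%:Z * x%:Z) * (g c * zeta ((x%:Z - c%:Z) * n.+1%:Z) /
        (L%:R * (1 - zeta (x%:Z - c%:Z))) * zeta (i%:Z * - c%:Z)) =
        g c * zeta ((x%:Z - c%:Z) * n.+1%:Z) /
        (L%:R * (1 - zeta (x%:Z - c%:Z))) * zeta ((x%:Z - c%:Z) * i%:Z).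
      rewrite mulrCA -zetaD; congr (_ * zeta _); ring.
    rewrite natrVC; by field; rewrite z1 Lc.
  by ring.
have near_le (i : 'I_N) : cabs (near i) <= 12 * lam.
  rewrite cabs_realM ?invr_ge0 // mulrC ler_pdivrMr //.
  have := ball_sum_le cz (8 * eta) xOm.
  rewrite natrM mulrA (_ : 2 * 8 = 16 :> R); last by ring.
  move=> ball; apply: le_trans (cabs_sum _ _ _) _.
  apply: (@le_trans _ _ (N%:R * \sum_(c < L | chord (x%:Z - c%:Z) < 16 * eta%:R) cabs (g c))).
    rewrite mulr_sumr (eq_bigl _ _ (fun c => ltNge _ _)).
    apply: ler_sum => c _; rewrite !cabsM cabs_zeta mulr1 mulrC ler_wpM2r ?cabs_ge0 //.
    apply: le_trans (cabs_sum _ _ _) _; under eq_bigr do rewrite cabs_zeta.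
    by rewrite sumr_const card_ord ler_nat ltnW.
  have Nr : 0 <= N%:R :> R by rewrite ler0n.
  have := ler_wpM2l Nr ball; rewrite LE; lra.
have := dual_sum_le n.+1; set V := 48 * lam * _ => dual.
apply: (@le_trans _ _ (\sum_(i < N) (288 * lam ^+ 2 + 2 * cabs (dual_sum n.+1 i) ^+ 2))).
  apply: ler_sum => i _; rewrite decomp.
  apply: le_trans (sqr_cabs_le_add _ _) _; rewrite cabsN cabsM cabs_zeta mul1r lerD2r.
  have : cabs (near i) ^+ 2 <= (12 * lam) ^+ 2.
    by apply: lerXn2r; rewrite ?nnegrE ?cabs_ge0 ?mulr_ge0.
  by rewrite exprMn; lra.
rewrite big_split /= sumr_const card_ord -[288 * _ *+ N]mulr_natl -mulr_sumr mulrDr lerD2l.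
by lra.
Qed.

End Oscillation.
End WeakType.

Lemma sqr_sum_le (R : realType) (n : nat) (a : 'I_n -> R) :
  (\sum_i a i) ^+ 2 <= n%:R * \sum_i a i ^+ 2.
Proof.
rewrite expr2 big_distrlr /=.
apply: (@le_trans _ _ (\sum_i \sum_j (a i ^+ 2 / 2 + a j ^+ 2 / 2))).
  apply: ler_sum => i _; apply: ler_sum => j _.
  by have := sqr_ge0 (a i - a j); rewrite !expr2; lra.
set S := \sum_i a i ^+ 2.
have inner i : \sum_j (a i ^+ 2 / 2 + a j ^+ 2 / 2) = n%:R * (a i ^+ 2 / 2) + S / 2.
  by rewrite big_split /= sumr_const card_ord -mulr_suml mulr_natl.
rewrite (eq_bigr _ (fun i _ => inner i)) big_split /= -mulr_sumr -mulr_suml.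
rewrite sumr_const card_ord -(mulr_natl (S / 2)) -/S.
by lra.
Qed.

Section GridOperators.
Variables (R : realType) (l : nat).
Let L := (2 ^ l)%N.
Let L_gt0 : (0 < L)%N. Proof. by rewrite expn_gt0. Qed.
Implicit Types (g : 'I_L -> R[i]) (lam eps t : R).

(** The exceptional set joins the tripled intervals, the set of [fmean_good], and the points where
    the Marcinkiewicz integral of [|g| + |b|] exceeds [lam]; their costs 3, 6 and 30 add up to less
    than 50. *)
Lemma psum_weak_type_explicit g lam : 0 < lam ->
  exists Xi : {set 'I_L}, #|Xi|%:R * lam <= 50 * \sum_c cabs (g c) /\
    forall x, x \notin Xi -> forall N eta, (16 * N * eta = L)%N ->
      (forall n, exists kappa : R[i],
        \sum_(i < N) cabs (psum (n + i) g x%:Z - kappa) ^+ 2 <= N%:R * (2000 * lam) ^+ 2)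
      /\ cabs (fmean N g x%:Z) <= 5000 * lam.
Proof.
move=> lam0; have l0 := ltW lam0; set S := \sum_c cabs (g c).
have S0 : 0 <= S by apply: sumr_ge0 => c _; exact: cabs_ge0.
have [big|small] := ltP (lam * L%:R) S.
  exists [set: 'I_L]; split; last by move=> x; rewrite inE.
  by rewrite cardsT card_ord; lra.
have [D [sig [b [Om cz]]]] := cz_grid_exists lam0 small.
have [Xi [sXi good]] := fmean_good lam0 (czg_bound cz).
pose gam (c : 'I_L) := cabs (g c) + cabs (b c).
have gam0 c : 0 <= gam c by rewrite addr_ge0 ?cabs_ge0.
pose Y := [set x : 'I_L | (x \notin Om) && (lam < marcinkiewicz D gam x)].
exists (Om :|: Xi :|: Y); split.
  have sOm := czg_size cz; have nb := czg_norm1 cz.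
  have sY : #|Y|%:R * lam <= 30 * S.
    have gamS : \sum_(c < L) gam c = S + \sum_(c < L) cabs (b c) by rewrite big_split.
    have := sum_marcinkiewicz_le cz gam0; rewrite gamS => sM.
    apply: (@le_trans _ _ (\sum_(x < L | x \notin Om) marcinkiewicz D gam x)); last first.
      by rewrite -/S in nb; lra.
    rewrite -sum1_card natr_sum mulr_suml big_mkcond [leRHS]big_mkcond /=.
    apply: ler_sum => x _; rewrite inE.
    by case: ifP => /= [/andP[-> /ltW]|_]; rewrite ?mul1r //; case: ifP => // _;
      exact: marcinkiewicz_ge0.
  have : #|Om :|: Xi :|: Y|%:R <= #|Om|%:R + #|Xi|%:R + #|Y|%:R :> R.
    rewrite -!natrD ler_nat; apply: leq_trans (leq_card_setU _ _) _.
    by rewrite leq_add2r leq_card_setU.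
  move=> /(ler_wpM2r l0); rewrite !mulrDl -/S in sOm nb *.
  by rewrite -/S in sXi; lra.
move=> x; rewrite !inE !negb_or negb_and negbK -leNgt.
move=> /andP[/andP[xOm xXi]]; rewrite (negbTE xOm) /= => Mx N eta NeL.
have N0 : (0 < N)%N by have := L_gt0; rewrite -NeL !muln_gt0 => /andP[].
split.
  move=> n; have [kappa hk] := psum_oscillation_le lam0 cz NeL xOm n.
  exists kappa; apply: le_trans hk _; rewrite ler_wpM2l //.
  set Q := marcinkiewicz _ _ _.
  have QM : Q <= lam.
    apply: le_trans Mx; apply: ler_sum => c _.
    by rewrite ler_wpM2r ?divr_ge0 ?sqr_ge0 // lerDl cabs_ge0.
  have : lam * Q <= lam * lam by rewrite ler_wpM2l.
  by rewrite exprMn !expr2; nra.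
have -> : fmean N g x%:Z = \sum_(c < L) fejer_kernel R L N (x%:Z - c%:Z) * (g c - b c)
    + fmean N b x%:Z.
  by rewrite !fmeanE -big_split /=; apply: eq_bigr => c _; ring.
apply: le_trans (cabs_le_add _ _) _.
have := bad_part_le cz N0 xOm; rewrite -/gam.
by have := good x xXi N eta NeL; lra.
Qed.

End GridOperators.

Lemma psum_weak_type (R : realType) : exists2 C : R, 0 < C &
  forall (l : nat) (g : 'I_(2 ^ l) -> R[i]) (lam : R), 0 < lam ->
  exists Xi : {set 'I_(2 ^ l)}, #|Xi|%:R * lam <= C * \sum_c cabs (g c) /\
    forall x, x \notin Xi -> forall N eta, (16 * N * eta = 2 ^ l)%N ->
      (forall n, exists kappa : R[i],
        \sum_(i < N) cabs (psum (n + i) g x%:Z - kappa) ^+ 2 <= N%:R * (C * lam) ^+ 2)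
      /\ cabs (fmean N g x%:Z) <= C * lam.
Proof.
have [C [C0 C1 C2 C3]] : exists C : R, [/\ 0 < C, 50 <= C, 2000 <= C & 5000 <= C].
  by exists (50 + 2000 + 5000); split; lra.
exists C => // l g lam lam0; have l0 := ltW lam0.
have [Xi [sXi good]] := psum_weak_type_explicit g lam0.
exists Xi; split.
  apply: le_trans sXi _; rewrite ler_wpM2r //.
  by apply: sumr_ge0 => c _; exact: cabs_ge0.
move=> x xXi N eta NeL; have [osc mean] := good x xXi N eta NeL; split; last first.
  by apply: le_trans mean _; rewrite ler_wpM2r.
move=> n; have [kappa h] := osc n; exists kappa; apply: le_trans h _.
have k0 : 0 <= 2000 * lam by lra.
move: C2 => /(ler_wpM2r l0); move: k0; set k := 2000 * lam => k0 kC.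
by rewrite ler_wpM2l // lerXn2r ?nnegrE // (le_trans k0).
Qed.

(** * Half-line projections from L log L to L^1 *)

Section LLogLFunction.
Variable R : realType.
Implicit Types (u eps : R).

(** The scale [eps] is the height below which the logarithm stays bounded. A dilation of [u] amounts
    to one of [eps], which yields the quasi-triangle inequality [llog_add_le]. *)
Definition llog eps u : R := u * (1 + ln (1 + u / eps)).

Lemma ln_div_ge0 eps u : 0 < eps -> 0 <= u -> 0 <= ln (1 + u / eps).
Proof. by move=> e0 u0; apply: ln_ge0; rewrite lerDl divr_ge0 // ltW. Qed.

Lemma llog_ge0 eps u : 0 < eps -> 0 <= u -> 0 <= llog eps u.
Proof. by move=> e0 u0; rewrite mulr_ge0 // addr_ge0 // ln_div_ge0. Qed.

Lemma le_llog eps u : 0 < eps -> 0 <= u -> u <= llog eps u.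
Proof. by move=> e0 u0; rewrite /llog mulrDr mulr1 lerDl mulr_ge0 // ln_div_ge0. Qed.

(** Induction with [eps] doubled: as long as [eps < u], a doubling lowers [ln (1 + u / eps)] by at
    least 1/4. *)
Lemma count_dyadic_below eps u (n : nat) : 0 < eps -> 0 <= u ->
  \sum_(i < n) (if eps * 2 ^+ i < u then 1 else 0) <= 4 * ln (1 + u / eps).
Proof.
move=> e0 u0; elim: n eps e0 => [|n IH] eps e0.
  by rewrite big_ord0 mulr_ge0 // ln_div_ge0.
rewrite big_ord_recl /= expr0 mulr1.
under eq_bigr do rewrite /bump /= add1n exprS mulrA.
have e20 : 0 < eps * 2 by rewrite mulr_gt0.
have := IH _ e20; set T := \sum_(i < n) _ => hT.
set w := u / eps.
have w2 : u / (eps * 2) = w / 2 by rewrite /w; field; rewrite gt_eqF.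
rewrite w2 in hT.
have w0 : 0 <= w by rewrite divr_ge0 // ltW.
have [lt|ge] := ltP eps u; last first.
  rewrite add0r; apply: le_trans hT _; rewrite ler_pM2l // ler_ln ?posrE; lra.
have w1 : 1 < w by rewrite ltr_pdivlMr // mul1r.
have step : 4^-1 <= ln (1 + w) - ln (1 + w / 2).
  rewrite -ln_div ?posrE; try lra.
  have -> : ln ((1 + w) / (1 + w / 2)) = - ln (1 - (w / 2) / (1 + w)).
    rewrite -lnV ?posrE; last first.
      by rewrite subr_gt0 ltr_pdivrMr; lra.
    by congr ln; field; apply/andP; split; rewrite gt_eqF; lra.
  have q : 4^-1 <= (w / 2) / (1 + w) by rewrite ler_pdivlMr; lra.
  have : ln (1 - (w / 2) / (1 + w)) <= - ((w / 2) / (1 + w)).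
    by apply: le_ln1Dx; rewrite ltrNl opprK ltr_pdivrMr; lra.
  by lra.
by lra.
Qed.

(** Once [u <= eps], the terms are dominated by a geometric series of ratio 1/2 with first term at
    most 1. *)
Lemma sum_dyadic_above eps u (n : nat) : 0 < eps -> 0 <= u ->
  \sum_(i < n) (if eps * 2 ^+ i < u then 0 else u / (eps * 2 ^+ i)) <= 2.
Proof.
move=> e0 u0; elim: n eps e0 => [|n IH] eps e0; first by rewrite big_ord0.
rewrite big_ord_recl /= expr0 mulr1.
under eq_bigr do rewrite /bump /= add1n exprS mulrA.
have [lt|ge] := ltP eps u; first by rewrite add0r IH // mulr_gt0.
have geom m (e : R) : 0 < e -> \sum_(i < m) u / (e * 2 ^+ i) <= 2 * (u / e).
  elim: m e => [|m IHm] e ep; first by rewrite big_ord0 mulr_ge0 // divr_ge0 // ltW.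
  rewrite big_ord_recl /= expr0 mulr1.
  under eq_bigr do rewrite /bump /= add1n exprS mulrA.
  have ep2 : 0 < e * 2 by rewrite mulr_gt0.
  have := IHm _ ep2.
  have -> : 2 * (u / (e * 2)) = u / e by field; rewrite gt_eqF.
  by lra.
have e20 : 0 < eps * 2 by rewrite mulr_gt0.
have ue : u / eps <= 1 by rewrite ler_pdivrMr // mul1r.
have := geom n _ e20; have -> : 2 * (u / (eps * 2)) = u / eps by field; rewrite gt_eqF.
suff : \sum_(i < n) (if eps * 2 * 2 ^+ i < u then 0 else u / (eps * 2 * 2 ^+ i))
    <= \sum_(i < n) u / (eps * 2 * 2 ^+ i) by lra.
apply: ler_sum => i _; case: ifP => // _.
by rewrite divr_ge0 // mulr_ge0 ?exprn_ge0 // ltW.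
Qed.

(** A dyadic layer cake: with the offset [2 eps], the levels of index below [m] add up to exactly
    [2 eps 2 ^ m]. *)
Lemma le_dyadic_layers eps u (n : nat) : 0 < eps -> 0 <= u -> u <= 2 * eps * 2 ^+ n ->
  u <= 2 * eps + \sum_(i < n) (if 2 * (eps * 2 ^+ i) < u then 2 * (eps * 2 ^+ i) else 0).
Proof.
move=> e0 u0; elim: n => [|n IH] un; first by rewrite big_ord0 addr0 -(mulr1 (2 * eps)).
rewrite big_ord_recr /=; case: ltP => h; last first.
  by rewrite addr0; apply: IH; rewrite -mulrA.
have pn : 0 <= 2 ^+ n :> R by rewrite exprn_ge0.
have full m : 2 * (eps * 2 ^+ m) < u ->
    2 * eps + \sum_(i < m) (if 2 * (eps * 2 ^+ i) < u then 2 * (eps * 2 ^+ i) else 0)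
     = 2 * (eps * 2 ^+ m).
  elim: m => [|m IHm] hm; first by rewrite big_ord0 addr0 expr0 mulr1.
  have h' : 2 * (eps * 2 ^+ m) < u.
    apply: le_lt_trans hm; rewrite ler_pM2l // ler_pM2l // exprS.
    by rewrite ler_peMl ?exprn_ge0 // ler1n.
  by rewrite big_ord_recr /= h' addrA IHm // exprS; ring.
rewrite addrA full //; apply: le_trans un _; rewrite exprS le_eqVlt.
by apply/orP; left; apply/eqP; ring.
Qed.

End LLogLFunction.

Section Projection.
Variables (R : realType) (l K eta : nat).
Let L := (2 ^ l)%N.
Let L_gt0 : (0 < L)%N. Proof. by rewrite expn_gt0. Qed.
Hypothesis KeL : (16 * (2 * K) * eta = L)%N.
Variable C : R.
Hypothesis C_gt0 : 0 < C.
Hypothesis weak_type : forall (g : 'I_L -> R[i]) (lam : R), 0 < lam ->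
  exists Xi : {set 'I_L}, #|Xi|%:R * lam <= C * \sum_c cabs (g c) /\
    forall x, x \notin Xi -> forall N eta, (16 * N * eta = L)%N ->
      cabs (fmean N g x%:Z) <= C * lam.
Implicit Types (g : 'I_L -> R[i]) (lam eps t : R).

Let K_gt0 : (0 < K)%N.
Proof. by have := L_gt0; rewrite -KeL !muln_gt0 => /andP[]. Qed.
Let eta_gt0 : (0 < eta)%N.
Proof. by have := L_gt0; rewrite -KeL !muln_gt0 => /andP[]. Qed.

(** A de la Vallee-Poussin combination: the multiplier [2 (1 - j / (2 K)) - (1 - j / K)] equals 1
    for [0 <= j <= K], and negative frequencies down to [- K] are annihilated. It is the half-line
    projection on polynomials of degree at most [K], and as a combination of two Cesaro means it
    inherits their weak type bound. *)
Definition halfline g (x : int) : R[i] := 2 * fmean (2 * K) g x - fmean K g x.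

Lemma fmeanD N g h x : fmean N (fun c => g c + h c) x = fmean N g x + fmean N h x.
Proof.
by rewrite !fmeanE -big_split /=; apply: eq_bigr => c _; rewrite mulrDr.
Qed.

Lemma halflineD g h x : halfline (fun c => g c + h c) x = halfline g x + halfline h x.
Proof. by rewrite /halfline !fmeanD; ring. Qed.

Lemma fmean_l2 N g : (0 < N)%N -> (N <= L)%N ->
  \sum_(x < L) cabs (fmean N g x%:Z) ^+ 2 <= \sum_(c < L) cabs (g c) ^+ 2.
Proof.
move=> N0 NL; have Nr : 0 < N%:R :> R by rewrite ltr0n.
apply: (@le_trans _ _ (\sum_(x < L) N%:R^-1 * \sum_(p < N) cabs (psum p g x%:Z) ^+ 2)).
  apply: ler_sum => x _; rewrite /fmean cabs_realM ?invr_ge0 ?(ltW Nr) // exprMn.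
  rewrite expr2 -mulrA ler_pM2l ?invr_gt0 // ler_pdivrMl //.
  apply: le_trans (sqr_sum_le _); rewrite lerXn2r ?nnegrE ?cabs_ge0 //; last exact: cabs_sum.
  by apply: sumr_ge0 => p _; exact: cabs_ge0.
rewrite -mulr_sumr ler_pdivrMl // exchange_big /=.
apply: (@le_trans _ _ (\sum_(p < N) \sum_(c < L) cabs (g c) ^+ 2)).
  by apply: ler_sum => p _; apply: psum_l2 => //; apply: leq_trans NL.
by rewrite sumr_const card_ord mulr_natl.
Qed.

Lemma halfline_l2 g : \sum_(x < L) cabs (halfline g x%:Z) ^+ 2 <= 10 * \sum_(c < L) cabs (g c) ^+ 2.
Proof.
have h1 := @fmean_l2 (2 * K) g ltac:(lia) ltac:(rewrite -KeL; nia).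
have h2 := @fmean_l2 K g K_gt0 ltac:(rewrite -KeL; nia).
apply: (@le_trans _ _ (\sum_(x < L) (8 * cabs (fmean (2 * K) g x%:Z) ^+ 2 +
   2 * cabs (fmean K g x%:Z) ^+ 2))).
  apply: ler_sum => x _; apply: le_trans (sqr_cabs_le_add _ _) _; rewrite cabsN cabsM.
  have -> : cabs (2 : R[i]) = 2.
    by rewrite -(rmorph_nat (real_complex R)) cabs_real normr_nat.
  by rewrite exprMn; lra.
by rewrite big_split /= -!mulr_sumr; lra.
Qed.

Lemma halfline_weak g t : 0 < t ->
  #|[set x : 'I_L | t < cabs (halfline g x%:Z)]|%:R * t <= (3 * C * C) * \sum_(c < L) cabs (g c).
Proof.
(* Off the exceptional set the combination is at most [2 C lam + C lam], which is [t]. *)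
move=> t0; pose lam := t / (3 * C).
have lam0 : 0 < lam by rewrite divr_gt0 ?mulr_gt0.
have [Xi [sXi good]] := weak_type g lam0.
have tE : t = (3 * C) * lam by rewrite /lam mulrC divfK // gt_eqF // mulr_gt0.
suff : #|[set x : 'I_L | t < cabs (halfline g x%:Z)]|%:R <= #|Xi|%:R :> R.
  have l0 := ltW lam0.
  have C30 : 0 <= 3 * C by rewrite mulr_ge0 // ltW.
  move=> /(ler_wpM2r l0) /le_trans /(_ sXi) /(ler_wpM2l C30).
  by rewrite tE; lra.
rewrite ler_nat; apply: subset_leq_card; apply/fintype.subsetP => x; rewrite inE.
apply: contraTT => xXi; rewrite -leNgt.
have h1 := good x xXi _ _ KeL.
have h2 := good x xXi K (2 * eta)%N ltac:(rewrite -KeL; ring).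
apply: le_trans (cabs_le_sub _ _) _; rewrite cabsM.
have -> : cabs (2 : R[i]) = 2.
  by rewrite -(rmorph_nat (real_complex R)) cabs_real normr_nat.
by rewrite tE; lra.
Qed.

(* Truncating g at each dyadic level and using the weak type (1,1) bound for
   the large part and the L2 bound for the small one. *)
Lemma halfline_llog g eps : 0 < eps ->
  \sum_(x < L) cabs (halfline g x%:Z) <=
  (24 * C * C + 40) * \sum_(c < L) (eps + llog eps (cabs (g c))).
Proof.
move=> e0.
(* The grid is finite, so finitely many dyadic layers cover all values of the projection. *)
have [n hn] : exists n : nat, forall x : 'I_L, cabs (halfline g x%:Z) <= 2 * eps * 2 ^+ n.
  pose M := \sum_(x < L) cabs (halfline g x%:Z).
  have e20 : 0 < 2 * eps by rewrite mulr_gt0.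
  exists (Num.truncn (M / (2 * eps))).+1 => x.
  apply: (@le_trans _ _ M).
    by rewrite /M (bigD1 x) //= lerDl sumr_ge0 // => y _; exact: cabs_ge0.
  have M0 : 0 <= M by apply: sumr_ge0 => y _; exact: cabs_ge0.
  rewrite -ler_pdivrMl // mulrC; apply: le_trans (ltW (truncnS_gt _)) _.
  by rewrite -natrX ler_nat ltnW // ltn_expl.
pose t i : R := eps * 2 ^+ i.
have t0 i : 0 < t i by rewrite mulr_gt0 // exprn_gt0.
pose hi i c : R[i] := if t i < cabs (g c) then g c else 0.
pose lo i c : R[i] := if t i < cabs (g c) then 0 else g c.
pose A i := [set x : 'I_L | t i < cabs (halfline (hi i) x%:Z)].
pose B i := [set x : 'I_L | t i < cabs (halfline (lo i) x%:Z)].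
have layer i : 2 * t i * #|[set x : 'I_L | 2 * t i < cabs (halfline g x%:Z)]|%:R <=
    \sum_(c < L) ((6 * C * C) * (if t i < cabs (g c) then cabs (g c) else 0) +
      20 * (if t i < cabs (g c) then 0 else cabs (g c) ^+ 2 / t i)).
  have sub : #|[set x : 'I_L | 2 * t i < cabs (halfline g x%:Z)]|%:R <= #|A i|%:R + #|B i|%:R :> R.
    rewrite -natrD ler_nat; apply: leq_trans (leq_card_setU _ _).
    apply: subset_leq_card; apply/fintype.subsetP => x; rewrite !inE; apply: contraTT.
    rewrite negb_or -!leNgt => /andP[h1 h2].
    have -> : halfline g x%:Z = halfline (hi i) x%:Z + halfline (lo i) x%:Z.
      rewrite -halflineD; congr (halfline _ _); apply/funext => c.
      by rewrite /hi /lo; case: ifP; rewrite ?addr0 ?add0r.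
    by apply: le_trans (cabs_le_add _ _) _; lra.
  have hA : 2 * (#|A i|%:R * t i) <= \sum_(c < L) (6 * C * C) * (if t i < cabs (g c) then cabs (g c) else 0).
    have := halfline_weak (hi i) (t0 i); rewrite -/(A i) -mulr_sumr.
    have -> : \sum_(c < L) cabs (hi i c) = \sum_(c < L) (if t i < cabs (g c) then cabs (g c) else 0).
      by apply: eq_bigr => c _; rewrite /hi; case: ifP; rewrite ?cabs0.
    by lra.
  have hB : 2 * (#|B i|%:R * t i) <= \sum_(c < L) 20 * (if t i < cabs (g c) then 0 else cabs (g c) ^+ 2 / t i).
    have cheb : #|B i|%:R * t i ^+ 2 <= \sum_(x < L) cabs (halfline (lo i) x%:Z) ^+ 2.
      rewrite -sum1_card natr_sum mulr_suml big_mkcond /=.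
      apply: ler_sum => x _; rewrite inE mul1r; case: ifP => [h|_]; last exact: sqr_ge0.
      by apply: lerXn2r; rewrite ?nnegrE ?cabs_ge0 // ltW.
    have := le_trans cheb (halfline_l2 (lo i)).
    have -> : \sum_(c < L) cabs (lo i c) ^+ 2 =
        t i * \sum_(c < L) (if t i < cabs (g c) then 0 else cabs (g c) ^+ 2 / t i).
      rewrite mulr_sumr; apply: eq_bigr => c _; rewrite /lo; case: ifP => _.
        by rewrite cabs0 expr0n mulr0.
      by rewrite mulrC divfK // gt_eqF.
    rewrite -mulr_sumr; set V := \sum_(c < L) _ => h.
    have : t i * (#|B i|%:R * t i) <= t i * (10 * V) by move: h; rewrite expr2; lra.
    by rewrite ler_pM2l //; lra.
  rewrite big_split /=.
  have t20 : 0 <= 2 * t i by rewrite mulr_ge0 // ltW.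
  by have := ler_wpM2l t20 sub; lra.
apply: (@le_trans _ _ (\sum_(x < L) (2 * eps + \sum_(i < n)
    (if 2 * t i < cabs (halfline g x%:Z) then 2 * t i else 0)))).
  by apply: ler_sum => x _; apply: le_dyadic_layers; rewrite ?cabs_ge0.
rewrite big_split /= exchange_big /=.
have layers : \sum_(i < n) \sum_(x < L) (if 2 * t i < cabs (halfline g x%:Z) then 2 * t i else 0)
   <= \sum_(c < L) \sum_(i < n) ((6 * C * C) * (if t i < cabs (g c) then cabs (g c) else 0) +
      20 * (if t i < cabs (g c) then 0 else cabs (g c) ^+ 2 / t i)).
  rewrite [leRHS]exchange_big /=; apply: ler_sum => i _.
  apply: le_trans (layer i); rewrite -sum1_card natr_sum mulr_sumr [leRHS]big_mkcond /=.
  by apply: ler_sum => x _; rewrite inE mulr1.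
apply: le_trans (lerD (lexx _) layers) _.
(* For fixed [c] the heights below [|g c|] are counted by the logarithm, and those above it give a
   geometric series. *)
rewrite -big_split mulr_sumr /=; apply: ler_sum => c _.
set u := cabs (g c); have u0 : 0 <= u by exact: cabs_ge0.
rewrite big_split /= -!mulr_sumr.
have h1 : \sum_(i < n) (if t i < u then u else 0) <= u * (4 * ln (1 + u / eps)).
  have := ler_wpM2l u0 (count_dyadic_below n e0 u0); apply: le_trans.
  by rewrite mulr_sumr; apply: ler_sum => i _; case: ifP; rewrite ?mulr1 ?mulr0.
have h2 : \sum_(i < n) (if t i < u then 0 else u ^+ 2 / t i) <= u * 2.
  have := ler_wpM2l u0 (sum_dyadic_above n e0 u0); apply: le_trans.
  rewrite mulr_sumr; apply: ler_sum => i _; rewrite -/(t i).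
  by case: ifP; rewrite ?mulr0 // expr2 mulrA.
have := mulr_ge0 u0 (ln_div_ge0 e0 u0).
have CC : 0 <= 6 * C * C by rewrite !mulr_ge0 // ltW.
have CCu : 0 <= 24 * C * C * (eps + u) by rewrite !mulr_ge0 ?addr_ge0 // ltW.
have := ler_wpM2l CC h1.
by rewrite /llog; lra.
Qed.

End Projection.

(** * John-Nirenberg inequality *)

Section JohnNirenberg.
Variable R : realType.
Implicit Types (u : nat -> R) (a : nat -> R[i]).

Definition dyadic_mean u (i j : nat) : R :=
  (2 ^+ i)^-1 * \sum_(t < 2 ^ i) u (j * 2 ^ i + t)%N.

Definition dyadic_var u (i j : nat) : R :=
  (2 ^+ i)^-1 * \sum_(t < 2 ^ i) (u (j * 2 ^ i + t)%N - dyadic_mean u i j) ^+ 2.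

Lemma sum_dyadic_split (F : nat -> R) (i j : nat) :
  \sum_(t < 2 ^ i.+1) F (j * 2 ^ i.+1 + t)%N =
  \sum_(t < 2 ^ i) F (j.*2 * 2 ^ i + t)%N + \sum_(t < 2 ^ i) F (j.*2.+1 * 2 ^ i + t)%N.
Proof.
rewrite -(big_mkord xpredT (fun t => F (j * 2 ^ i.+1 + t)%N)).
rewrite (@big_cat_nat _ _ _ (2 ^ i)) //=; last by rewrite leq_exp2l.
rewrite big_mkord; congr (_ + _).
  by apply: eq_bigr => t _; congr F; rewrite expnS; lia.
rewrite -{1}[(2 ^ i)%N]add0n big_addn expnS mul2n -addnn addnK big_mkord.
by apply: eq_bigr => t _; congr F; lia.
Qed.

Lemma dyadic_meanS u i j :
  dyadic_mean u i.+1 j = (dyadic_mean u i j.*2 + dyadic_mean u i j.*2.+1) / 2.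
Proof.
rewrite /dyadic_mean sum_dyadic_split exprS; field.
by rewrite expf_neq0.
Qed.

Lemma sum_sqr_mean u i j (k : R) :
  (2 ^+ i)^-1 * \sum_(t < 2 ^ i) (u (j * 2 ^ i + t)%N - k) ^+ 2 =
  dyadic_var u i j + (dyadic_mean u i j - k) ^+ 2.
Proof.
rewrite /dyadic_var; set m := dyadic_mean u i j.
have zero : \sum_(t < 2 ^ i) (u (j * 2 ^ i + t)%N - m) = 0.
  by rewrite sumrB sumr_const card_ord -(mulr_natl m) natrX /m /dyadic_mean mulVKf ?subrr //.
have -> : \sum_(t < 2 ^ i) (u (j * 2 ^ i + t)%N - k) ^+ 2 =
    \sum_(t < 2 ^ i) (u (j * 2 ^ i + t)%N - m) ^+ 2 + 2 ^+ i * (m - k) ^+ 2.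
  transitivity (\sum_(t < 2 ^ i) ((u (j * 2 ^ i + t)%N - m) ^+ 2 +
     ((u (j * 2 ^ i + t)%N - m) * (2 * (m - k)) + (m - k) ^+ 2))).
    by apply: eq_bigr => t _; ring.
  rewrite big_split big_split /= -mulr_suml zero mul0r add0r sumr_const card_ord.
  by rewrite -(mulr_natl ((m - k) ^+ 2)) natrX.
by rewrite mulrDr mulKf // expf_neq0.
Qed.

Lemma dyadic_var_le u i j (k : R) :
  dyadic_var u i j <= (2 ^+ i)^-1 * \sum_(t < 2 ^ i) (u (j * 2 ^ i + t)%N - k) ^+ 2.
Proof. by rewrite sum_sqr_mean lerDl sqr_ge0. Qed.

Lemma dyadic_var_ge0 u i j : 0 <= dyadic_var u i j.
Proof.
rewrite mulr_ge0 ?invr_ge0 ?exprn_ge0 //; apply: sumr_ge0 => t _; exact: sqr_ge0.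
Qed.

(** The law of total variance for the two halves of a block. *)
Lemma dyadic_varS u i j :
  dyadic_var u i.+1 j = (dyadic_var u i j.*2 + dyadic_var u i j.*2.+1) / 2
    + ((dyadic_mean u i j.*2 - dyadic_mean u i j.*2.+1) / 2) ^+ 2.
Proof.
rewrite {1}/dyadic_var; set m := dyadic_mean u i.+1 j.
rewrite (sum_dyadic_split (fun t => (u t - m) ^+ 2)) exprS invfM -mulrA mulrDr.
by rewrite !sum_sqr_mean /m dyadic_meanS; field.
Qed.

Lemma expR_le_quad (t : R) : `|t| <= 2^-1 -> expR t <= 1 + t + 2 * t ^+ 2.
Proof.
rewrite ler_norml => /andP[t1 t2].
have h : 0 < 1 - t by lra.
have : expR t <= (1 - t)^-1.
  by rewrite -[t in leLHS]opprK expRN lef_pV2 ?posrE ?expR_gt0 // -[1 - t]/(1 + - t) expR_ge1Dx.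
move=> /le_trans; apply; rewrite -[leLHS]mul1r ler_pdivrMr //.
have : 0 <= t ^+ 2 * (1 - 2 * t) by rewrite mulr_ge0 ?sqr_ge0 //; lra.
by rewrite !expr2; lra.
Qed.

Let bellman (v : R) := 1 + 4 * v - v ^+ 2.

(* The concave function [bellman] absorbs both the drift of the mean and the
   imbalance of the two half variances. *)
Lemma bellman_step (v w d : R) : 0 <= v - w -> 0 <= v + w -> v + d ^+ 2 <= 1 ->
  v - w <= 1 -> v + w <= 1 ->
  (expR (d / 4) * bellman (v + w) + expR (- (d / 4)) * bellman (v - w)) / 2 <=
  bellman (v + d ^+ 2).
Proof.
move=> v1 v2 vd w1 w2; have d2 := sqr_ge0 d.
have v0 : 0 <= v by lra.
have dle : `|d| <= 1 by rewrite -(@ler_pXn2r _ 2) ?nnegrE // expr1n real_normK ?num_real //; lra.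
have t4 : `|d / 4| <= 2^-1 by rewrite normrM normfV (ger0_norm (ler0n _ 4)); lra.
have e1 := expR_le_quad t4.
have e2 : expR (- (d / 4)) <= 1 + - (d / 4) + 2 * (- (d / 4)) ^+ 2.
  by apply: expR_le_quad; rewrite normrN.
have bpos x : 0 <= x -> x <= 1 -> 0 <= bellman x.
  move=> x0 x1; have : 0 <= x * (4 - x) by rewrite mulr_ge0 //; lra.
  by rewrite /bellman expr2; lra.
have b1 := bpos _ v2 w2; have b2 := bpos _ v1 w1.
have := ler_wpM2r b1 e1; have := ler_wpM2r b2 e2.
set E1 := expR _ * _; set E2 := expR _ * _ => h2 h1.
rewrite /bellman in h1 h2 *; move: h1 h2.
rewrite !expr2.
have : 0 <= (w - d / 4 * (2 - v)) ^+ 2 by exact: sqr_ge0.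
have : 0 <= d ^+ 2 * w ^+ 2 by rewrite mulr_ge0 ?sqr_ge0.
have : 0 <= d ^+ 2 * (1 - v - d ^+ 2) by rewrite mulr_ge0 ?sqr_ge0 //; lra.
have : 0 <= d ^+ 2 * v by rewrite mulr_ge0.
have v1' : 0 <= 1 - v by lra.
have : 0 <= d ^+ 2 * v * (1 - v) by apply: mulr_ge0 => //; exact: mulr_ge0.
rewrite !expr2; nra.
Qed.

(** Bellman induction on the scale: the halves have means [m + d] and [m - d], and the variance of
    the parent is their average variance plus [d ^ 2], so [bellman_step] climbs one level. The
    hypothesis on all dyadic variances keeps the arguments of [bellman] in [[0, 1]]. *)
Lemma exp_moment_le u (r i j : nat) : (i <= r)%N -> (j.+1 * 2 ^ i <= 2 ^ r)%N ->
  (forall i j, (i <= r)%N -> (j.+1 * 2 ^ i <= 2 ^ r)%N -> dyadic_var u i j <= 1) ->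
  (2 ^+ i)^-1 * \sum_(t < 2 ^ i) expR ((u (j * 2 ^ i + t)%N - dyadic_mean u i j) / 4) <=
  bellman (dyadic_var u i j).
Proof.
move=> ir jr var1; elim: i j ir jr => [|i IH] j ir jr.
  rewrite expn0 big_ord1 expr0 invr1 mul1r /dyadic_var /dyadic_mean.
  rewrite expn0 !big_ord1 expr0 invr1 !mul1r subrr expr0n /= mul0r expR0.
  by rewrite /bellman mulr0 expr0n subr0 addr0.
have ir' : (i <= r)%N by lia.
have jr1 : (j.*2.+1 * 2 ^ i <= 2 ^ r)%N by move: jr; rewrite expnS; nia.
have jr2 : (j.*2.+2 * 2 ^ i <= 2 ^ r)%N by move: jr; rewrite expnS; nia.
have h1 := IH _ ir' jr1; have h2 := IH _ ir' jr2.
set m1 := dyadic_mean u i j.*2 in h1; set m2 := dyadic_mean u i j.*2.+1 in h2.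
set v1 := dyadic_var u i j.*2 in h1; set v2 := dyadic_var u i j.*2.+1 in h2.
set m := dyadic_mean u i.+1 j.
have mE : m = (m1 + m2) / 2 by rewrite /m dyadic_meanS.
have vE : dyadic_var u i.+1 j = (v1 + v2) / 2 + ((m1 - m2) / 2) ^+ 2 by exact: dyadic_varS.
set d := (m1 - m2) / 2 in vE.
rewrite (sum_dyadic_split (fun t => expR ((u t - m) / 4))).
have q1 : \sum_(t < 2 ^ i) expR ((u (j.*2 * 2 ^ i + t)%N - m) / 4) =
    expR (d / 4) * \sum_(t < 2 ^ i) expR ((u (j.*2 * 2 ^ i + t)%N - m1) / 4).
  rewrite mulr_sumr; apply: eq_bigr => t _; rewrite -expRD; congr expR.
  by rewrite mE /d; field.
have q2 : \sum_(t < 2 ^ i) expR ((u (j.*2.+1 * 2 ^ i + t)%N - m) / 4) =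
    expR (- (d / 4)) * \sum_(t < 2 ^ i) expR ((u (j.*2.+1 * 2 ^ i + t)%N - m2) / 4).
  rewrite mulr_sumr; apply: eq_bigr => t _; rewrite -expRD; congr expR.
  by rewrite mE /d; field.
rewrite q1 q2 vE.
set S1 := \sum_(t < 2 ^ i) _ in h1 *; set S2 := \sum_(t < 2 ^ i) _ in h2 *.
have -> : (2 ^+ i.+1)^-1 * (expR (d / 4) * S1 + expR (- (d / 4)) * S2) =
   (expR (d / 4) * ((2 ^+ i)^-1 * S1) + expR (- (d / 4)) * ((2 ^+ i)^-1 * S2)) / 2.
  by rewrite exprS; field; rewrite expf_neq0.
have step := @bellman_step ((v1 + v2) / 2) ((v1 - v2) / 2) d.
rewrite -mulrBl -mulrDl in step.
have e1 : v1 + v2 + (v1 - v2) = v1 * 2 by ring.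
have e2 : v1 + v2 - (v1 - v2) = v2 * 2 by ring.
rewrite e1 e2 !mulfK // in step.
have v10 : 0 <= v1 by exact: dyadic_var_ge0.
have v20 : 0 <= v2 by exact: dyadic_var_ge0.
have v11 : v1 <= 1 by exact: var1.
have v21 : v2 <= 1 by exact: var1.
apply: le_trans (step v20 v10 _ v21 v11); last by rewrite -vE var1.
rewrite ler_pM2r ?invr_gt0 //; apply: lerD; rewrite ler_wpM2l ?expR_ge0 //.
Qed.

(** After scaling to [B = 1], the bounds [bellman <= 4] on [[0, 1]] and 2 for the exponential of a
    quarter of the mean give 8 for each of [u] and [- u]. *)
Lemma exp_abs_moment_le u (r : nat) (B : R) : 0 < B ->
  (forall i j, (i <= r)%N -> (j.+1 * 2 ^ i <= 2 ^ r)%N -> dyadic_var u i j <= B ^+ 2) ->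
  `|dyadic_mean u r 0| <= B ->
  \sum_(t < 2 ^ r) expR (`|u t| / (4 * B)) <= 16 * 2 ^+ r.
Proof.
move=> B0; wlog -> : u B B0 / B = 1 => [hw var mean|].
  have Bn : B != 0 by rewrite gt_eqF.
  have meanE i j : dyadic_mean (fun t => u t / B) i j = dyadic_mean u i j / B.
    by rewrite /dyadic_mean -mulr_suml mulrA.
  have varE i j : dyadic_var (fun t => u t / B) i j = dyadic_var u i j / B ^+ 2.
    rewrite /dyadic_var -mulrA mulr_suml; congr (_ * _); apply: eq_bigr => t _.
    by rewrite meanE -mulrBl exprMn exprVn.
  have := hw (fun t => u t / B) 1 ltr01 erefl.
  rewrite mulr1; under eq_bigr do rewrite normrM normfV (gtr0_norm B0) -mulrA -invfM (mulrC B).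
  apply=> [i j ir jr|]; first by rewrite varE ler_pdivrMr ?exprn_gt0 // expr1n mul1r var.
  by rewrite meanE normrM normfV (gtr0_norm B0) ler_pdivrMr // mul1r.
rewrite expr1n mulr1 => var mean.
have bell v : bellman v <= 5 by rewrite /bellman; have := sqr_ge0 (v - 2); rewrite !expr2; lra.
have bell4 v : v <= 1 -> 0 <= v -> bellman v <= 4 by rewrite /bellman expr2; nra.
have jr : (1 * 2 ^ r <= 2 ^ r)%N by rewrite mul1n.
have half (w : nat -> R) : (forall i j, (i <= r)%N -> (j.+1 * 2 ^ i <= 2 ^ r)%N ->
     dyadic_var w i j <= 1) -> `|dyadic_mean w r 0| <= 1 ->
    \sum_(t < 2 ^ r) expR (w t / 4) <= 8 * 2 ^+ r.
  move=> varw meanw.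
  have := exp_moment_le (leqnn r) jr varw.
  move=> /le_trans /(_ (bell4 _ (varw _ _ (leqnn r) jr) (dyadic_var_ge0 _ _ _))).
  rewrite ler_pdivrMl // => h.
  have e14 : expR (dyadic_mean w r 0 / 4) <= 2.
    move: meanw; rewrite ler_norml => /andP[m1 m2].
    have : `|dyadic_mean w r 0 / 4| <= 2^-1.
      by rewrite ler_norml; apply/andP; split; lra.
    by move=> /expR_le_quad; rewrite expr2; nra.
  have -> : \sum_(t < 2 ^ r) expR (w t / 4) =
     expR (dyadic_mean w r 0 / 4) * \sum_(t < 2 ^ r) expR ((w (0 * 2 ^ r + t)%N - dyadic_mean w r 0) / 4).
    rewrite mulr_sumr; apply: eq_bigr => t _; rewrite -expRD mul0n add0n; congr expR.
    by ring.
  have S0 : 0 <= \sum_(t < 2 ^ r) expR ((w (0 * 2 ^ r + t)%N - dyadic_mean w r 0) / 4).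
    by apply: sumr_ge0 => t _; exact: expR_ge0.
  by have := ler_wpM2r S0 e14; lra.
have hp := half u var mean.
have meanN i j : dyadic_mean (fun t => - u t) i j = - dyadic_mean u i j.
  by rewrite /dyadic_mean sumrN mulrN.
have hn : \sum_(t < 2 ^ r) expR (- u t / 4) <= 8 * 2 ^+ r.
  apply: (half (fun t => - u t)); last by rewrite meanN normrN.
  move=> i j ir jr'; rewrite /dyadic_var meanN.
  have := var i j ir jr'; rewrite /dyadic_var.
  by under [X in _ -> _ * X <= _]eq_bigr do rewrite -opprD sqrrN.
apply: (@le_trans _ _ (\sum_(t < 2 ^ r) (expR (u t / 4) + expR (- u t / 4)))).
  apply: ler_sum => t _; case: (leP 0 (u t)) => h.
    by rewrite ger0_norm // lerDl expR_ge0.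
  by rewrite ltr0_norm // lerDr expR_ge0.
by rewrite big_split /=; lra.
Qed.

(** Real and imaginary parts are treated separately and recombined by [2 x y <= x ^ 2 + y ^ 2] on
    exponentials, which costs the passage from [4 B] to [8 B]. *)
Lemma john_nirenberg a (r : nat) (B : R) : 0 < B ->
  (forall i j, (i <= r)%N -> (j.+1 * 2 ^ i <= 2 ^ r)%N -> exists kappa : R[i],
     \sum_(t < 2 ^ i) cabs (a (j * 2 ^ i + t)%N - kappa) ^+ 2 <= 2 ^+ i * B ^+ 2) ->
  cabs (\sum_(t < 2 ^ r) a t) <= 2 ^+ r * B ->
  \sum_(t < 2 ^ r) expR (cabs (a t) / (8 * B)) <= 16 * 2 ^+ r.
Proof.
move=> B0 osc mean.
have hRe : \sum_(t < 2 ^ r) expR (`|complex.Re (a t)| / (4 * B)) <= 16 * 2 ^+ r.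
  apply: (@exp_abs_moment_le (fun t => complex.Re (a t))) => // [i j ir jr|].
    have [kappa hk] := osc i j ir jr.
    apply: le_trans (dyadic_var_le _ _ _ (complex.Re kappa)) _.
    rewrite ler_pdivrMl //; apply: le_trans hk; apply: ler_sum => t _.
    by rewrite -ReB sqr_cabs lerDl sqr_ge0.
  rewrite /dyadic_mean normrM gtr0_norm ?invr_gt0 // ler_pdivrMl //.
  by under eq_bigr do rewrite mul0n add0n; rewrite -Re_sum (le_trans (normr_Re_le _)).
have hIm : \sum_(t < 2 ^ r) expR (`|complex.Im (a t)| / (4 * B)) <= 16 * 2 ^+ r.
  apply: (@exp_abs_moment_le (fun t => complex.Im (a t))) => // [i j ir jr|].
    have [kappa hk] := osc i j ir jr.
    apply: le_trans (dyadic_var_le _ _ _ (complex.Im kappa)) _.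
    rewrite ler_pdivrMl //; apply: le_trans hk; apply: ler_sum => t _.
    by rewrite -ImB sqr_cabs lerDr sqr_ge0.
  rewrite /dyadic_mean normrM gtr0_norm ?invr_gt0 // ler_pdivrMl //.
  by under eq_bigr do rewrite mul0n add0n; rewrite -Im_sum (le_trans (normr_Im_le _)).
apply: (@le_trans _ _ (\sum_(t < 2 ^ r) (expR (`|complex.Re (a t)| / (4 * B)) +
   expR (`|complex.Im (a t)| / (4 * B))) / 2)).
  apply: ler_sum => t _; set p := `|complex.Re _|; set q := `|complex.Im _|.
  have B80 : 0 < 8 * B by rewrite mulr_gt0.
  apply: (@le_trans _ _ (expR ((p + q) / (8 * B)))).
    by rewrite ler_expR ler_pM2r ?invr_gt0 // cabs_le_ReIm.
  have -> : expR (p / (4 * B)) = expR (p / (8 * B)) ^+ 2.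
    by rewrite expr2 -expRD; congr expR; field; rewrite gt_eqF.
  have -> : expR (q / (4 * B)) = expR (q / (8 * B)) ^+ 2.
    by rewrite expr2 -expRD; congr expR; field; rewrite gt_eqF.
  rewrite mulrDl expRD; have := sqr_ge0 (expR (p / (8 * B)) - expR (q / (8 * B))).
  by rewrite !expr2; lra.
by rewrite -mulr_suml big_split /=; lra.
Qed.

End JohnNirenberg.

(** * Square partial sums on the two-dimensional grid *)

Section PeriodicSums.
Variables (V : nmodType) (L : nat).
Hypothesis L_gt0 : (0 < L)%N.
Implicit Types F : int -> V.

Lemma periodic_mulz F : (forall y, F (y + L%:Z) = F y) -> forall y (k : int), F (y + k * L%:Z) = F y.
Proof.
move=> per; have nat_case (n : nat) y : F (y + n%:Z * L%:Z) = F y.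
  elim: n y => [|n IH] y; first by rewrite mul0r addr0.
  by rewrite intS mulrDl mul1r addrA IH per.
move=> y [n|n]; first exact: nat_case.
by rewrite -[in RHS](subrK (n.+1%:Z * L%:Z) y) nat_case NegzE mulNr.
Qed.

Lemma sum_periodic_shift F (k : int) : (forall y, F (y + L%:Z) = F y) ->
  \sum_(y < L) F (y%:Z + k) = \sum_(y < L) F y%:Z.
Proof.
move=> per; have nat_case (n : nat) : \sum_(y < L) F (y%:Z + n%:Z) = \sum_(y < L) F y%:Z.
  elim: n => [|n <-]; first by under eq_bigr do rewrite addr0.
  case: L L_gt0 per => // L' _ per'.
  rewrite big_ord_recr [RHS]big_ord_recl /= addrC; congr (_ + _).
    by rewrite -[RHS]per'; congr F; lia.
  by apply: eq_bigr => i _; congr F; rewrite /bump /=; lia.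
rewrite -(nat_case (absz (k + `|k| * L%:Z)%R)); apply: eq_bigr => y _.
rewrite -(periodic_mulz per _ `|k|) -addrA; congr (F (_ + _)).
by nia.
Qed.

Lemma sum_periodic_opp F : (forall y, F (y + L%:Z) = F y) ->
  \sum_(y < L) F (- y%:Z) = \sum_(y < L) F y%:Z.
Proof.
move=> per; rewrite -[RHS](sum_periodic_shift (1 - L%:Z) per) (reindex_inj rev_ord_inj) /=.
by apply: eq_bigr => y _; congr F; have := ltn_ord y; lia.
Qed.

End PeriodicSums.

Section GridPolynomials.
Variables (R : realType) (l : nat).
Let L := (2 ^ l)%N.
Let L_gt0 : (0 < L)%N. Proof. by rewrite expn_gt0. Qed.
Notation zeta := (zeta R L).
Implicit Types (s : seq (int * int)) (a : int * int -> R[i]) (P : pred (int * int)).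

(** A projection is a change of the predicate [P], with the list [s] and the coefficients [a] kept.
    A frequency may occur several times in [s]. *)
Definition grid_sum P s a (x y : int) : R[i] :=
  \sum_(p <- s | P p) a p * zeta (p.1 * x + p.2 * y).

Notation gpoly := (grid_sum predT).

Lemma gsum_periodic1 P s a x y : grid_sum P s a (x + L%:Z) y = grid_sum P s a x y.
Proof.
apply: eq_bigr => p _; rewrite (_ : p.1 * (x + L%:Z) + p.2 * y = p.1 * x + p.2 * y + p.1 * L%:Z).
  by rewrite zeta_period.
by ring.
Qed.

Lemma gsum_periodic2 P s a x y : grid_sum P s a x (y + L%:Z) = grid_sum P s a x y.
Proof.
apply: eq_bigr => p _; rewrite (_ : p.1 * x + p.2 * (y + L%:Z) = p.1 * x + p.2 * y + p.2 * L%:Z).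
  by rewrite zeta_period.
by ring.
Qed.

Lemma psum_exp (p : nat) (j x : int) : (`|j| + p < L)%N ->
  psum p (fun c : 'I_L => zeta (j * c%:Z)) x = if 0 <= j <= p%:Z then zeta (j * x) else 0.
Proof.
move=> jp; rewrite /psum; under eq_bigr do rewrite mulr_sumr.
rewrite exchange_big /=.
have inner (m : 'I_p.+1) : \sum_(c < L) zeta (j * c%:Z) * zeta ((x - c%:Z) * m%:Z) =
    if j == m%:Z then L%:R * zeta (x * m%:Z) else 0.
  rewrite (eq_bigr (fun c : 'I_L => zeta (x * m%:Z) * zeta (c%:Z * (j - m%:Z)))); last first.
    by move=> c _; rewrite -!zetaD; congr (zeta _); ring.
  rewrite -mulr_sumr sum_zeta //; case: eqP => [->|jm].
    by rewrite subrr dvdz0 mulrC.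
  rewrite ifF ?mulr0 //; apply/negP => /dvdzP[k hk].
  have mp := ltn_ord m; have k0 : k = 0 by nia.
  by apply: jm; move: hk; rewrite k0 mul0r => /eqP; rewrite subr_eq0 => /eqP.
under eq_bigr do rewrite inner.
rewrite -big_mkcond /=; case: ifP => jr; last first.
  by rewrite big_pred0 ?mulr0 // => m; apply/negP => /eqP jm; have := ltn_ord m; lia.
have jlt : (absz j < p.+1)%N by lia.
rewrite (big_pred1 (Ordinal jlt)) /=.
  rewrite -(rmorph_nat (real_complex R)) mulrA -rmorphM mulVf ?pnatr_eq0 -?lt0n //.
  by rewrite rmorph1 mul1r mulrC; congr (zeta (_ * _)); lia.
by move=> m; apply/eqP/eqP => [jm|-> /=]; [apply: val_inj => /=; lia|lia].
Qed.

(** The condition [|q.1| + p < L] excludes aliasing: a frequency congruent modulo [L] to one in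
    [[0, p]] is equal to it. *)
Lemma psum_gsum (p : nat) P s a (x y : int) :
  (forall q, q \in s -> (`|q.1| + p < L)%N) ->
  psum p (fun c : 'I_L => grid_sum P s a c%:Z y) x =
  grid_sum (fun q => P q && (0 <= q.1 <= p%:Z)) s a x y.
Proof.
move=> sL; rewrite /grid_sum.
rewrite (_ : (fun c : 'I_L => _) = (fun c : 'I_L => \sum_(q <- [seq q <- s | P q])
    (a q * zeta (q.2 * y)) * zeta (q.1 * c%:Z))); last first.
  by apply/funext => c; rewrite big_filter; apply: eq_bigr => q _; rewrite addrC zetaD mulrA.
rewrite psum_sum big_filter big_mkcondr big_seq_cond [RHS]big_seq_cond /=.
apply: eq_bigr => q /andP[qs _]; rewrite psumZ psum_exp ?sL //.
by case: ifP; rewrite ?mulr0 // -mulrA -zetaD addrC.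
Qed.

Section HalfPlanes.
Variables (K eta : nat).
Hypothesis KeL : (16 * (2 * K) * eta = L)%N.
Let K_gt0 : (0 < K)%N.
Proof. by have := L_gt0; rewrite -KeL !muln_gt0 => /andP[]. Qed.
Let eta_gt0 : (0 < eta)%N.
Proof. by have := L_gt0; rewrite -KeL !muln_gt0 => /andP[]. Qed.

Lemma fmean_exp (N : nat) (j x : int) : (0 < N)%N -> (`|j| + N <= L)%N -> (`|j| <= N)%N ->
  fmean N (fun c : 'I_L => zeta (j * c%:Z)) x =
  if 0 <= j then (1 - (`|j|%:R / N%:R : R))%:C * zeta (j * x) else 0.
Proof.
move=> N0 jNL jN; rewrite /fmean.
rewrite (eq_bigr (fun p : 'I_N => if 0 <= j <= p%:Z then zeta (j * x) else 0)); last first.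
  by move=> p _; rewrite psum_exp //; have := ltn_ord p; lia.
case: ifP => j0; last first.
  by rewrite big1 ?mulr0 // => p _; rewrite ifF //; lia.
have -> : \sum_(p < N) (if true && (j <= p%:Z) then zeta (j * x) else 0) =
    (N - `|j|)%:R * zeta (j * x).
  rewrite -big_mkcond /= -(big_mkord (fun p => j <= p%:Z) (fun=> zeta (j * x))).
  rewrite (@big_cat_nat _ _ _ `|j|) //= big_nat_cond big_pred0 ?add0r; last by move=> p; lia.
  rewrite big_nat_cond (eq_bigl (fun i => (`|j| <= i < N)%N)); last by move=> p; lia.
  by rewrite -big_nat sumr_const_nat mulr_natl.
rewrite mulrA; congr (_ * _); rewrite -(rmorph_nat (real_complex R)) -rmorphM; congr (_%:C).
rewrite natrB // mulrBr mulVf ?pnatr_eq0 -?lt0n //.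
by rewrite mulrC.
Qed.

Lemma halfline_exp (j x : int) : (`|j| <= K)%N ->
  halfline K (fun c : 'I_L => zeta (j * c%:Z)) x = if 0 <= j then zeta (j * x) else 0.
Proof.
move=> jK; have K2 : (0 < 2 * K)%N by rewrite muln_gt0.
have L1 : (`|j| + 2 * K <= L)%N by rewrite -KeL; nia.
rewrite /halfline (fmean_exp _ K2 L1); last by lia.
rewrite (fmean_exp _ K_gt0) //; last by lia.
case: ifP => _; last by rewrite mulr0 subrr.
rewrite mulrA -mulrBl -[RHS]mul1r; congr (_ * _).
rewrite -(rmorph_nat (real_complex R) 2) -rmorphM -rmorphB -[RHS](rmorph1 (real_complex R)).
by congr (_%:C); rewrite natrM; field; rewrite pnatr_eq0 -lt0n; lia.
Qed.

Lemma fmean_sum N I (r : seq I) (F : I -> 'I_L -> R[i]) x :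
  fmean N (fun c => \sum_(i <- r) F i c) x = \sum_(i <- r) fmean N (F i) x.
Proof.
rewrite /fmean -[RHS]mulr_sumr; congr (_ * _); rewrite exchange_big /=.
by apply: eq_bigr => p _; rewrite psum_sum.
Qed.

Lemma fmeanZ N (b : R[i]) g x : fmean N (fun c : 'I_L => b * g c) x = b * fmean N g x.
Proof.
rewrite /fmean mulrCA; congr (_ * _); rewrite mulr_sumr.
by apply: eq_bigr => p _; rewrite psumZ.
Qed.

Lemma halfline_exp_sum (I : eqType) (r : seq I) (b : I -> R[i]) (j : I -> int) x :
  (forall i, i \in r -> (`|j i| <= K)%N) ->
  halfline K (fun c : 'I_L => \sum_(i <- r) b i * zeta (j i * c%:Z)) x =
  \sum_(i <- r | 0 <= j i) b i * zeta (j i * x).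
Proof.
move=> jK; rewrite big_mkcond /=.
have -> : halfline K (fun c : 'I_L => \sum_(i <- r) b i * zeta (j i * c%:Z)) x =
    \sum_(i <- r) b i * halfline K (fun c : 'I_L => zeta (j i * c%:Z)) x.
  rewrite /halfline !fmean_sum mulr_sumr -sumrB; apply: eq_bigr => i _.
  by rewrite !fmeanZ; ring.
elim: r jK => [|i r IH] jK; first by rewrite !big_nil.
rewrite !big_cons IH => [|i' hi']; last by apply: jK; rewrite in_cons hi' orbT.
by rewrite halfline_exp ?jK ?mem_head //; case: ifP; rewrite ?mulr0 ?add0r.
Qed.

(** Along the antidiagonal through [(x, y)] the frequency [p] becomes [p.1 - p.2], so the half-plane
    becomes a half-line. *)
Lemma gsum_ge_halfline s a (x y : int) : (forall p, p \in s -> (`|p.1| + `|p.2| <= K)%N) ->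
  grid_sum (fun p => p.2 <= p.1) s a x y =
  halfline K (fun c : 'I_L => gpoly s a c%:Z (x + y - c%:Z)) x.
Proof.
move=> sK; rewrite /grid_sum.
rewrite (_ : (fun c : 'I_L => _) = (fun c : 'I_L => \sum_(p <- s)
    (a p * zeta (p.2 * (x + y))) * zeta ((p.1 - p.2) * c%:Z))); last first.
  apply/funext => c; apply: eq_bigr => p _; rewrite -mulrA -zetaD; congr (_ * zeta _).
  by ring.
rewrite halfline_exp_sum => [|p ps]; last by have := sK p ps; rewrite /=; lia.
rewrite [RHS](eq_bigl (fun p => p.2 <= p.1)) => [|p]; last by rewrite /= subr_ge0.
by apply: eq_bigr => p _; rewrite -mulrA -zetaD; congr (_ * zeta _); ring.
Qed.

(** Along the diagonal [p] becomes [p.1 + p.2]. The factor [zeta (- c)] lowers it by 1, turning the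
    strict inequality into the weak one that [halfline] selects. *)
Lemma gsum_gt_halfline s a (x y : int) : (forall p, p \in s -> (`|p.1| + `|p.2| < K)%N) ->
  grid_sum (fun p => 0 < p.1 + p.2) s a x y =
  zeta x * halfline K (fun c : 'I_L => zeta (- c%:Z) * gpoly s a c%:Z (c%:Z + y - x)) x.
Proof.
move=> sK; rewrite /grid_sum.
rewrite (_ : (fun c : 'I_L => _) = (fun c : 'I_L => \sum_(p <- s)
    (a p * zeta (p.2 * (y - x))) * zeta ((p.1 + p.2 - 1) * c%:Z))); last first.
  apply/funext => c; rewrite mulr_sumr; apply: eq_bigr => p _.
  by rewrite mulrCA -mulrA -!zetaD; congr (_ * zeta _); ring.
rewrite halfline_exp_sum => [|p ps]; last by have := sK p ps; rewrite /=; lia.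
rewrite mulr_sumr [RHS](eq_bigl (fun p => 0 < p.1 + p.2)) => [|p]; last by rewrite /=; lia.
by apply: eq_bigr => p _; rewrite mulrCA -mulrA -!zetaD; congr (_ * zeta _); ring.
Qed.

End HalfPlanes.
End GridPolynomials.

Lemma card_slices (T U : finType) (X : U -> {set T}) :
  #|[set xy : T * U | xy.1 \in X xy.2]| = (\sum_y #|X y|)%N.
Proof.
rewrite -sum1_card; 
under [RHS]eq_bigr do rewrite -sum1_card.
rewrite (eq_bigl (fun xy : T * U => xy.1 \in X xy.2)) => [|xy]; last by rewrite inE.
rewrite big_mkcond /= -(pair_bigA _ (fun x y => if x \in X y then 1%N else 0%N)) /=.
by rewrite exchange_big /=; apply: eq_bigr => y _; rewrite [RHS]big_mkcond.
Qed.

Section SideSums.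
Variables (R : realType) (l : nat).
Let L := (2 ^ l)%N.
Let L_gt0 : (0 < L)%N. Proof. by rewrite expn_gt0. Qed.
Notation gpoly := (@grid_sum R l predT).
Variables (K eta : nat).
Hypothesis KeL : (16 * (2 * K) * eta = L)%N.
Variable C : R.
Hypothesis C_gt0 : 0 < C.
Hypothesis weak_type : forall (g : 'I_L -> R[i]) (lam : R), 0 < lam ->
  exists Xi : {set 'I_L}, #|Xi|%:R * lam <= C * \sum_c cabs (g c) /\
    forall x, x \notin Xi -> forall N eta, (16 * N * eta = L)%N ->
      (forall n, exists kappa : R[i],
        \sum_(i < N) cabs (psum (n + i) g x%:Z - kappa) ^+ 2 <= N%:R * (C * lam) ^+ 2)
      /\ cabs (fmean N g x%:Z) <= C * lam.
Let C2 := 24 * C * C + 40.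
Variables (s : seq (int * int)) (a : int * int -> R[i]).
Hypothesis sK : forall p, p \in s -> (`|p.1| + `|p.2| < K)%N.

Let weak_mean (g : 'I_L -> R[i]) (lam : R) : 0 < lam ->
  exists Xi : {set 'I_L}, #|Xi|%:R * lam <= C * \sum_c cabs (g c) /\
    forall x, x \notin Xi -> forall N eta, (16 * N * eta = L)%N ->
      cabs (fmean N g x%:Z) <= C * lam.
Proof.
move=> lam0; have [Xi [sXi good]] := weak_type g lam0.
exists Xi; split=> // x xXi N e NeL.
by case: (good x xXi N e NeL).
Qed.

Definition grid_llog (eps : R) (b : int * int -> R[i]) (t : seq (int * int)) : R :=
  \sum_(x < L) \sum_(y < L) (eps + llog eps (cabs (gpoly t b x%:Z y%:Z))).

Let sum_antidiagonal (F : int -> int -> R) :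
  (forall x y, F x (y + L%:Z) = F x y) ->
  \sum_(x < L) \sum_(y < L) F x%:Z y%:Z = \sum_(t < L) \sum_(x < L) F x%:Z (x%:Z * 0 + t%:Z - x%:Z).
Proof.
move=> per; rewrite [RHS]exchange_big /=; apply: eq_bigr => x _.
rewrite -(sum_periodic_shift L_gt0 (- x%:Z) (per x%:Z)).
by apply: eq_bigr => y _; congr (F _ _); ring.
Qed.

Let sum_diagonal (F : int -> int -> R) :
  (forall x y, F x (y + L%:Z) = F x y) ->
  \sum_(x < L) \sum_(y < L) F x%:Z y%:Z = \sum_(t < L) \sum_(x < L) F x%:Z (t%:Z + x%:Z).
Proof.
move=> per; rewrite [RHS]exchange_big /=; apply: eq_bigr => x _.
by rewrite -(sum_periodic_shift L_gt0 x%:Z (per x%:Z)).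
Qed.

Lemma gsum_ge_norm1 (eps : R) : 0 < eps ->
  \sum_(x < L) \sum_(y < L) cabs (@grid_sum R l (fun p => p.2 <= p.1) s a x%:Z y%:Z) <=
  C2 * grid_llog eps a s.
Proof.
move=> e0.
rewrite (@sum_antidiagonal (fun x y => cabs (@grid_sum R l (fun p => p.2 <= p.1) s a x y))); last first.
  by move=> x y; rewrite gsum_periodic2.
rewrite /grid_llog (@sum_antidiagonal (fun x y => eps + llog eps (cabs (gpoly s a x y)))); last first.
  by move=> x y; rewrite gsum_periodic2.
rewrite mulr_sumr; apply: ler_sum => t _.
have := halfline_llog KeL C_gt0 weak_mean (fun c => gpoly s a c%:Z (c%:Z * 0 + t%:Z - c%:Z)) e0.
apply: le_trans; apply: ler_sum => x _.
rewrite (gsum_ge_halfline KeL) => [|p ps]; last by have := sK ps; lia.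
rewrite le_eqVlt; apply/orP; left; apply/eqP; congr (cabs (halfline _ _ _)).
by apply/funext => c; congr (grid_sum _ _ _ _ _); ring.
Qed.

Lemma gsum_gt_norm1 (eps : R) : 0 < eps ->
  \sum_(x < L) \sum_(y < L) cabs (@grid_sum R l (fun p => 0 < p.1 + p.2) s a x%:Z y%:Z) <=
  C2 * grid_llog eps a s.
Proof.
move=> e0.
rewrite (@sum_diagonal (fun x y => cabs (@grid_sum R l (fun p => 0 < p.1 + p.2) s a x y))); last first.
  by move=> x y; rewrite gsum_periodic2.
rewrite /grid_llog (@sum_diagonal (fun x y => eps + llog eps (cabs (gpoly s a x y)))); last first.
  by move=> x y; rewrite gsum_periodic2.
rewrite mulr_sumr; apply: ler_sum => t _.
have := halfline_llog KeL C_gt0 weak_mean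
  (fun c => zeta R L (- c%:Z) * gpoly s a c%:Z (t%:Z + c%:Z)) e0.
rewrite [X in _ <= _ * X](eq_bigr (fun c : 'I_L => eps + llog eps (cabs (gpoly s a c%:Z (t%:Z + c%:Z))))); last first.
  by move=> c _; rewrite cabsM cabs_zeta mul1r.
apply: le_trans; apply: ler_sum => x _.
rewrite (gsum_gt_halfline KeL) // cabsM cabs_zeta mul1r.
rewrite le_eqVlt; apply/orP; left; apply/eqP; congr (cabs (halfline _ _ _)).
apply/funext => c.
by rewrite (_ : c%:Z + (t%:Z + x%:Z) - x%:Z = t%:Z + c%:Z) //; ring.
Qed.

Lemma rowwise_weak_type (F : int -> int -> R[i]) (lam : R) : 0 < lam ->
  exists Bad : {set 'I_L * 'I_L},
    #|Bad|%:R * lam <= C * \sum_(x < L) \sum_(y < L) cabs (F x%:Z y%:Z) /\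
    forall x y : 'I_L, (x, y) \notin Bad -> forall N eta, (16 * N * eta = L)%N ->
      (forall n, exists kappa : R[i], \sum_(i < N)
         cabs (psum (n + i) (fun c : 'I_L => F c%:Z y%:Z) x%:Z - kappa) ^+ 2 <= N%:R * (C * lam) ^+ 2)
      /\ cabs (fmean N (fun c : 'I_L => F c%:Z y%:Z) x%:Z) <= C * lam.
Proof.
move=> lam0.
have [Xi hXi] := choice (fun y : 'I_L => weak_type (fun c : 'I_L => F c%:Z y%:Z) lam0).
exists [set xy | xy.1 \in Xi xy.2]; split.
  rewrite card_slices natr_sum mulr_suml exchange_big mulr_sumr /=.
  by apply: ler_sum => y _; case: (hXi y).
by move=> x y; rewrite inE /= => xXi; case: (hXi y) => _; apply.
Qed.

(** The right-hand quarter of the square, with one of its two slanted edges left out so that the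
    four quarter turns tile the square without the origin. *)
Definition side (n : nat) (p : int * int) : bool :=
  [&& 0 <= p.1, p.1 <= n%:Z, - p.1 < p.2 & p.2 <= p.1].

(** For [0 <= p.1] at least one of [p.2 <= p.1] and [0 < p.1 + p.2] holds, so the indicator of their
    conjunction is the sum of the two indicators minus 1. Each term depends on [n] only through a
    row partial sum. *)
Lemma side_sum_decomposition (n : nat) (x y : int) : (n + K <= L)%N ->
  @grid_sum R l (side n) s a x y =
  psum n (fun c : 'I_L => @grid_sum R l (fun p => p.2 <= p.1) s a c%:Z y) x +
  psum n (fun c : 'I_L => @grid_sum R l (fun p => 0 < p.1 + p.2) s a c%:Z y) x -
  psum n (fun c : 'I_L => gpoly s a c%:Z y) x.
Proof.
move=> nL; have sL q : q \in s -> (`|q.1| + n < L)%N by move=> /sK; lia.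
rewrite !psum_gsum // /grid_sum.
rewrite !(big_mkcond (fun p => _ && (0 <= _ <= _))) (big_mkcond (side n)) /=.
rewrite -sumrN -!big_split /=; apply: eq_bigr => p _.
set w := a p * _; rewrite /side.
have [h|h] := boolP (0 <= p.1 <= n%:Z); last first.
  rewrite !andbF oppr0 !addr0 ifF //; apply/negbTE; apply: contra h.
  by case/and4P => -> ->.
rewrite !andbT; case/andP: h => h0 hn; rewrite h0 hn /=.
by case: (ltP (- p.1) p.2) => h1; case: (leP p.2 p.1) => h2;
  case: (ltP 0 (p.1 + p.2)) => h3 /=; try (by exfalso; lia); ring.
Qed.

(** The weak type along rows is applied to the three functions of the decomposition. It costs their
    L^1 norms: [C2] times [grid_llog] for each projection, and once [grid_llog] for the
    polynomial. *)
Lemma side_sum_estimate (lam eps : R) : 0 < lam -> 0 < eps ->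
  exists Bad : {set 'I_L * 'I_L},
    #|Bad|%:R * lam <= C * (2 * C2 + 1) * grid_llog eps a s /\
    forall x y : 'I_L, (x, y) \notin Bad -> forall N eta, (16 * N * eta = L)%N ->
      (forall n, (n + N + K <= L)%N -> exists kappa : R[i], \sum_(i < N)
         cabs (@grid_sum R l (side (n + i)) s a x%:Z y%:Z - kappa) ^+ 2 <= N%:R * (4 * C * lam) ^+ 2)
      /\ ((N + K <= L)%N ->
          cabs (\sum_(p < N) @grid_sum R l (side p) s a x%:Z y%:Z) <= N%:R * (3 * C * lam)).
Proof.
move=> lam0 e0; have l0 := ltW lam0.
have [B1 [sB1 g1]] := rowwise_weak_type (@grid_sum R l (fun p => p.2 <= p.1) s a) lam0.
have [B2 [sB2 g2]] := rowwise_weak_type (@grid_sum R l (fun p => 0 < p.1 + p.2) s a) lam0.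
have [B3 [sB3 g3]] := rowwise_weak_type (@grid_sum R l predT s a) lam0.
exists (B1 :|: B2 :|: B3); split.
  have : #|B1 :|: B2 :|: B3|%:R <= #|B1|%:R + #|B2|%:R + #|B3|%:R :> R.
    rewrite -!natrD ler_nat; apply: leq_trans (leq_card_setU _ _) _.
    by rewrite leq_add2r leq_card_setU.
  move=> /(ler_wpM2r l0); rewrite !mulrDl => /le_trans; apply.
  have C0 := ltW C_gt0.
  have := ler_wpM2l C0 (gsum_ge_norm1 e0); have := ler_wpM2l C0 (gsum_gt_norm1 e0).
  have : \sum_(x < L) \sum_(y < L) cabs (gpoly s a x%:Z y%:Z) <= grid_llog eps a s.
    apply: ler_sum => x _; apply: ler_sum => y _.
    apply: le_trans (le_llog e0 (cabs_ge0 _)) _; rewrite lerDr; exact: ltW.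
  move=> /(ler_wpM2l C0).
  by lra.
move=> x y; rewrite !inE !negb_or => /andP[/andP[n1 n2] n3] N e NeL.
have [osc1 m1] := g1 x y n1 N e NeL; have [osc2 m2] := g2 x y n2 N e NeL.
have [osc3 m3] := g3 x y n3 N e NeL.
have Nr : 0 <= N%:R :> R by rewrite ler0n.
split=> [n nL|NL].
  have [k1 h1] := osc1 n; have [k2 h2] := osc2 n; have [k3 h3] := osc3 n.
  exists (k1 + k2 - k3).
  apply: (@le_trans _ _ (\sum_(i < N) (4 * cabs (psum (n + i) (fun c : 'I_L => @grid_sum R l (fun p => p.2 <= p.1) s a c%:Z y%:Z) x%:Z - k1) ^+ 2 +
     4 * cabs (psum (n + i) (fun c : 'I_L => @grid_sum R l (fun p => 0 < p.1 + p.2) s a c%:Z y%:Z) x%:Z - k2) ^+ 2 +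
     2 * cabs (psum (n + i) (fun c : 'I_L => gpoly s a c%:Z y%:Z) x%:Z - k3) ^+ 2))).
    apply: ler_sum => i _; rewrite side_sum_decomposition; last first.
      by apply: leq_trans nL; rewrite leq_add2r leq_add2l ltnW.
    set u := psum _ _ _; set v := psum _ _ _; set w := psum _ _ _.
    have -> : u + v - w - (k1 + k2 - k3) = ((u - k1) + (v - k2)) + - (w - k3) by ring.
    apply: le_trans (sqr_cabs_le_add _ _) _; rewrite cabsN lerD2r.
    by have := sqr_cabs_le_add (u - k1) (v - k2); lra.
  rewrite !big_split /= -!mulr_sumr.
  have : 0 <= N%:R * (C * lam) ^+ 2 by rewrite mulr_ge0 // sqr_ge0.
  have -> : (4 * C * lam) ^+ 2 = 16 * (C * lam) ^+ 2 by ring.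
  by lra.
have sumE : \sum_(p < N) @grid_sum R l (side p) s a x%:Z y%:Z =
   N%:R * (fmean N (fun c : 'I_L => @grid_sum R l (fun p => p.2 <= p.1) s a c%:Z y%:Z) x%:Z +
     fmean N (fun c : 'I_L => @grid_sum R l (fun p => 0 < p.1 + p.2) s a c%:Z y%:Z) x%:Z -
     fmean N (fun c : 'I_L => gpoly s a c%:Z y%:Z) x%:Z).
  have N0 : (0 < N)%N by have := L_gt0; rewrite -NeL !muln_gt0 => /andP[].
  rewrite /fmean -mulrDr -mulrBr mulrA -{1}(rmorph_nat (real_complex R)) -rmorphM.
  rewrite mulfV ?pnatr_eq0 -?lt0n // rmorph1 mul1r -big_split -sumrB /=.
  by apply: eq_bigr => p _; rewrite side_sum_decomposition // (leq_trans _ NL) // leq_add2r ltnW.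
rewrite sumE cabsM -{1}(rmorph_nat (real_complex R)) cabs_real normr_nat ler_wpM2l //.
apply: le_trans (cabs_le_sub _ _) _.
apply: le_trans (lerD (cabs_le_add _ _) (lexx _)) _.
by lra.
Qed.

End SideSums.

(** * Quarter turns of frequencies and of the grid *)

Definition quarter_turn (p : int * int) : int * int := (p.2, - p.1).
Definition quarter_turn_inv (p : int * int) : int * int := (- p.2, p.1).
Notation turn k := (iter k quarter_turn).
Notation turn_inv k := (iter k quarter_turn_inv).

Lemma turnK k : cancel (turn k) (turn_inv k).
Proof.
elim: k => [//|k IH] p; rewrite [turn k.+1 p]iterS [turn_inv _ _]iterSr /quarter_turn_inv /=.
by rewrite opprK -[X in iter _ _ X]surjective_pairing IH.
Qed.

Lemma turn_dot k (p z : int * int) :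
  (turn k p).1 * (turn k z).1 + (turn k p).2 * (turn k z).2 = p.1 * z.1 + p.2 * z.2.
Proof. by elim: k => [//|k IH] /=; rewrite -IH; ring. Qed.

Lemma turn_norm k (p : int * int) :
  (`|(turn k p).1| + `|(turn k p).2| = `|p.1| + `|p.2|)%N.
Proof. by elim: k => [//|k IH] /=; rewrite -IH abszN addnC. Qed.

Section Rotations.
Variables (R : realType) (l : nat).
Let L := (2 ^ l)%N.
Let L_gt0 : (0 < L)%N. Proof. by rewrite expn_gt0. Qed.
Implicit Types (s : seq (int * int)) (a : int * int -> R[i]) (P : pred (int * int)).
Notation gsum := (@grid_sum R l).

(** Turning frequencies and points together preserves their pairing, so a turned sector of [s] is a
    plain sector of the turned list. *)
Lemma gsum_turn P s a k (z : int * int) :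
  gsum P (map (turn k) s) (fun q => a (turn_inv k q)) (turn k z).1 (turn k z).2 =
  gsum (fun p => P (turn k p)) s a z.1 z.2.
Proof.
rewrite /grid_sum big_map; apply: eq_bigr => p _.
by rewrite turnK turn_dot.
Qed.

Lemma grid_llog_turn eps s a k :
  grid_llog l eps (fun q => a (turn_inv k q)) (map (turn k) s) = grid_llog l eps a s.
Proof.
elim: k => [|k IH]; first by rewrite map_id.
rewrite -IH /grid_llog.
pose F x y := eps + llog eps (cabs (gsum predT (map (turn k) s) (fun q => a (turn_inv k q)) x y)).
transitivity (\sum_(x < L) \sum_(y < L) F (- y%:Z) x%:Z).
  apply: eq_bigr => x _; apply: eq_bigr => y _; congr (_ + llog _ (cabs _)).
  rewrite /grid_sum !big_map; apply: eq_bigr => p _.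
  rewrite !turnK [turn k.+1 p]iterS /=; congr (_ * zeta _ _ _).
  by ring.
rewrite exchange_big; rewrite (sum_periodic_opp L_gt0 (F := fun y => \sum_(x < L) F y x%:Z)) //.
by move=> y; apply: eq_bigr => x _; rewrite /F gsum_periodic1.
Qed.

Definition neg_ord (x : 'I_L) : 'I_L := Ordinal (ltn_pmod (L - x) L_gt0).

Lemma neg_ord_inj : injective neg_ord.
Proof.
move=> x y /(congr1 val) /= h; apply: val_inj => /=.
have xL := ltn_ord x; have yL := ltn_ord y.
have [x0|x0] := posnP x; have [y0|y0] := posnP y; move: h; rewrite ?x0 ?y0 ?subn0 ?modnn //.
- by rewrite modn_small; lia.
- by rewrite modn_small; lia.
- by rewrite !modn_small; lia.
Qed.

Definition grid_turn (z : 'I_L * 'I_L) : 'I_L * 'I_L := (z.2, neg_ord z.1).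

Lemma grid_turn_inj : injective grid_turn.
Proof.
move=> [x y] [x' y'] e; have /= <- := congr1 fst e.
by have /= /neg_ord_inj <- := congr1 snd e.
Qed.

Lemma neg_ordE (x : 'I_L) : exists k : int, (neg_ord x)%:Z = - x%:Z + k * L%:Z.
Proof.
have xL := ltn_ord x; have [x0|x0] := posnP x.
  by exists 0; rewrite /= x0 subn0 modnn oppr0 mul0r.
by exists 1; rewrite /= modn_small; lia.
Qed.

Lemma grid_turnE k (z : 'I_L * 'I_L) : exists u v : int,
  ((iter k grid_turn z).1)%:Z = (turn k (z.1%:Z, z.2%:Z)).1 + u * L%:Z /\
  ((iter k grid_turn z).2)%:Z = (turn k (z.1%:Z, z.2%:Z)).2 + v * L%:Z.
Proof.
elim: k => [|k [u [v [hu hv]]]]; first by exists 0, 0; rewrite !mul0r !addr0.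
have [w hw] := neg_ordE (iter k grid_turn z).1.
exists v, (w - u); rewrite !iterS /=; split => //.
by rewrite hw hu; ring.
Qed.

Lemma gsum_grid_turn P s a k (x y : 'I_L) :
  gsum P (map (turn k) s) (fun q => a (turn_inv k q))
    (iter k grid_turn (x, y)).1%:Z (iter k grid_turn (x, y)).2%:Z =
  gsum (fun p => P (turn k p)) s a x%:Z y%:Z.
Proof.
have [u [v [-> ->]]] := grid_turnE k (x, y).
rewrite (periodic_mulz (F := fun x => gsum _ _ _ x _)); last first.
  by move=> w; rewrite gsum_periodic1.
rewrite (periodic_mulz (F := fun y => gsum _ _ _ _ y)); last first.
  by move=> w; rewrite gsum_periodic2.
exact: gsum_turn P s a k (x%:Z, y%:Z).
Qed.

Lemma iter_grid_turn_inj k : injective (iter k grid_turn).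
Proof. by elim: k => [|k IH] x y //= /grid_turn_inj /IH. Qed.

Definition square (n : nat) (p : int * int) : bool := (`|p.1| <= n)%N && (`|p.2| <= n)%N.

(** By the choice of edges in [side], every nonzero frequency of the square lies in exactly one of
    the four turned sectors. *)
Lemma gsum_squareE n s a (x y : int) :
  gsum (square n) s a x y = \sum_(p <- s | p == (0, 0)) a p
   + \sum_(k < 4) gsum (fun p => side n (turn k p)) s a x y.
Proof.
rewrite /grid_sum big_mkcond [in RHS]big_mkcond /=.
under [X in _ = _ + X]eq_bigr do rewrite big_mkcond /=.
rewrite exchange_big -big_split /=; apply: eq_bigr => p _.
rewrite !big_ord_recl big_ord0 /= /bump /= addr0 /square /side /=.
have [->|p0] := eqVneq p (0, 0); first by rewrite /= !mul0r addr0 zeta0 mulr1 !addr0.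
set w := a p * _.
have {p0} : (p.1 != 0) || (p.2 != 0).
  by case: p p0 {w} => u v /=; rewrite xpair_eqE negb_and.
rewrite add0r; move: p.1 p.2 w => u v w uv.
case: (boolP (_ && _)) => sq; repeat (case: (boolP [&& _, _, _ & _]) => ?);
  try (by exfalso; lia); by ring.
Qed.

Lemma sum_gsum s a : (forall p, p \in s -> (`|p.1| + `|p.2| < L)%N) ->
  \sum_(x < L) \sum_(y < L) gsum predT s a x%:Z y%:Z =
  L%:R * L%:R * \sum_(p <- s | p == (0, 0)) a p.
Proof.
move=> sL; rewrite /grid_sum.
under eq_bigr do rewrite exchange_big /=.
rewrite exchange_big /= mulr_sumr [RHS]big_mkcond big_seq [RHS]big_seq /=.
apply: eq_bigr => p ps.
transitivity (a p * ((\sum_(x < L) zeta R L (x%:Z * p.1)) * (\sum_(y < L) zeta R L (y%:Z * p.2)))).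
  rewrite big_distrlr /= mulr_sumr; apply: eq_bigr => x _; rewrite mulr_sumr.
  by apply: eq_bigr => y _; rewrite -zetaD; congr (_ * zeta _ _ _); ring.
have small (j : int) : (`|j| < L)%N -> (L%:Z %| j)%Z = (j == 0).
  move=> jL; apply/idP/eqP => [/dvdzP[k hk]|->]; last exact: dvdz0.
  have k0 : k = 0 by nia.
  by rewrite hk k0 mul0r.
have pL := sL p ps.
have p1L := leq_ltn_trans (leq_addr _ _) pL.
have p2L := leq_ltn_trans (leq_addl _ _) pL.
rewrite !sum_zeta // !small //.
case: p {ps pL p1L p2L} => u v /=; rewrite xpair_eqE.
by case: eqP; case: eqP; rewrite /= ?mulr0 ?mul0r ?mulr0 // mulrC.
Qed.

End Rotations.

Section GridEstimate.
Variables (R : realType) (l : nat) (C : R).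
Let L := (2 ^ l)%N.
Let L_gt0 : (0 < L)%N. Proof. by rewrite expn_gt0. Qed.
Hypothesis C_gt0 : 0 < C.
Hypothesis weak_type : forall (g : 'I_L -> R[i]) (lam : R), 0 < lam ->
  exists Xi : {set 'I_L}, #|Xi|%:R * lam <= C * \sum_c cabs (g c) /\
    forall x, x \notin Xi -> forall N eta, (16 * N * eta = L)%N ->
      (forall n, exists kappa : R[i],
        \sum_(i < N) cabs (psum (n + i) g x%:Z - kappa) ^+ 2 <= N%:R * (C * lam) ^+ 2)
      /\ cabs (fmean N g x%:Z) <= C * lam.
Let C2 := 24 * C * C + 40.
Variables (s : seq (int * int)) (a : int * int -> R[i]) (k r : nat).
Hypothesis sK : forall p, p \in s -> (`|p.1| + `|p.2| < 2 ^ k)%N.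
Hypothesis lE : (l = k + r + 5)%N.
Let S n x y := @grid_sum R l (square n) s a x y.

(** In [L = 2 ^ (k + r + 5)] the factor [2 ^ k] exceeds the frequencies, [2 ^ r] the indices, and
    [2 ^ 5] is the constant of [16 (2 K) eta = L]. Each block length [2 ^ m] with [m <= r] then also
    fits [16 N eta = L], so one exceptional set serves all dyadic blocks. *)
Lemma grid_exp_bound (lam eps : R) : 0 < lam -> 0 < eps ->
  exists Bad : {set 'I_L * 'I_L},
    #|Bad|%:R * lam <= (4 * (C * (2 * C2 + 1)) + 1) * grid_llog l eps a s /\
    forall x y : 'I_L, (x, y) \notin Bad -> forall i, (i <= r)%N ->
      \sum_(t < 2 ^ i) expR (cabs (S t x%:Z y%:Z) / (8 * (16 * (C + 1) * lam))) <= 16 * 2 ^+ i.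
Proof.
move=> lam0 e0; have l0 := ltW lam0; have C0 := ltW C_gt0.
have KL : (16 * (2 * 2 ^ k) * 2 ^ r = L)%N by rewrite /L lE !expnD; lia.
have KL' : (2 ^ r + 2 ^ k <= L)%N.
  have := expn_gt0 2 r; have := expn_gt0 2 k; rewrite -KL; nia.
have A0 : 0 <= grid_llog l eps a s.
  by apply: sumr_ge0 => x _; apply: sumr_ge0 => y _; rewrite addr_ge0 ?llog_ge0 ?cabs_ge0 // ltW.
have G1 : \sum_(x < L) \sum_(y < L) cabs (@grid_sum R l predT s a x%:Z y%:Z) <= grid_llog l eps a s.
  apply: ler_sum => x _; apply: ler_sum => y _.
  by apply: le_trans (le_llog e0 (cabs_ge0 _)) _; rewrite lerDr; exact: ltW.
have C20 : 0 <= C * (2 * C2 + 1) by rewrite /C2 !(mulr_ge0, addr_ge0).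
set S0 := \sum_(p <- s | p == (0, 0)) a p.
have Lr : 0 < L%:R :> R by rewrite ltr0n.
have S0E : L%:R * L%:R * cabs S0 <= grid_llog l eps a s.
  apply: le_trans G1.
  have -> : L%:R * L%:R * cabs S0 = cabs (\sum_(x < L) \sum_(y < L) @grid_sum R l predT s a x%:Z y%:Z).
    rewrite sum_gsum => [|p ps]; last by apply: leq_trans (sK ps) _; apply: leq_trans KL'; rewrite leq_addl.
    by rewrite !cabsM -(rmorph_nat (real_complex R)) cabs_real normr_nat.
  apply: le_trans (cabs_sum _ _ _) _; apply: ler_sum => x _; exact: cabs_sum.
(* The constant term belongs to no sector. If it exceeds [lam] the whole grid may be exceptional,
   since [L ^ 2 |S0|] is at most the sum of the moduli; this is the [+ 1] in the constant. *)
have [big|small] := ltP lam (cabs S0).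
  exists [set: 'I_L * 'I_L]; split; last by move=> x y; rewrite inE.
  rewrite cardsT card_prod card_ord natrM.
  have : L%:R * L%:R * lam <= L%:R * L%:R * cabs S0 by rewrite ler_pM2l ?mulr_gt0 // ltW.
  by have := mulr_ge0 C20 A0; lra.
have side_est (j : 'I_4) := @side_sum_estimate R l (2 ^ k) (2 ^ r) KL C C_gt0 weak_type
  (map (iter j quarter_turn) s) (fun q => a (iter j quarter_turn_inv q)).
have /choice[Bad hBad] : forall j : 'I_4, exists B : {set 'I_L * 'I_L},
    #|B|%:R * lam <= C * (2 * C2 + 1) * grid_llog l eps a s /\
    forall x y : 'I_L, (x, y) \notin iter j (@grid_turn l) @^-1: B -> forall N eta, (16 * N * eta = L)%N ->
      (forall n, (n + N + 2 ^ k <= L)%N -> exists kappa : R[i], \sum_(i < N)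
         cabs (@grid_sum R l (fun p => side (n + i) (iter j quarter_turn p)) s a x%:Z y%:Z - kappa) ^+ 2
           <= N%:R * (4 * C * lam) ^+ 2)
      /\ ((N + 2 ^ k <= L)%N ->
          cabs (\sum_(p < N) @grid_sum R l (fun q => side p (iter j quarter_turn q)) s a x%:Z y%:Z)
            <= N%:R * (3 * C * lam)).
  move=> j; have sKj p : p \in [seq iter j quarter_turn i | i <- s] -> (`|p.1| + `|p.2| < 2 ^ k)%N.
    by move=> /mapP[q qs ->]; rewrite turn_norm sK.
  have [B [sB hB]] := side_est j sKj lam eps lam0 e0.
  exists B; split; first by rewrite grid_llog_turn in sB.
  move=> x y; rewrite inE => nB N e NeL.
  move: nB; rewrite [iter j _ (x, y)]surjective_pairing => nB.
  have [osc mean] := hB _ _ nB N e NeL; split=> [n nL|NL].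
    have [kappa hk] := osc n nL; exists kappa; apply: le_trans hk.
    by apply: ler_sum => i _; rewrite gsum_grid_turn.
  by under eq_bigr do rewrite -gsum_grid_turn; exact: mean.
exists (\bigcup_(j < 4) (iter j (@grid_turn l) @^-1: Bad j)); split.
  have : #|\bigcup_(j < 4) (iter j (@grid_turn l) @^-1: Bad j)|%:R <= \sum_(j < 4) #|Bad j|%:R :> R.
    rewrite -natr_sum ler_nat.
    elim/big_rec2: _ => [|j n B _ nB]; first by rewrite cards0.
    apply: leq_trans (leq_card_setU _ _) _; apply: leq_add nB.
    by rewrite card_preimset //; exact: iter_grid_turn_inj.
  move=> /(ler_wpM2r l0) /le_trans; apply.
  rewrite mulr_suml; apply: (@le_trans _ _ (\sum_(j < 4) C * (2 * C2 + 1) * grid_llog l eps a s)).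
    by apply: ler_sum => j _; case: (hBad j).
  by rewrite sumr_const card_ord -(mulr_natl (C * (2 * C2 + 1) * grid_llog l eps a s)); lra.
move=> x y nBad i ir.
have good (j : 'I_4) : (x, y) \notin iter j (@grid_turn l) @^-1: Bad j.
  by apply: contra nBad => h; apply/bigcupP; exists j.
have block (m : nat) : (m <= r)%N -> (16 * 2 ^ m * 2 ^ (k + r + 1 - m) = L)%N.
  move=> mr; rewrite -mulnA -expnD subnKC; last first.
    by apply: leq_trans mr _; rewrite addnAC leq_addl.
  by rewrite /L lE (_ : 16%N = (2 ^ 4)%N) // -expnD addnC -addnA.
(* Four sectors of oscillation [4 C lam] give [16 C lam]; their means and the constant term give
   [12 C lam + lam]. *)
have B0 : 0 < 16 * (C + 1) * lam by rewrite !mulr_gt0 // addr_gt0.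
have SE n : S n x%:Z y%:Z = S0 + \sum_(j < 4) @grid_sum R l (fun p => side n (iter j quarter_turn p)) s a x%:Z y%:Z.
  exact: gsum_squareE.
apply: (@john_nirenberg R (fun n => S n x%:Z y%:Z)) => // [m j mi ji|].
  have mr := leq_trans mi ir.
  have jL : (j * 2 ^ m + 2 ^ m + 2 ^ k <= L)%N.
    apply: leq_trans KL'; rewrite leq_add2r -mulSnr; apply: leq_trans ji _.
    by rewrite leq_exp2l.
  have /choice[kap hk] : forall q : 'I_4, exists kappa : R[i], \sum_(t < 2 ^ m)
     cabs (@grid_sum R l (fun p => side (j * 2 ^ m + t) (iter q quarter_turn p)) s a x%:Z y%:Z - kappa) ^+ 2
           <= (2 ^ m)%:R * (4 * C * lam) ^+ 2.
    move=> q; have [_ h] := hBad q.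
    by have [osc _] := h x y (good q) _ _ (block m mr); exact: osc.
  exists (S0 + \sum_(q < 4) kap q).
  apply: (@le_trans _ _ (\sum_(t < 2 ^ m) 4 * \sum_(q < 4) cabs (@grid_sum R l
     (fun p => side (j * 2 ^ m + t) (iter q quarter_turn p)) s a x%:Z y%:Z - kap q) ^+ 2)).
    apply: ler_sum => t _; rewrite SE.
    set F := fun q : 'I_4 => @grid_sum R l (fun p => side (j * 2 ^ m + t) (iter q quarter_turn p)) s a x%:Z y%:Z.
    have -> : S0 + \sum_(q < 4) F q - (S0 + \sum_(q < 4) kap q) = \sum_(q < 4) (F q - kap q).
      by rewrite sumrB; ring.
    apply: le_trans (sqr_sum_le (fun q : 'I_4 => cabs (F q - kap q))).
    apply: lerXn2r; rewrite ?nnegrE ?cabs_ge0 ?cabs_sum //.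
    by apply: sumr_ge0 => q _; exact: cabs_ge0.
  rewrite -mulr_sumr exchange_big /=.
  apply: (@le_trans _ _ (4 * \sum_(q < 4) (2 ^ m)%:R * (4 * C * lam) ^+ 2)).
    by rewrite ler_pM2l //; apply: ler_sum => q _; exact: hk.
  rewrite sumr_const card_ord -(mulr_natl ((2 ^ m)%:R * _)) natrX.
  have -> : 4 * (4 * (2 ^+ m * (4 * C * lam) ^+ 2)) = 2 ^+ m * (16 * C * lam) ^+ 2 by ring.
  rewrite ler_pM2l ?exprn_gt0 //; apply: lerXn2r; rewrite ?nnegrE ?mulr_ge0 ?addr_ge0 //.
  by rewrite ler_wpM2r // ler_wpM2l // lerDl.
under eq_bigr do rewrite SE.
rewrite big_split /= sumr_const card_ord exchange_big /=.
apply: le_trans (cabs_le_add _ _) _.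
have h1 : cabs (S0 *+ 2 ^ i) <= 2 ^+ i * lam.
  rewrite -(mulr_natl S0) cabsM -(rmorph_nat (real_complex R)) cabs_real normr_nat natrX.
  by rewrite ler_pM2l // exprn_gt0.
have h2 : cabs (\sum_(j < 4) \sum_(t < 2 ^ i) @grid_sum R l (fun p => side t (iter j quarter_turn p)) s a x%:Z y%:Z)
   <= 2 ^+ i * (12 * C * lam).
  apply: le_trans (cabs_sum _ _ _) _.
  apply: (@le_trans _ _ (\sum_(j < 4) (2 ^ i)%:R * (3 * C * lam))).
    apply: ler_sum => j _; have [_ h] := hBad j.
    have [_ mean] := h x y (good j) _ _ (block i ir); apply: mean.
    by apply: leq_trans KL'; rewrite leq_add2r leq_exp2l.
  by rewrite sumr_const card_ord -(mulr_natl ((2 ^ i)%:R * _)) natrX; lra.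
apply: le_trans (lerD h1 h2) _; rewrite -mulrDr ler_pM2l ?exprn_gt0 //.
have := mulr_ge0 C0 l0.
by lra.
Qed.

End GridEstimate.

(** The order of the quantifiers matters: [A] precedes everything, and [l] may depend on the
    frequencies and on [r] but not on the coefficients, which vary with the translate of the
    grid. *)
Lemma grid_exp_estimate (R : realType) : exists2 A : R, 0 < A &
  forall (s : seq (int * int)) (r : nat), exists l : nat,
  forall (a : int * int -> R[i]) (lam eps : R), 0 < lam -> 0 < eps ->
  exists Bad : {set 'I_(2 ^ l) * 'I_(2 ^ l)},
    #|Bad|%:R * lam <= A * grid_llog l eps a s /\
    forall x y : 'I_(2 ^ l), (x, y) \notin Bad -> forall i, (i <= r)%N ->
      \sum_(t < 2 ^ i) expR (cabs (@grid_sum R l (square t) s a x%:Z y%:Z) / lam) <= 16 * 2 ^+ i.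
Proof.
have [C C0 weak] := psum_weak_type R.
pose A1 := 4 * (C * (2 * (24 * C * C + 40) + 1)) + 1.
have A10 : 0 < A1 by rewrite !(addr_gt0, mulr_gt0).
have C1 : 0 < 8 * (16 * (C + 1)) by rewrite !mulr_gt0 // addr_gt0.
exists (8 * (16 * (C + 1)) * A1); first exact: mulr_gt0.
move=> s r; pose k := (\sum_(p <- s) (`|p.1| + `|p.2|))%N.
exists (k + r + 5)%N => a lam eps lam0 e0.
have sK p : p \in s -> (`|p.1| + `|p.2| < 2 ^ k)%N.
  move=> ps; apply: leq_ltn_trans (ltn_expl k (ltnSn 1)).
  by rewrite /k (big_rem p) //= leq_addr.
have lam'0 : 0 < lam / (8 * (16 * (C + 1))) by rewrite divr_gt0.
have [Bad [sBad good]] := @grid_exp_bound R _ C C0 (@weak _) s a k r sK erefl _ eps lam'0 e0.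
exists Bad; split.
  have := ler_wpM2l (ltW C1) sBad.
  rewrite -/A1; move: (8 * (16 * (C + 1))) C1 lam'0 {sBad good} => K K0 _.
  by rewrite mulrCA (mulrC K (lam / K)) divfK ?gt_eqF // mulrA.
move=> x y /good h i /h; have -> // : 8 * (16 * (C + 1) * (lam / (8 * (16 * (C + 1))))) = lam.
by field; rewrite gt_eqF // addr_gt0.
Qed.

(** * From the grid to the torus *)

Local Open Scope classical_set_scope.
Local Open Scope ring_scope.
Local Open Scope complex_scope.

Section BorelPlane.
Variable R : realType.
Notation mR := (measurableTypeR R).
Notation mu := (@lebesgue_measure R).
Notation mu2 := (borel2 R).

Lemma measurable_id_plane : measurable_fun [set: plane R] (fun z : plane R => z : mR * mR).
Proof.
move=> _ B mB; rewrite setTI.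
exact: caratheodory_measurable_mu_ext.
Qed.

Lemma measurable_plane (A : set (mR * mR)) : measurable A -> measurable (A : set (plane R)).
Proof. exact: caratheodory_measurable_mu_ext. Qed.

Lemma lebesgue2E (A : set (mR * mR)) : measurable A -> lebesgue2 R A = mu2 A.
Proof. by move=> mA; exact: measurable_mu_extE. Qed.

Lemma measurable_fun_plane d (T : measurableType d) (D : set (mR * mR)) (f : mR * mR -> T) :
  measurable D -> measurable_fun D f -> measurable_fun (D : set (plane R)) (f : plane R -> T).
Proof.
move=> mD mf _ B mB; apply: measurable_plane; exact: mf.
Qed.

(** The identity from [plane] to the Borel plane is measurable and pushes Lebesgue measure to the
    Borel product measure. *)
Lemma ge0_integral_plane (D : set (mR * mR)) (f : mR * mR -> \bar R) :
  measurable D -> measurable_fun D f -> (forall z, D z -> 0 <= f z)%E ->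
  (\int[lebesgue2 R]_(z in D) f z = \int[mu2]_(z in D) f z)%E.
Proof.
move=> mD mf f0.
have := ge0_integral_pushforward measurable_id_plane (lebesgue2 R) mD mf.
rewrite preimage_id /= => <-; last by move=> z; rewrite inE => /f0.
apply: eq_measure_integral; first exact: measurable_id_plane.
by move=> mid A mA _; exact: lebesgue2E.
Qed.

Lemma measurable_shift (t : R) : measurable_fun [set: mR] (fun x : mR => x + t : mR).
Proof. by apply: measurable_funD => //; exact: measurable_cst. Qed.

Lemma lebesgue_measure_shift (t : R) (A : set mR) : measurable A ->
  mu ((fun x : R => x + t) @^-1` A) = mu A.
Proof.
move=> mA; rewrite -[LHS]/(pushforward mu (fun x : mR => x + t : mR) A).
apply/esym/lebesgue_measure_unique => //=.
  exact: measurable_shift.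
move=> ms _ [[a b]] _ <-; rewrite /pushforward.
have -> : (fun x : R => x + t) @^-1` [set` `]a, b]%R] = [set` `]a - t, b - t]%R].
  by apply/seteqP; split => x /=; rewrite !in_itv /= ltrBlDr lerBrDr.
rewrite !lebesgue_measure_itv /= !lte_fin ltrD2r.
by case: ifP => // _; rewrite -!EFinD; congr (_%:E); ring.
Qed.

Definition shift2 (t : R * R) (z : mR * mR) : mR * mR := (z.1 + t.1, z.2 + t.2).

Lemma measurable_shift2 (t : R * R) :
  measurable_fun [set: mR * mR] (shift2 t).
Proof.
apply/measurable_fun_pairP; split.
  by apply: (measurableT_comp (measurable_shift t.1)); exact: measurable_fst.
by apply: (measurableT_comp (measurable_shift t.2)); exact: measurable_snd.
Qed.

Lemma borel2_shift (t : R * R) (A : set (mR * mR)) : measurable A ->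
  mu2 ((shift2 t) @^-1` A) = mu2 A.
Proof.
move=> mA.
rewrite -[LHS]/(pushforward mu2 (shift2 t) A).
apply/esym/product_measure_unique => //.
  exact: measurable_shift2.
move=> ms A1 A2 mA1 mA2; rewrite /pushforward.
rewrite -[LHS]/(mu2 (((fun x : R => x + t.1) @^-1` A1) `*` ((fun x : R => x + t.2) @^-1` A2))).
have m1 : measurable ((fun x : R => x + t.1) @^-1` A1 : set mR).
  by rewrite -[X in measurable X]setTI; exact: measurable_shift.
have m2 : measurable ((fun x : R => x + t.2) @^-1` A2 : set mR).
  by rewrite -[X in measurable X]setTI; exact: measurable_shift.
apply: etrans (product_measure1E mu mu m1 m2) _.
by congr (_ * _)%E; exact: lebesgue_measure_shift.
Qed.

Lemma ge0_integral_shift2 (t : R * R) (D : set (mR * mR)) (f : mR * mR -> \bar R) :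
  measurable D -> measurable_fun D f -> (forall z, D z -> 0 <= f z)%E ->
  (\int[mu2]_(z in (shift2 t) @^-1` D)
     f (shift2 t z) = \int[mu2]_(z in D) f z)%E.
Proof.
move=> mD mf f0.
rewrite -(ge0_integral_pushforward (measurable_shift2 t) mu2 mD mf); last first.
  by move=> z; rewrite inE => /f0.
apply: eq_measure_integral; first exact: measurable_shift2.
by move=> ms A mA _; exact: borel2_shift.
Qed.

End BorelPlane.

Section ComplexMeasurable.
Context {d : measure_display} {T : measurableType d} {R : realType}.
Implicit Types (D : set T) (f g : T -> R[i]).

Definition cmeasurable D f :=
  measurable_fun D (fun z => complex.Re (f z)) /\
  measurable_fun D (fun z => complex.Im (f z)).

Lemma cmeasurable_cst D c : cmeasurable D (fun=> c).
Proof. by split; exact: measurable_cst. Qed.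

Lemma cmeasurableD D f g :
  cmeasurable D f -> cmeasurable D g -> cmeasurable D (fun z => f z + g z).
Proof.
move=> [f1 f2] [g1 g2]; split.
  by under eq_fun do rewrite ReD; exact: measurable_funD.
by under eq_fun do rewrite ImD; exact: measurable_funD.
Qed.

Lemma cmeasurableM D f g :
  cmeasurable D f -> cmeasurable D g -> cmeasurable D (fun z => f z * g z).
Proof.
have E (z w : R[i]) : z * w = (complex.Re z * complex.Re w - complex.Im z * complex.Im w)
   +i* (complex.Re z * complex.Im w + complex.Im z * complex.Re w).
  by case: z; case: w.
move=> [f1 f2] [g1 g2]; split.
  under eq_fun do rewrite E /=.
  by apply: measurable_funB; exact: measurable_funM.
under eq_fun do rewrite E /=.
by apply: measurable_funD; exact: measurable_funM.
Qed.

Lemma cmeasurableN D f : cmeasurable D f -> cmeasurable D (fun z => - f z).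
Proof.
move=> h; under eq_fun do rewrite -mulN1r.
exact: cmeasurableM (cmeasurable_cst _ _) h.
Qed.

Lemma cmeasurableB D f g :
  cmeasurable D f -> cmeasurable D g -> cmeasurable D (fun z => f z - g z).
Proof. by move=> hf /cmeasurableN; exact: cmeasurableD. Qed.

Lemma cmeasurable_sum D I (s : seq I) (P : pred I) (F : I -> T -> R[i]) :
  (forall i, cmeasurable D (F i)) -> cmeasurable D (fun z => \sum_(i <- s | P i) F i z).
Proof.
move=> mF; elim: s => [|i s ih].
  by under eq_fun do rewrite big_nil; exact: cmeasurable_cst.
under eq_fun do rewrite big_cons; case: (P i) => //.
exact: cmeasurableD.
Qed.

Lemma cmeasurable_expi D (g : T -> R) : measurable_fun D g ->
  cmeasurable D (fun z => expi (g z)).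
Proof.
move=> mg; split.
  apply: (measurableT_comp _ mg); exact: (continuous_measurable_fun (@continuous_cos R)).
apply: (measurableT_comp _ mg); exact: (continuous_measurable_fun (@continuous_sin R)).
Qed.

Lemma measurable_cabs D f : cmeasurable D f -> measurable_fun D (fun z => cabs (f z)).
Proof.
move=> [f1 f2].
have -> : (fun z => cabs (f z)) =
   (fun z => Num.sqrt (complex.Re (f z) ^+ 2 + complex.Im (f z) ^+ 2)).
  by apply/funext => z; case: (f z).
apply: (measurableT_comp (continuous_measurable_fun (@sqrt_continuous R))).
by apply: measurable_funD; exact: measurable_funX.
Qed.

Lemma measurable_llog D (eps : R) (g : T -> R) : measurable_fun D g ->
  measurable_fun D (fun z => llog eps (g z)).
Proof.
move=> mg; apply: measurable_funM => //; apply: measurable_funD; first exact: measurable_cst.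
apply: (measurableT_comp (@measurable_ln R)); apply: measurable_funD; first exact: measurable_cst.
by apply: measurable_funM => //; exact: measurable_cst.
Qed.

End ComplexMeasurable.

Section GridIntegral.
Variable R : realType.
Notation mR := (measurableTypeR R).
Notation mu2 := (borel2 R).
Notation torus := (@torus2 R : set (mR * mR)).

Lemma measurable_torus2 : measurable torus.
Proof. by apply: measurableX; exact: measurable_itv. Qed.

Variable L : nat.
Hypothesis L_gt0 : (0 < L)%N.
Let h : R := 2 * pi / L%:R.

Definition grid_arc (k : nat) : set mR :=
  [set` `[- pi + h * k%:R, - pi + h * k.+1%:R[].

Definition grid_cell (c : 'I_L * 'I_L) : set (mR * mR) := grid_arc c.1 `*` grid_arc c.2.

Definition grid_point (c : 'I_L * 'I_L) : R * R := (h * c.1%:R, h * c.2%:R).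

Let L_neq0 : L%:R != 0 :> R. Proof. by rewrite pnatr_eq0 -lt0n. Qed.

Let h_gt0 : 0 < h.
Proof. by rewrite divr_gt0 ?ltr0n // mulr_gt0 ?pi_gt0. Qed.

Let hL : h * L%:R = 2 * pi.
Proof. by rewrite /h divfK. Qed.

Lemma grid_arc_cover (x : R) : - pi <= x < pi -> exists k : 'I_L, grid_arc k x.
Proof.
move=> /andP[x1 x2].
have x0 : 0 <= (x + pi) / h by rewrite divr_ge0 ?(ltW h_gt0) // -lerBlDr sub0r.
have /andP[k1 k2] := truncn_itv x0.
move: k1 k2; set k := Num.trunc _ => k1 k2.
rewrite ler_pdivlMr // in k1; rewrite ltr_pdivrMr // in k2.
have kL : (k < L)%N.
  rewrite -(ltr_nat R) -(ltr_pM2l h_gt0) hL; apply: le_lt_trans (_ : x + pi < _).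
    by rewrite mulrC.
  by lra.
exists (Ordinal kL); rewrite /grid_arc /= in_itv /=.
by rewrite mulrC (mulrC h k.+1%:R); apply/andP; split; lra.
Qed.

Lemma grid_arc_sub (k : 'I_L) (x : R) : grid_arc k x -> - pi <= x < pi.
Proof.
rewrite /grid_arc /= in_itv /= => /andP[x1 x2]; apply/andP; split.
  by apply: le_trans x1; rewrite lerDl mulr_ge0 // ltW.
apply: lt_le_trans x2 _.
have : h * k.+1%:R <= h * L%:R by rewrite ler_pM2l // ler_nat.
by rewrite hL; lra.
Qed.

Lemma grid_arc_inj (j k : nat) (x : R) : grid_arc j x -> grid_arc k x -> j = k.
Proof.
rewrite /grid_arc /= !in_itv /= => /andP[a1 a2] /andP[b1 b2].
have : h * j%:R < h * k.+1%:R by lra.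
have : h * k%:R < h * j.+1%:R by lra.
by rewrite !ltr_pM2l // !ltr_nat; lia.
Qed.

Lemma torus2_cells :
  torus = \big[setU/set0]_(c <- index_enum ('I_L * 'I_L)%type) grid_cell c.
Proof.
rewrite -bigcup_seq; apply/seteqP; split.
  move=> [x y] [/=]; rewrite !in_itv /=.
  move=> /grid_arc_cover[j hj] /grid_arc_cover[k hk].
  by exists (j, k) => //=; exact: mem_index_enum.
move=> [x y] [c _ [/= /grid_arc_sub hx /grid_arc_sub hy]].
by split => /=; rewrite in_itv.
Qed.

Lemma grid_cell_shift (c0 : 'I_L) (c : 'I_L * 'I_L) : c0 = 0%N :> nat ->
  grid_cell (c0, c0) = shift2 (grid_point c) @^-1` grid_cell c.
Proof.
move=> E.
have A (k : nat) (x : R) : grid_arc 0 x <-> grid_arc k (x + h * k%:R).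
  rewrite /grid_arc /= !in_itv /= -natr1 mulrDr !mulr0 !mulr1.
  by split => /andP[a b]; apply/andP; split; lra.
apply/seteqP; split => -[x y] [] /=; rewrite ?E => a b.
  by split; apply/A.
by split; rewrite /= E; apply/A; [exact: a|exact: b].
Qed.

Lemma measurable_grid_cell (c : 'I_L * 'I_L) : measurable (grid_cell c).
Proof. by apply: measurableX; exact: measurable_itv. Qed.

(** [torus2] is the disjoint union of the translates of one cell by the grid points, and the measure
    is translation invariant. *)
Lemma torus2_integral_grid (c0 : 'I_L) (F : mR * mR -> \bar R) : c0 = 0%N :> nat ->
  measurable_fun [set: mR * mR] F -> (forall z, 0 <= F z)%E ->
  (\int[mu2]_(z in torus) F z = \int[mu2]_(z in grid_cell (c0, c0))
    \sum_(c <- index_enum ('I_L * 'I_L)%type) F (shift2 (grid_point c) z))%E.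
Proof.
move=> E mF F0.
have mFs (t : R * R) : measurable_fun [set: mR * mR] (fun z => F (shift2 t z)).
  by apply: (measurableT_comp mF); exact: measurable_shift2.
rewrite torus2_cells ge0_integral_bigsetU //=.
- rewrite ge0_integral_sum //.
  + apply: eq_bigr => c _; rewrite (grid_cell_shift c E).
    by rewrite ge0_integral_shift2 //; [exact: measurable_grid_cell|exact: measurable_funTS].
  + exact: measurable_grid_cell.
  + by move=> c; exact: measurable_funTS.
- exact: measurable_grid_cell.
- exact: index_enum_uniq.
- move=> [i j] [k l] _ _ [[x y] [[/= a b] [/= a' b']]].
  by congr pair; apply/val_inj; [exact: grid_arc_inj a a'|exact: grid_arc_inj b b'].
- exact: measurable_funTS.
Qed.

(** The transfer principle from the grid to the torus: an inequality between grid sums at every base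
    point is integrated over one cell. *)
Lemma torus2_integral_le (F G : mR * mR -> \bar R) :
  measurable_fun [set: mR * mR] F -> measurable_fun [set: mR * mR] G ->
  (forall z, 0 <= F z)%E -> (forall z, 0 <= G z)%E ->
  (forall z, \sum_(c : 'I_L * 'I_L) F (shift2 (grid_point c) z) <=
             \sum_(c : 'I_L * 'I_L) G (shift2 (grid_point c) z))%E ->
  (\int[mu2]_(z in torus) F z <= \int[mu2]_(z in torus) G z)%E.
Proof.
move=> mF mG F0 G0 FG.
have E : Ordinal L_gt0 = 0%N :> nat by [].
rewrite !(torus2_integral_grid E) //.
have m (H : mR * mR -> \bar R) : measurable_fun [set: mR * mR] H ->
  measurable_fun (grid_cell (Ordinal L_gt0, Ordinal L_gt0))
   (fun z => \sum_(c <- index_enum ('I_L * 'I_L)%type) H (shift2 (grid_point c) z))%E.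
  move=> mH; apply: emeasurable_sum => c; apply: measurable_funTS.
  by apply: (measurableT_comp mH); exact: measurable_shift2.
apply: ge0_le_integral => //; [exact: measurable_grid_cell| |exact: m|exact: m].
by move=> z _; exact: sume_ge0.
Qed.

End GridIntegral.

(** * Weak-type estimate for trigonometric polynomials *)

Section TrigPoly.
Variable R : realType.
Notation mR := (measurableTypeR R).
Notation mu2 := (borel2 R).
Notation torus := (@torus2 R : set (mR * mR)).
Implicit Types (s : seq (int * int)) (a : int * int -> R[i]) (P : pred (int * int)).

Definition phase (p : int * int) (z : R * R) : R := p.1%:~R * z.1 + p.2%:~R * z.2.

Definition trig P s a (z : R * R) : R[i] := \sum_(p <- s | P p) a p * expi (phase p z).

Lemma measurable_phase p : measurable_fun [set: mR * mR] (phase p).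
Proof.
apply: measurable_funD; apply: measurable_funM; try exact: measurable_cst.
  exact: measurable_fst.
exact: measurable_snd.
Qed.

Lemma cmeasurable_trig P s a : cmeasurable [set: mR * mR] (trig P s a).
Proof.
apply: cmeasurable_sum => p; apply: cmeasurableM; first exact: cmeasurable_cst.
exact: cmeasurable_expi (measurable_phase p).
Qed.

Lemma trig_grid l P s a (c : 'I_(2 ^ l) * 'I_(2 ^ l)) (z : R * R) :
  trig P s a (shift2 (grid_point R c) z) =
  @grid_sum R l P s (fun p => a p * expi (phase p z)) c.1%:Z c.2%:Z.
Proof.
apply: eq_bigr => p _; rewrite -mulrA -expiD; congr (_ * expi _).
rewrite /phase /= rmorphD /= !rmorphM /=.
by set L := (2 ^ l)%N; move: (L%:R^-1) => w; rewrite -!pmulrn; ring.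
Qed.

Definition exp_mean_exceptional s a (lam : R) (r : nat) : set (mR * mR) :=
  \bigcup_(i in `I_r.+1)
    [set z | 16 * 2 ^+ i < \sum_(t < 2 ^ i) expR (cabs (trig (square t) s a z) / lam)].

Lemma measurable_exceptional s a lam r : measurable (exp_mean_exceptional s a lam r).
Proof.
apply: bigcup_measurable => i _.
pose F (z : mR * mR) : R := \sum_(t < 2 ^ i) expR (cabs (trig (square t) s a z) / lam).
have mF : measurable_fun [set: mR * mR] F.
  apply: measurable_sum => t; apply: (measurableT_comp (@measurable_expR R)).
  apply: measurable_funM; last exact: measurable_cst.
  exact: measurable_cabs (cmeasurable_trig _ _ _).
have := mF measurableT _ (measurable_itv `]16 * 2 ^+ i, +oo[).
by rewrite setTI; congr measurable; apply/seteqP; split => z /=; rewrite in_itv /= andbT.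
Qed.

(** With both sides written as integrals over the torus, the transfer principle reduces the claim to
    the grid estimate at each [z], for the coefficients multiplied by the phases at [z]. *)
Lemma exp_mean_weak_type : exists2 A : R, 0 < A &
  forall s a (lam eps : R) (r : nat), 0 < lam -> 0 < eps ->
  (lam%:E * mu2 (exp_mean_exceptional s a lam r `&` torus) <=
   \int[mu2]_(z in torus) (A * (eps + llog eps (cabs (trig predT s a z))))%:E)%E.
Proof.
have [A A0 HA] := grid_exp_estimate R.
exists A => // s a lam eps r lam0 eps0.
have [l Hl] := HA s r.
set E := exp_mean_exceptional s a lam r.
have mE : measurable E := measurable_exceptional s a lam r.
have -> : (lam%:E * mu2 (E `&` torus) = \int[mu2]_(z in torus) (lam * \1_E z)%:E)%E.
  rewrite -integral_indic //; last exact: measurable_torus2.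
  rewrite -ge0_integralZl_EFin //; [exact: measurable_torus2| |exact: ltW].
  by apply/measurable_EFinP; exact: measurable_indic.
have L0 : (0 < 2 ^ l)%N by rewrite expn_gt0.
apply: (torus2_integral_le L0).
- apply/measurable_EFinP; apply: measurable_funM; first exact: measurable_cst.
  exact: measurable_indic.
- apply/measurable_EFinP; apply: measurable_funM; first exact: measurable_cst.
  apply: measurable_funD; first exact: measurable_cst.
  by apply: measurable_llog; exact: measurable_cabs (cmeasurable_trig _ _ _).
- by move=> z; rewrite lee_fin mulr_ge0 // ltW.
- move=> z; rewrite lee_fin mulr_ge0 ?(ltW A0) // addr_ge0 ?(ltW eps0) //.
  by apply: llog_ge0 => //; exact: cabs_ge0.
move=> z; rewrite !sumEFin lee_fin.
have [Bad [B1 B2]] := Hl (fun p => a p * expi (phase p z)) lam eps lam0 eps0.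
rewrite -!mulr_sumr.
apply: le_trans (_ : #|Bad|%:R * lam <= _).
  rewrite mulrC ler_pM2r //.
  rewrite -sum1_card natr_sum [leRHS]big_mkcond /=; apply: ler_sum => c _.
  rewrite indicE; case: ifPn => [_|cB]; first by case: (_ \in E).
  case: (boolP (_ \in E)) => //; rewrite inE => -[i /= ir] b; exfalso; move: b.
  have := B2 c.1 c.2; rewrite -surjective_pairing => /(_ cB i ir).
  rewrite leNgt => /negP B3 B4; apply: B3; move: B4; congr is_true; congr (_ < _).
  by apply: eq_bigr => t _; rewrite trig_grid.
apply: le_trans B1 _; rewrite ler_pM2l //.
rewrite /grid_llog pair_bigA /=; apply: ler_sum => c _.
by rewrite trig_grid.
Qed.

End TrigPoly.

Section TrigIntegral.
Variable R : realType.
Notation mR := (measurableTypeR R).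
Notation mu2 := (borel2 R).
Notation torus := (@torus2 R : set (mR * mR)).
Implicit Types (s : seq (int * int)) (a : int * int -> R[i]) (P : pred (int * int)).

Lemma borel2_torus2 : mu2 torus = (4 * pi ^+ 2)%:E.
Proof.
rewrite /torus2.
have p0 := pi_gt0 R; have lp : - pi < pi :> R by lra.
have m : measurable ([set` `[- pi, pi[] : set mR) by exact: measurable_itv.
have H : @lebesgue_measure R [set` `[- pi, pi[] = (2 * pi)%:E.
  by rewrite lebesgue_measure_itv /= lte_fin lp -EFinB; congr (_%:E); ring.
apply: etrans (product_measure1E (@lebesgue_measure R) (@lebesgue_measure R) m m) _.
apply: (@etrans _ _ ((2 * pi)%:E * (2 * pi)%:E)%E); first by congr (_ * _)%E; exact: H.
by rewrite -EFinM; congr (_%:E); ring.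
Qed.

Lemma measurable_torus2_plane : measurable (@torus2 R).
Proof. by apply: measurable_plane; exact: measurable_torus2. Qed.

Lemma lebesgue2_torus2 : lebesgue2 R (@torus2 R) = (4 * pi ^+ 2)%:E.
Proof. by rewrite lebesgue2E ?borel2_torus2 //; exact: measurable_torus2. Qed.

Lemma lebesgue2_torus2_fin : (lebesgue2 R (@torus2 R) < +oo)%E.
Proof. by rewrite lebesgue2_torus2 ltry. Qed.

Lemma torus2_integrable_bounded (f : plane R -> R) (M : R) :
  measurable_fun (@torus2 R) f -> (forall z, `|f z| <= M) ->
  (lebesgue2 R).-integrable (@torus2 R) (EFin \o f).
Proof.
move=> mf fM; apply: measurable_bounded_integrable => //.
- exact: measurable_torus2_plane.
- exact: lebesgue2_torus2_fin.
- by exists M; split; [exact: num_real|move=> y My z _; apply: le_trans (fM z) (ltW My)].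
Qed.

Let L0 s : nat := (\sum_(p <- s) (`|p.1| + `|p.2|)).+1.

Let sum_grid (L : nat) (L_gt0 : (0 < L)%N) (p : int * int) (z : R * R) :
  (`|p.1| < L)%N -> (`|p.2| < L)%N ->
  \sum_(c : 'I_L * 'I_L) expi (phase p (shift2 (grid_point R c) z)) =
  if p == (0, 0) then (L%:R * L%:R) else 0.
Proof.
move=> p1 p2.
have dvd0 (u : int) : (`|u| < L)%N -> (L%:Z %| u)%Z = (u == 0).
  move=> uL; apply/idP/eqP => [|->]; last exact: dvdz0.
  by rewrite dvdzE /= => /dvdn_leq; lia.
have E (c : 'I_L * 'I_L) : expi (phase p (shift2 (grid_point R c) z)) =
   expi (phase p z) * zeta R L (c.1%:Z * p.1) * zeta R L (c.2%:Z * p.2).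
  rewrite -!expiD; congr expi; rewrite /phase /= !rmorphM /=.
  by move: (L%:R^-1) => w; rewrite -!pmulrn; ring.
under eq_bigr do rewrite E.
rewrite -(pair_bigA _ (fun i j : 'I_L => expi (phase p z) * zeta R L (i%:Z * p.1) * zeta R L (j%:Z * p.2))) /=.
under eq_bigr do rewrite -mulr_sumr (sum_zeta _ L_gt0).
rewrite -mulr_suml -mulr_sumr (sum_zeta _ L_gt0) !dvd0 //.
case: p p1 p2 {E} => j k /= _ _.
rewrite xpair_eqE; case: eqP => [->|_] /=; last by rewrite mulr0 mul0r.
case: eqP => [->|_] /=; last by rewrite mulr0.
by rewrite /phase /= !mul0r addr0 expi0 mul1r.
Qed.

(** The transfer principle used in both directions: [M + Re trig] and the constant [M + k] are
    nonnegative and have equal grid sums once [L] exceeds all frequencies. *)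
Let Rintegral_Re_trig s a :
  \int[lebesgue2 R]_(z in @torus2 R) complex.Re (trig predT s a z) =
  4 * pi ^+ 2 * complex.Re (\sum_(p <- s | p == (0, 0)) a p).
Proof.
set k := complex.Re (\sum_(_ <- _ | _) _).
pose M := \sum_(p <- s) cabs (a p).
have tM z : `|complex.Re (trig predT s a z)| <= M.
  apply: le_trans (normr_Re_le _) _; apply: le_trans (cabs_sum _ _ _) _.
  by apply: ler_sum => p _; rewrite cabsM cabs_expi mulr1.
have kM : `|k| <= M.
  apply: le_trans (normr_Re_le _) _; apply: le_trans (cabs_sum _ _ _) _.
  rewrite big_mkcond; apply: ler_sum => p _; case: ifP => // _; exact: cabs_ge0.
have [mre _] := cmeasurable_trig predT s a.
have mre' : measurable_fun (@torus2 R) (fun z : plane R => complex.Re (trig predT s a z)).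
  apply: (@measurable_fun_plane _ _ _ torus); first exact: measurable_torus2.
  exact: measurable_funTS.
have mF : measurable_fun [set: mR * mR] (fun z => (M + complex.Re (trig predT s a z))%:E).
  by apply/measurable_EFinP; apply: measurable_funD => //; exact: measurable_cst.
have mG : measurable_fun [set: mR * mR] (fun=> (M + k)%:E) by exact: measurable_cst.
have F0 z : (0 <= (M + complex.Re (trig predT s a z))%:E)%E.
  by rewrite lee_fin; have := tM z; rewrite ler_norml => /andP[]; lra.
have G0 : (0 <= (M + k)%:E)%E.
  by rewrite lee_fin; have := kM; rewrite ler_norml => /andP[]; lra.
pose L := L0 s.
have Lg : (0 < L)%N by [].
have sL p : p \in s -> (`|p.1| < L)%N && (`|p.2| < L)%N.
  move=> ps; rewrite /L /L0 !ltnS (big_rem p) //=.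
  by apply/andP; split; rewrite -?addnA ?leq_addr // addnCA leq_addr.
have E z : \sum_(c : 'I_L * 'I_L) (M + complex.Re (trig predT s a (shift2 (grid_point R c) z)))%:E
   = (\sum_(c : 'I_L * 'I_L) (M + k)%:E)%E.
  rewrite !sumEFin; congr (_%:E); rewrite !big_split /=; congr (_ + _).
  rewrite -Re_sum /trig exchange_big /=.
  rewrite sumr_const card_prod !card_ord /k.
  have -> : \sum_(j <- s) \sum_(c : 'I_L * 'I_L) a j * expi (phase j (shift2 (grid_point R c) z))
     = (L * L)%:R%:C * \sum_(p <- s | p == (0, 0)) a p.
    rewrite [in RHS]big_mkcond mulr_sumr big_seq [RHS]big_seq; apply: eq_bigr => p /sL /andP[l1 l2].
    rewrite -mulr_sumr sum_grid //; case: ifP => _; last by rewrite !mulr0.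
    by rewrite natrM rmorphM /= !rmorph_nat mulrC.
  by rewrite Re_realM mulr_natl.
have I : (\int[mu2]_(z in torus) (M + complex.Re (trig predT s a z))%:E =
   \int[mu2]_(z in torus) (M + k)%:E)%E.
  by apply/eqP; rewrite eq_le; apply/andP; split; apply: (torus2_integral_le Lg) => // z; rewrite E.
have J : \int[lebesgue2 R]_(z in @torus2 R) (M + complex.Re (trig predT s a z)) =
   (M + k) * (4 * pi ^+ 2).
  rewrite /Rintegral (ge0_integral_plane (@measurable_torus2 R)) //; last exact: measurable_funTS.
  by rewrite I integral_cst ?borel2_torus2 //; exact: measurable_torus2.
have := J; rewrite RintegralD //=; last 3 first.
- exact: measurable_torus2_plane.
- apply: (@torus2_integrable_bounded (fun=> M) `|M|) => //; exact: measurable_cst.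
- exact: torus2_integrable_bounded tM.
rewrite Rintegral_cst; last exact: measurable_torus2_plane.
by rewrite lebesgue2_torus2 /=; lra.
Qed.

Lemma cintegral_trig s a :
  cintegral (@torus2 R) (trig predT s a) = (4 * pi ^+ 2)%:C * \sum_(p <- s | p == (0, 0)) a p.
Proof.
rewrite /cintegral Rintegral_Re_trig.
(* The imaginary part is the real part of the polynomial multiplied by [- 'i]. *)
have E z : complex.Im (trig predT s a z) = complex.Re (trig predT s (fun p => - 'i * a p) z).
  rewrite /trig; under [in RHS]eq_bigr do rewrite -mulrA; rewrite -mulr_sumr.
  by case: (\sum_(_ <- _ | _) _) => u v /=; ring.
under eq_Rintegral do rewrite E.
rewrite Rintegral_Re_trig -mulr_sumr.
case: (\sum_(_ <- _ | _) _) => u v.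
by apply/eqP; rewrite eq_complex /=; apply/andP; split; apply/eqP; ring.
Qed.

(** Multiplication by a character translates the frequencies, which reduces every coefficient to a
    mean value. *)
Lemma fourier_trig s a (j k : int) :
  fourier (trig predT s a) j k = \sum_(p <- s | p == (j, k)) a p.
Proof.
pose sub p : int * int := (p.1 - j, p.2 - k); pose add p : int * int := (p.1 + j, p.2 + k).
have E z : trig predT s a z * expi (- (j%:~R * z.1 + k%:~R * z.2)) =
  trig predT (map sub s) (a \o add) z.
  rewrite /trig mulr_suml big_map; apply: eq_bigr => p _.
  rewrite -mulrA -expiD /=; congr (a _ * expi _).
    by rewrite /add /sub /= !subrK -surjective_pairing.
  by rewrite /phase /= !rmorphB /=; ring.
rewrite /fourier.
have -> : (fun z : R * R => trig predT s a z * expi (- (j%:~R * z.1 + k%:~R * z.2))) =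
  trig predT (map sub s) (a \o add) by apply/funext.
rewrite cintegral_trig mulrA -rmorphM /= mulVf ?mul1r; last first.
  by rewrite mulf_neq0 ?pnatr_eq0 // expf_neq0 // gt_eqF // pi_gt0.
rewrite big_map; apply: eq_big => p.
  by rewrite /sub; case: p => u v /=; rewrite !xpair_eqE !subr_eq0.
by move=> _ /=; rewrite /add /sub /= !subrK -surjective_pairing.
Qed.

Lemma Snn_trig s a (n : nat) (z : R * R) :
  Snn n z.1 z.2 (trig predT s a) = trig (square n) s a z.
Proof.
rewrite /Snn /=.
under eq_bigr => x _ do under eq_bigr => y _ do rewrite fourier_trig big_mkcond mulr_suml.
under eq_bigr => x _ do rewrite exchange_big.
rewrite exchange_big /trig [RHS]big_mkcond /=; apply: eq_bigr => p _.
pose x0 := absz (p.1 + n%:Z); pose y0 := absz (p.2 + n%:Z).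
case: ifPn => [/andP[h1 h2]|h].
  have hx : (p.1 + n%:Z)%R = x0 by rewrite /x0 gez0_abs //; lia.
  have hy : (p.2 + n%:Z)%R = y0 by rewrite /y0 gez0_abs //; lia.
  rewrite (bigD1_seq x0) ?mem_index_iota ?iota_uniq //=; last by lia.
  rewrite (bigD1_seq y0) ?mem_index_iota ?iota_uniq //=; last by lia.
  rewrite -hx -hy !addrK -surjective_pairing eqxx.
  rewrite big1 ?addr0 => [|y yy]; last first.
    rewrite [p in p == _]surjective_pairing xpair_eqE eqxx /=.
    case: eqP => [e|_]; last by rewrite mul0r.
    by exfalso; move: yy; rewrite /y0 e subrK /= eqxx.
  rewrite big1 ?addr0 // => x xx; apply: big1 => y _.
  rewrite [p in p == _]surjective_pairing xpair_eqE.
  case: eqP => [e|_] /=; last by rewrite mul0r.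
  by exfalso; move: xx; rewrite /x0 e subrK /= eqxx.
rewrite big_nat; apply: big1 => x xn; rewrite big_nat; apply: big1 => y yn.
rewrite [p in p == _]surjective_pairing xpair_eqE.
case: eqP => [e1|_] /=; last by rewrite mul0r.
case: eqP => [e2|_] /=; last by rewrite mul0r.
by exfalso; move: h; rewrite /square e1 e2; lia.
Qed.

End TrigIntegral.

(** * Density of trigonometric polynomials *)

Section TrigAlgebra.
Variable R : realType.
Implicit Types (f g : R * R -> R[i]).

Definition is_trig f := exists s a, f = trig predT s a.

(** Sums and products produce lists with repeated frequencies and different coefficients; collecting
    equal frequencies gives a coefficient function. *)
Lemma is_trigP (t : seq ((int * int) * R[i])) f :
  (forall z, f z = \sum_(e <- t) e.2 * expi (phase e.1 z)) -> is_trig f.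
Proof.
move=> ft; exists (undup [seq e.1 | e <- t]), (fun p => \sum_(e <- t | e.1 == p) e.2).
apply/funext => z; rewrite ft /trig.
under [RHS]eq_bigr do rewrite mulr_suml big_mkcond.
rewrite exchange_big /= big_seq [RHS]big_seq; apply: eq_bigr => e et.
rewrite -big_mkcond /= (big_rem e.1) /=; last by rewrite mem_undup map_f.
rewrite eqxx big_seq_cond big_pred0 ?addr0 // => p.
rewrite mem_rem_uniq ?undup_uniq // inE eq_sym.
by case: (e.1 == p); rewrite ?andbF.
Qed.

Lemma is_trig_list f : is_trig f ->
  exists t : seq ((int * int) * R[i]), forall z, f z = \sum_(e <- t) e.2 * expi (phase e.1 z).
Proof.
by move=> [s [a ->]]; exists [seq (p, a p) | p <- s] => z; rewrite big_map.
Qed.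

Lemma is_trig_expi p c : is_trig (fun z => c * expi (phase p z)).
Proof. by apply: (@is_trigP [:: (p, c)]) => z; rewrite big_seq1. Qed.

Lemma is_trig_cst c : is_trig (fun=> c).
Proof.
apply: (@is_trigP [:: ((0, 0), c)]) => z.
by rewrite big_seq1 /phase /= !mul0r addr0 expi0 mulr1.
Qed.

Lemma is_trigD f g : is_trig f -> is_trig g -> is_trig (fun z => f z + g z).
Proof.
move=> /is_trig_list[t ft] /is_trig_list[u gu]; apply: (@is_trigP (t ++ u)) => z.
by rewrite big_cat ft gu.
Qed.

Lemma is_trigM f g : is_trig f -> is_trig g -> is_trig (fun z => f z * g z).
Proof.
move=> /is_trig_list[t ft] /is_trig_list[u gu].
apply: (@is_trigP [seq ((e.1.1 + e'.1.1, e.1.2 + e'.1.2), e.2 * e'.2) | e <- t, e' <- u]) => z.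
rewrite big_allpairs_dep ft gu mulr_suml; apply: eq_bigr => e _.
rewrite mulr_sumr; apply: eq_bigr => e' _ /=.
rewrite mulrACA -expiD; congr (_ * expi _).
by rewrite /phase /= !rmorphD /=; ring.
Qed.

Lemma is_trigX f n : is_trig f -> is_trig (fun z => f z ^+ n).
Proof.
move=> hf; elim: n => [|n ih].
  by under eq_fun do rewrite expr0; exact: is_trig_cst.
by under eq_fun do rewrite exprS; exact: is_trigM.
Qed.

Lemma is_trigB f g : is_trig f -> is_trig g -> is_trig (fun z => f z - g z).
Proof.
move=> hf hg; under eq_fun do rewrite -mulN1r.
apply: is_trigD => //; exact: is_trigM (is_trig_cst _) hg.
Qed.

Lemma is_trig_cos p (x0 : R) : is_trig (fun z => (cos (phase p z - x0))%:C).
Proof.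
have E z : (cos (phase p z - x0))%:C =
  2^-1 * expi (- x0) * expi (phase p z) + 2^-1 * expi x0 * expi (phase (- p.1, - p.2) z).
  have -> : phase (- p.1, - p.2) z = - phase p z by rewrite /phase /= !rmorphN /=; ring.
  rewrite -!mulrA -!expiD -mulrDr [- x0 + _]addrC.
  have -> : x0 - phase p z = - (phase p z - x0) by rewrite opprB.
  rewrite expiN; move: (phase p z - x0) => y.
  have -> : expi y + conjc (expi y) = 2 * (cos y)%:C.
    by apply/eqP; rewrite eq_complex /=; apply/andP; split; apply/eqP; ring.
  by rewrite mulrA mulVf ?mul1r // pnatr_eq0.
under eq_fun do rewrite E.
by apply: is_trigD; exact: is_trig_expi.
Qed.

End TrigAlgebra.

Section LLogReal.
Variable R : realType.
Implicit Types (eps : R).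

Lemma llog_double eps (u : R) : 0 < eps -> llog eps (2 * u) = 2 * llog (eps / 2) u.
Proof.
move=> e0; rewrite /llog -mulrA; congr (_ * (_ * (_ + ln (_ + _)))).
by field; rewrite gt_eqF.
Qed.

Lemma llog_scale eps (c u : R) : 0 < eps -> 0 < c -> llog eps (c * u) = c * llog (eps / c) u.
Proof.
move=> e0 c0; rewrite /llog -mulrA; congr (_ * (_ * (_ + ln (_ + _)))).
by field; rewrite !gt_eqF.
Qed.

Lemma llog_homo eps (u v : R) : 0 < eps -> 0 <= u -> u <= v -> llog eps u <= llog eps v.
Proof.
move=> e0 u0 uv; have v0 : 0 <= v by exact: le_trans uv.
rewrite /llog; apply: ler_pM => //; first by rewrite addr_ge0 // ln_div_ge0.
rewrite lerD2l ler_ln ?posrE; last 2 first.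
- by rewrite ltr_wpDr // divr_ge0 // ltW.
- by rewrite ltr_wpDr // divr_ge0 // ltW.
by rewrite lerD2l ler_pM2r // invr_gt0.
Qed.

(** [u + v] is at most twice the larger of the two, and [llog_double] moves the factor 2 into
    [eps]. *)
Lemma llog_add_le eps (u v : R) : 0 < eps -> 0 <= u -> 0 <= v ->
  llog eps (u + v) <= 2 * llog (eps / 2) u + 2 * llog (eps / 2) v.
Proof.
move=> e0 u0 v0; rewrite -!llog_double //.
have uge w : 0 <= w -> 0 <= llog eps (2 * w) by move=> w0; apply: llog_ge0; rewrite // mulr_ge0.
have [uv|/ltW vu] := leP u v.
  by apply: le_trans (llog_homo e0 (addr_ge0 u0 v0) (_ : _ <= 2 * v)) _; [lra|rewrite lerDr uge].
by apply: le_trans (llog_homo e0 (addr_ge0 u0 v0) (_ : _ <= 2 * u)) _; [lra|rewrite lerDl uge].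
Qed.

Lemma llog0 eps : llog eps 0 = 0.
Proof. by rewrite /llog mul0r. Qed.

Lemma cvg_llog eps (u : nat -> R) : 0 < eps -> (forall n, 0 <= u n) ->
  u n @[n --> \oo] --> (0 : R) -> llog eps (u n) @[n --> \oo] --> (0 : R).
Proof.
move=> e0 u0 cu.
apply: (@squeeze_cvgr _ _ _ _ (cst 0) (fun n => u n * (1 + u n / eps))).
- near=> n; rewrite llog_ge0 //= /llog ler_wpM2l // lerD2l.
  apply: le_ln1Dx; apply: lt_le_trans (_ : 0 <= _); first by lra.
  by rewrite divr_ge0 // ltW.
- exact: cvg_cst.
rewrite -[X in _ --> X](mul0r (1 + 0 / eps)).
apply: cvgM => //; apply: cvgD; first exact: cvg_cst.
by apply: cvgM => //; exact: cvg_cst.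
Unshelve. all: by end_near.
Qed.

End LLogReal.

Section LLogIntegral.
Context {d : measure_display} {T : measurableType d} {R : realType}.
Variables (mu : {measure set T -> \bar R}) (D : set T).
Hypothesis mD : measurable D.
Implicit Types (f g h : T -> R[i]) (eps : R).

Definition llog_int eps f : \bar R := (\int[mu]_(z in D) (llog eps (cabs (f z)))%:E)%E.

Lemma measurable_llog_cabs eps f : cmeasurable D f ->
  measurable_fun D (fun z => (llog eps (cabs (f z)))%:E).
Proof. by move=> mf; apply/measurable_EFinP/measurable_llog/measurable_cabs. Qed.

Lemma llog_int_le_add eps h f g : 0 < eps ->
  cmeasurable D h -> cmeasurable D f -> cmeasurable D g ->
  (forall z, D z -> cabs (h z) <= cabs (f z) + cabs (g z)) ->
  (llog_int eps h <= 2%:E * llog_int (eps / 2) f + 2%:E * llog_int (eps / 2) g)%E.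
Proof.
move=> e0 mh mf mg hfg.
have e20 : 0 < eps / 2 by rewrite divr_gt0.
have p k z : (0 <= (llog (eps / 2) (cabs (k z : R[i])))%:E)%E.
  by rewrite lee_fin llog_ge0 ?cabs_ge0.
have m k : cmeasurable D k -> measurable_fun D (fun z => 2%:E * (llog (eps / 2) (cabs (k z)))%:E)%E.
  by move=> mk; apply: measurable_funeM; exact: measurable_llog_cabs.
rewrite /llog_int -!ge0_integralZl_EFin //; try exact: measurable_llog_cabs.
rewrite -ge0_integralD //; try (by move=> z _; apply: mule_ge0; [rewrite lee_fin|exact: p]); try exact: m.
apply: ge0_le_integral => //.
- by move=> z _; rewrite lee_fin llog_ge0 ?cabs_ge0.
- exact: measurable_llog_cabs.
- by apply: emeasurable_funD; exact: m.
- move=> z Tz; rewrite -!EFinM -EFinD lee_fin.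
  apply: le_trans (llog_homo e0 (cabs_ge0 _) (hfg z Tz)) _.
  by apply: llog_add_le; rewrite ?cabs_ge0.
Qed.

Lemma llog_int0 eps : llog_int eps (fun=> 0) = 0%E.
Proof.
rewrite /llog_int; under eq_integral do rewrite cabs0 llog0.
exact: integral0.
Qed.

Lemma llog_int_scale eps c f : 0 < eps -> c != 0 -> cmeasurable D f ->
  llog_int eps (fun z => c * f z) = ((cabs c)%:E * llog_int (eps / cabs c) f)%E.
Proof.
move=> e0 c0 mf; have k0 := cabs_gt0 c0.
rewrite /llog_int -ge0_integralZl_EFin //; last 3 first.
- by move=> z _; rewrite lee_fin llog_ge0 ?cabs_ge0 // divr_gt0.
- exact: measurable_llog_cabs.
- exact: ltW.
by apply: eq_integral => z _; rewrite cabsM llog_scale // EFinM.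
Qed.

Lemma cvg_llog_int f (g : nat -> T -> R[i]) (h : T -> R) eps : 0 < eps ->
  cmeasurable D f -> (forall n, cmeasurable D (g n)) ->
  (forall z, D z -> cabs (f z - g n z) @[n --> \oo] --> (0 : R)) ->
  (forall n z, D z -> cabs (f z - g n z) <= h z) ->
  mu.-integrable D (fun z => (llog eps (h z))%:E) ->
  llog_int eps (fun z => f z - g n z) @[n --> \oo] --> 0%E.
Proof.
move=> e0 mf mg fg fh ih.
rewrite -[X in _ --> X](integral0 mu D).
apply: (@dominated_cvg _ _ _ _ _ mD _ _ (fun z => (llog eps (h z))%:E)) => //.
- by move=> n; apply: measurable_llog_cabs; exact: cmeasurableB.
- move=> z Dz; apply: cvg_EFin; first by near=> n.
  by apply: cvg_llog => // [n|]; [exact: cabs_ge0|exact: fg].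
- move=> n z Dz; rewrite gee0_abs ?lee_fin; first by apply: llog_homo; rewrite ?cabs_ge0 ?fh.
  by rewrite llog_ge0 ?cabs_ge0.
Unshelve. all: by end_near.
Qed.

End LLogIntegral.

(** * Closure of a class of functions under the L log L functional *)

Section LLogClosure.
Context {d : measure_display} {T : measurableType d} {R : realType}.
Variables (mu : {measure set T -> \bar R}) (D : set T) (Q : set (T -> R[i])).
Hypothesis mD : measurable D.
Hypothesis mQ : forall q, Q q -> cmeasurable D q.
Hypothesis Q0 : Q (fun=> 0).
Hypothesis Qadd : forall p q, Q p -> Q q -> Q (fun z => p z + q z).
Hypothesis Qscale : forall c q, Q q -> Q (fun z => c * q z).
Implicit Types (f g : T -> R[i]) (eps : R).

(** Quantifying over every [eps] makes the closure stable under linear operations although the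
    functional is not a norm: addition halves [eps], and multiplication by [c] divides it by
    [|c|]. *)
Definition llog_closure f := cmeasurable D f /\
  forall eps delta : R, 0 < eps -> 0 < delta ->
  exists2 q : T -> R[i], Q q & (llog_int mu D eps (fun z => (f z - q z)%R) <= delta%:E)%E.

Lemma llog_closure_sub q : Q q -> llog_closure q.
Proof.
move=> hq; split=> [|eps delta e0 d0]; first exact: mQ.
exists q => //; have -> : (fun z : T => (q z - q z)%R) = (fun=> 0) by apply/funext => z; rewrite subrr.
by rewrite llog_int0 lee_fin ltW.
Qed.

Lemma llog_closure_closed f : cmeasurable D f ->
  (forall eps delta : R, 0 < eps -> 0 < delta ->
   exists2 g, llog_closure g & (llog_int mu D eps (fun z => (f z - g z)%R) <= delta%:E)%E) ->
  llog_closure f.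
Proof.
move=> mf H; split=> // eps delta e0 d0.
have e20 : 0 < eps / 2 by rewrite divr_gt0.
have d40 : 0 < delta / 4 by rewrite divr_gt0.
have [g [mg hg] fg] := H _ _ e20 d40.
have [q tq gq] := hg _ _ e20 d40; exists q => //.
have mq := mQ tq.
apply: le_trans (@llog_int_le_add _ _ _ _ _ mD eps _ (fun z => f z - g z) (fun z => g z - q z) e0 _ _ _ _) _;
  try exact: cmeasurableB.
  by move=> z _; apply: le_trans (cabs_le_add _ _); rewrite addrA subrK.
apply: (@le_trans _ _ (2%:E * (delta / 4)%:E + 2%:E * (delta / 4)%:E)%E).
  by apply: leeD; apply: lee_wpmul2l; rewrite ?lee_fin.
by rewrite -!EFinM -EFinD lee_fin; lra.
Qed.

Lemma llog_closureD f g : llog_closure f -> llog_closure g -> llog_closure (fun z => f z + g z).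
Proof.
move=> [mf hf] [mg hg]; split; first exact: cmeasurableD.
move=> eps delta e0 d0.
have e20 : 0 < eps / 2 by rewrite divr_gt0.
have d40 : 0 < delta / 4 by rewrite divr_gt0.
have [p tp fp] := hf _ _ e20 d40; have [q tq gq] := hg _ _ e20 d40.
exists (fun z => p z + q z); first exact: Qadd.
have mp := mQ tp; have mq := mQ tq.
apply: le_trans (@llog_int_le_add _ _ _ _ _ mD eps _ (fun z => f z - p z) (fun z => g z - q z) e0 _ _ _ _) _;
  try exact: cmeasurableB.
  by apply: cmeasurableB; exact: cmeasurableD.
  by move=> z _; apply: le_trans (cabs_le_add _ _); rewrite addrACA opprD.
apply: (@le_trans _ _ (2%:E * (delta / 4)%:E + 2%:E * (delta / 4)%:E)%E).
  by apply: leeD; apply: lee_wpmul2l; rewrite ?lee_fin.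
by rewrite -!EFinM -EFinD lee_fin; lra.
Qed.

Lemma llog_closureZ c f : llog_closure f -> llog_closure (fun z => c * f z).
Proof.
move=> [mf hf]; have [->|c0] := eqVneq c 0.
  have -> : (fun z => 0 * f z) = (fun=> 0) by apply/funext => z; rewrite mul0r.
  exact: llog_closure_sub Q0.
have k0 := cabs_gt0 c0; split; first exact: cmeasurableM (cmeasurable_cst _ _) mf.
move=> eps delta e0 d0.
have [q tq fq] := hf (eps / cabs c) (delta / cabs c) (divr_gt0 e0 k0) (divr_gt0 d0 k0).
exists (fun z => c * q z); first exact: Qscale.
have mq := mQ tq.
apply: (@le_trans _ _ ((cabs c)%:E * llog_int mu D (eps / cabs c) (fun z => (f z - q z)%R))%E); last first.
  apply: (@le_trans _ _ ((cabs c)%:E * (delta / cabs c)%:E)%E).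
    by apply: lee_wpmul2l; rewrite ?lee_fin // ltW.
  by rewrite -EFinM lee_fin mulrC divfK // gt_eqF.
have -> : (fun z => c * f z - c * q z) = (fun z => c * (f z - q z)).
  by apply/funext => z; rewrite mulrBr.
by rewrite llog_int_scale //; exact: cmeasurableB.
Qed.

Lemma llog_closure_dominated f (g : nat -> T -> R[i]) (h : T -> R) :
  cmeasurable D f -> (forall n, llog_closure (g n)) ->
  (forall z, D z -> cabs (f z - g n z) @[n --> \oo] --> (0 : R)) ->
  (forall n z, D z -> cabs (f z - g n z) <= h z) ->
  (forall eps, 0 < eps ->
     mu.-integrable D (fun z => (llog eps (h z))%:E)) ->
  llog_closure f.
Proof.
move=> mf hg fg fh ih; apply: llog_closure_closed => // eps delta e0 d0.
have C := cvg_llog_int mD e0 mf (fun n => proj1 (hg n)) fg fh (ih eps e0).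
have /C[n _ /(_ n (leqnn n)) /= H] : nbhs (0 : \bar R)%E [set x | (x < delta%:E)%E].
  by apply: (@open_ereal_lt_ereal R delta%:E); rewrite /= lte_fin.
by exists (g n) => //; exact: ltW.
Qed.

Lemma llog_closure_sum I (r : seq I) (F : I -> T -> R[i]) :
  (forall i, llog_closure (F i)) -> llog_closure (fun z => \sum_(i <- r) F i z).
Proof.
move=> hF; elim: r => [|i r ih].
  by under eq_fun do rewrite big_nil; exact: llog_closure_sub.
by under eq_fun do rewrite big_cons; exact: llog_closureD.
Qed.

Definition cindic (A : set T) (z : T) : R[i] := (\1_A z)%:C.

Lemma cmeasurable_cindic A : measurable A -> cmeasurable D (cindic A).
Proof. by move=> mA; split; [exact: measurable_indic|exact: measurable_cst]. Qed.

Section Sets.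
Hypothesis muD : (mu D < +oo)%E.
Hypothesis Q1 : Q (fun=> 1).

Lemma llog_closure_setT : llog_closure (cindic setT).
Proof.
have -> : cindic setT = (fun=> 1) by apply/funext => z; rewrite /cindic indicT.
exact: llog_closure_sub.
Qed.

Lemma llog_closure_setC A : llog_closure (cindic A) -> llog_closure (cindic (~` A)).
Proof.
move=> hA.
have -> : cindic (~` A) = (fun z => 1 + -1 * cindic A z).
  apply/funext => z; rewrite /cindic !indicE in_setC mulN1r.
  by case: (z \in A); rewrite /= ?subrr ?subr0.
by apply: llog_closureD; [exact: llog_closure_sub|exact: llog_closureZ].
Qed.

Lemma llog_closure_bounded f (g : nat -> T -> R[i]) :
  cmeasurable D f -> (forall n, llog_closure (g n)) ->
  (forall z, D z -> cabs (f z - g n z) @[n --> \oo] --> (0 : R)) ->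
  (forall n z, D z -> cabs (f z - g n z) <= 1) -> llog_closure f.
Proof.
move=> mf hg fg fg1.
apply: (llog_closure_dominated mf hg fg fg1) => eps e0.
have -> : (fun=> (llog eps 1)%:E) = EFin \o cst (llog eps 1) :> (T -> \bar R) by [].
apply: measurable_bounded_integrable => //; try exact: measurable_cst.
by exists `|llog eps 1|; split=> [|y /ltW + z _]; [exact: num_real|].
Qed.

(** By disjointness the indicators of finite unions are sums. They converge pointwise with error at
    most 1, so bounded convergence applies. *)
Lemma llog_closure_bigcup (F : nat -> set T) : (forall n, measurable (F n)) ->
  trivIset setT F -> (forall n, llog_closure (cindic (F n))) ->
  llog_closure (cindic (\bigcup_k F k)).
Proof.
move=> mF tF hF; pose g n := cindic (\big[setU/set0]_(i < n) F i).
have notin n z : F n z -> z \in \big[setU/set0]_(i < n) F i = false.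
  move=> Fz; apply/negbTE/negP => /set_mem; rewrite -bigcup_mkord.
  move=> [k /= kn Fk]; have := tF k n I I (ex_intro _ z (conj Fk Fz)).
  by move=> e; rewrite e ltnn in kn.
apply: (@llog_closure_bounded _ g).
- by apply: cmeasurable_cindic; exact: bigcup_measurable.
- elim=> [|n ih]; rewrite /g.
    rewrite big_ord0; have -> : cindic set0 = (fun=> 0) by apply/funext => z; rewrite /cindic indic0.
    exact: llog_closure_sub.
  rewrite big_ord_recr /=.
  have -> : cindic (\big[setU/set0]_(i < n) F i `|` F n) = (fun z => g n z + cindic (F n) z).
    apply/funext => z; rewrite /g /cindic !indicE in_setU.
    case: (boolP (z \in F n)) => [|_]; last by rewrite orbF addr0.
    by rewrite inE => /notin ->; rewrite add0r.
  exact: llog_closureD.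
- move=> z _; rewrite /g /cindic !indicE.
  case: (boolP (z \in \bigcup_k F k)) => [|/negP h].
    rewrite inE => -[k _ Fk]; apply: cvg_near_cst; exists k.+1 => // n kn.
    rewrite indicE; have -> : z \in \big[setU/set0]_(i < n) F i = true.
      by apply/mem_set; rewrite -bigcup_mkord; exists k.
    by rewrite subrr cabs0.
  apply: cvg_near_cst; exists 0%N => // n _.
  rewrite indicE; have -> : z \in \big[setU/set0]_(i < n) F i = false.
    apply/negbTE/negP => /set_mem; rewrite -bigcup_mkord => -[k _ Fk].
    by apply: h; apply/mem_set; exists k.
  by rewrite subrr cabs0.
- move=> n z _; rewrite /g /cindic !indicE -rmorphB cabs_real.
  by do 2 case: (_ \in _) => /=; rewrite ?subrr ?subr0 ?sub0r ?normrN ?normr0 ?normr1.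
Qed.

End Sets.

Import HBNNSimple.

Section Functions.
Hypothesis indic_closure : forall A, measurable A -> llog_closure (cindic A).

(** Simple functions are finite sums of indicators; those approximating [u] from below leave an
    error dominated by [u]. *)
Let nonneg_closure (u : T -> R) : measurable_fun D u -> (forall z, D z -> 0 <= u z) ->
  (forall eps, 0 < eps -> mu.-integrable D (fun z => (llog eps (u z))%:E)) ->
  llog_closure (fun z => (u z)%:C).
Proof.
move=> mu' u0 iu.
have mEu : measurable_fun D (EFin \o u) by exact/measurable_EFinP.
pose g n := nnsfun_approx mD mEu n.
have gu n z : D z -> 0 <= u z - g n z.
  move=> Dz; rewrite subr_ge0 /g nnsfun_approxE -lee_fin.
  exact: (@le_approx _ _ _ D (EFin \o u)).
apply: (@llog_closure_dominated _ (fun n z => (g n z)%:C) u).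
- by split; [exact: mu'|exact: measurable_cst].
- move=> n.
  have -> : (fun z => (g n z)%:C) = (fun z => \sum_(y <- finmap.enum_fset (fset_set (range (g n))))
      y%:C * cindic (g n @^-1` [set y]) z).
    apply/funext => z; rewrite fimfunE fsbig_finite //= rmorph_sum /=.
    by apply: eq_bigr => y _; rewrite rmorphM.
  apply: llog_closure_sum => y; apply: llog_closureZ; apply: indic_closure.
  exact: measurable_funPTI.
- move=> z Dz; under eq_fun do rewrite -rmorphB cabs_real ger0_norm ?gu //.
  have /fine_cvgP[_] := cvg_nnsfun_approx mD mEu (fun x Dx => u0 x Dx) Dz.
  move=> /(cvgB (cvg_cst (u z))); rewrite subrr; exact.
- move=> n z Dz; rewrite -rmorphB cabs_real ger0_norm ?gu // gerBl //.
- exact: iu.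
Qed.

(** [f] is split into positive and negative parts of its real and imaginary parts, each dominated by
    [|f|]. *)
Lemma llog_closure_integrable f : cmeasurable D f ->
  (forall eps, 0 < eps -> mu.-integrable D (fun z => (llog eps (cabs (f z)))%:E)) ->
  llog_closure f.
Proof.
move=> mf hf.
have half (u : T -> R) : measurable_fun D u -> (forall z, `|u z| <= cabs (f z)) ->
    llog_closure (fun z => (2^-1 * (`|u z| + u z))%:C).
  move=> mfu uf; apply: nonneg_closure.
  - apply: measurable_funM; first exact: measurable_cst.
    by apply: measurable_funD => //; exact: measurableT_comp.
  - by move=> z _; rewrite mulr_ge0 //; have := ler_norm (- u z); rewrite normrN; lra.
  - move=> eps e0; apply: le_integrable (hf eps e0) => //.
      apply/measurable_EFinP/measurable_llog; apply: measurable_funM; first exact: measurable_cst.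
      by apply: measurable_funD => //; exact: measurableT_comp.
    move=> z Dz; have n0 : 0 <= 2^-1 * (`|u z| + u z).
      by rewrite mulr_ge0 //; have := ler_norm (- u z); rewrite normrN; lra.
    rewrite !gee0_abs ?lee_fin ?llog_ge0 ?cabs_ge0 // llog_homo //.
    by apply: le_trans (uf z); have := ler_norm (u z); lra.
have real (u : T -> R) : measurable_fun D u -> (forall z, `|u z| <= cabs (f z)) ->
    llog_closure (fun z => (u z)%:C).
  move=> mfu uf.
  have -> : (fun z => (u z)%:C) =
     (fun z => (2^-1 * (`|u z| + u z))%:C + -1 * (2^-1 * (`|- u z| + - u z))%:C).
    by apply/funext => z; rewrite normrN mulN1r -rmorphB; congr (_%:C); field.
  apply: llog_closureD; first exact: half.
  apply: llog_closureZ; apply: half; first exact: measurableT_comp.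
  by move=> z; rewrite normrN.
have -> : f = (fun z => (complex.Re (f z))%:C + 'i * (complex.Im (f z))%:C).
  by apply/funext => z; exact: complexE.
case: (mf) => m1 m2; apply: llog_closureD.
  by apply: real => // z; exact: normr_Re_le.
by apply: llog_closureZ; apply: real => // z; exact: normr_Im_le.
Qed.

End Functions.

End LLogClosure.

(** * Trigonometric approximation of indicators of rays *)

Section Sharpening.
Variable R : realType.
Implicit Types (v s t : R).

Lemma bernoulli_le t (N : nat) : 0 <= t -> 1 + N%:R * t <= (1 + t) ^+ N.
Proof.
move=> t0; elim: N => [|N ih]; first by rewrite mul0r addr0 expr0.
rewrite exprS -natr1; apply: le_trans (_ : (1 + t) * (1 + N%:R * t) <= _).
  have := mulr_ge0 (mulr_ge0 (ler0n R N) t0) t0; lra.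
by rewrite ler_pM2l //; lra.
Qed.

Lemma one_sub_expn_le t (N : nat) : 0 <= t <= 1 -> (1 - t) ^+ N * (1 + N%:R * t) <= 1.
Proof.
move=> /andP[t0 t1].
apply: le_trans (ler_wpM2l (exprn_ge0 _ _) (bernoulli_le N t0)) _; first by lra.
by rewrite -exprMn; apply: exprn_ile1; [nra|nra].
Qed.

Lemma one_sub_expn_ge t (N : nat) : 0 <= t <= 1 -> 1 - N%:R * t <= (1 - t) ^+ N.
Proof.
move=> /andP[t0 t1]; elim: N => [|N ih]; first by rewrite mul0r subr0 expr0.
rewrite exprS -natr1; apply: le_trans (_ : (1 - t) * (1 - N%:R * t) <= _).
  have := mulr_ge0 (mulr_ge0 (ler0n R N) t0) t0; lra.
by apply: ler_wpM2l => //; lra.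
Qed.

Lemma mulrn_expr_le s (n : nat) : 0 <= s <= 1 -> n%:R * s ^+ n * (1 - s) + s ^+ n <= 1.
Proof.
move=> /andP[s0 s1]; elim: n => [|n ih]; first by rewrite !mul0r add0r expr0.
rewrite exprS -natr1.
have sn : s ^+ n <= 1 by apply: exprn_ile1.
have -> : (n%:R + 1) * (s * s ^+ n) * (1 - s) + s * s ^+ n =
  s * (n%:R * s ^+ n * (1 - s) + s ^+ n) + s * (1 - s) * s ^+ n by ring.
have := ler_wpM2l s0 ih; have := ler_wpM2l (mulr_ge0 s0 (_ : 0 <= 1 - s)) sn.
by nra.
Qed.

(** With [s ^ 2 = r], the factor [n s ^ n] is bounded by [1 / (1 - s)] and the remaining [s ^ n]
    tends to 0. *)
Lemma cvg_mulrn_expr r : 0 <= r < 1 -> n%:R * r ^+ n @[n --> \oo] --> (0 : R).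
Proof.
move=> /andP[r0 r1]; pose s := Num.sqrt r.
have s0 : 0 <= s by exact: sqrtr_ge0.
have ss : s * s = r by rewrite -expr2 sqr_sqrtr.
have s1 : s < 1 by rewrite -(@ltr_pXn2r _ 2) ?nnegrE // expr1n expr2 ss.
apply: (@squeeze_cvgr _ _ _ _ (cst 0) (fun n => (1 - s)^-1 * s ^+ n)).
- near=> n; rewrite mulr_ge0 ?exprn_ge0 //= -ss exprMn mulrA ler_wpM2r ?exprn_ge0 //.
  rewrite -[leRHS]mul1r ler_pdivlMr ?subr_gt0 //.
  have := @mulrn_expr_le s n; rewrite s0 (ltW s1) => /(_ isT).
  by have := exprn_ge0 n s0; lra.
- exact: cvg_cst.
rewrite -[X in _ --> X](mulr0 (1 - s)^-1); apply: cvgM; first exact: cvg_cst.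
by apply: cvg_expr; rewrite ger0_norm.
Unshelve. all: by end_near.
Qed.

(** A polynomial familiar from proofs of Stone-Weierstrass. Bernoulli's inequality compares it from
    both sides with [n (2 v) ^ n], which tends to 0 for [v < 1/2] and is at least [n] otherwise, the
    case [v = 1/2] included. *)
Lemma cvg_sharpening v : 0 <= v <= 1 ->
  (1 - v ^+ n) ^+ (n * 2 ^ n) @[n --> \oo] --> (((v < 2^-1)%R)%:R : R).
Proof.
move=> /andP[v0 v1].
have vn n : 0 <= v ^+ n <= 1 by rewrite exprn_ge0 // exprn_ile1.
have E n : (n * 2 ^ n)%:R * v ^+ n = n%:R * (2 * v) ^+ n.
  by rewrite natrM natrX exprMn mulrA.
case: ltP => hv.
  apply: (@squeeze_cvgr _ _ _ _ (fun n => 1 - n%:R * (2 * v) ^+ n) (cst 1)).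
  - near=> n; rewrite -E one_sub_expn_ge //=.
    by apply: exprn_ile1; have /andP[] := vn n; lra.
  - rewrite -[X in _ --> X]subr0; apply: cvgB; first exact: cvg_cst.
    by apply: cvg_mulrn_expr; apply/andP; split; lra.
  - exact: cvg_cst.
apply: (@squeeze_cvgr _ _ _ _ (cst 0) (@harmonic R)); last 2 first.
- exact: cvg_cst.
- exact: cvg_harmonic.
near=> n; rewrite exprn_ge0 /=; last by have /andP[] := vn n; lra.
have := one_sub_expn_le (n * 2 ^ n) (vn n).
rewrite E => h.
rewrite /harmonic -[leRHS]mul1r ler_pdivlMr ?ltr0n //; apply: le_trans h.
apply: ler_wpM2l; first by apply: exprn_ge0; have /andP[] := vn n; lra.
rewrite -natr1 addrC lerD2l -[leLHS]mulr1 ler_wpM2l //.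
by apply: exprn_ege1; lra.
Unshelve. all: by end_near.
Qed.

(* It equals [1 / 2] exactly at the end points of the arc from [- pi] to [b], so
   that [cvg_sharpening] turns it into the indicator of [x > b]. *)
Definition bump_arc (b x : R) : R :=
  2^-1 + (cos (x - (b - pi) / 2) - cos ((b + pi) / 2)) / 4.

Lemma bump_arc_itv b x : 0 <= bump_arc b x <= 1.
Proof.
rewrite /bump_arc.
have := cos_geN1 (x - (b - pi) / 2); have := cos_le1 (x - (b - pi) / 2).
by have := cos_geN1 ((b + pi) / 2); have := cos_le1 ((b + pi) / 2); lra.
Qed.

Lemma bump_arc_lt b x : - pi <= b < pi -> - pi <= x < pi -> (bump_arc b x < 2^-1) = (b < x).
Proof.
move=> /andP[b1 b2] /andP[x1 x2].
pose p := (x + pi) / 2; pose q := (x - b) / 2.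
(* This is [cos (p + q) - cos (p - q) = - 2 sin p sin q]. As [p] lies in [[0, pi)], the sign of
   [sin q], hence of [x - b], decides. *)
have -> : bump_arc b x = 2^-1 - sin p * sin q / 2.
  rewrite /bump_arc.
  have -> : x - (b - pi) / 2 = p + q by rewrite /p /q; field.
  have -> : (b + pi) / 2 = p - q by rewrite /p /q; field.
  by rewrite cosD cosB; field.
have -> : (2^-1 - sin p * sin q / 2 < 2^-1) = (0 < sin p * sin q).
  by apply/idP/idP; lra.
have sp : 0 <= sin p by apply: sin_ge0_pi; rewrite /p; apply/andP; split; lra.
have [bx|xb] := ltP b x.
  by rewrite mulr_gt0 // sin_gt0_pi // /p /q; apply/andP; split; lra.
apply/negbTE; rewrite -leNgt mulr_ge0_le0 // -[q]opprK sinN oppr_le0.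
by apply: sin_ge0_pi; rewrite /q; apply/andP; split; lra.
Qed.

(** The approximants are polynomials in one cosine, hence trigonometric in either variable through
    [phase]. For [b] outside [[- pi, pi)] constants do. *)
Lemma ray_approximation (b : R) : exists q : nat -> R -> R, [/\
  forall n p, is_trig (fun z => (q n (phase p z))%:C),
  forall n x, 0 <= q n x <= 1 &
  forall x, - pi <= x < pi -> q n x @[n --> \oo] --> (((b < x)%R)%:R : R)].
Proof.
have [b1|b1] := ltP b (- pi).
  exists (fun _ _ => 1); split=> [n p|n x|x /andP[x1 _]]; first exact: is_trig_cst.
    by rewrite ler01 lexx.
  by rewrite (lt_le_trans b1 x1); exact: cvg_cst.
have [b2|b2] := ltP b pi; last first.
  exists (fun _ _ => 0); split=> [n p|n x|x /andP[_ x2]]; first exact: is_trig_cst.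
    by rewrite ler01 lexx.
  by rewrite ltNge (ltW (lt_le_trans x2 b2)); exact: cvg_cst.
exists (fun n x => (1 - bump_arc b x ^+ n) ^+ (n * 2 ^ n)); split.
- move=> n p; under eq_fun do rewrite rmorphXn rmorphB rmorph1 rmorphXn rmorphD rmorphM rmorphB.
  apply: is_trigX; apply: is_trigB; first exact: is_trig_cst.
  apply: is_trigX; apply: is_trigD; first exact: is_trig_cst.
  apply: is_trigM; last exact: is_trig_cst.
  by apply: is_trigB; [exact: is_trig_cos|exact: is_trig_cst].
- move=> n x; have /andP[v0 v1] := bump_arc_itv b x.
  have vn0 : 0 <= bump_arc b x ^+ n by exact: exprn_ge0.
  have vn1 : bump_arc b x ^+ n <= 1 by exact: exprn_ile1.
  by rewrite exprn_ge0 ?exprn_ile1 //; lra.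
- move=> x hx; rewrite -bump_arc_lt ?b1 //.
  by apply: cvg_sharpening; exact: bump_arc_itv.
Qed.

End Sharpening.

Section Density.
Variable R : realType.
Notation mR := (measurableTypeR R).
Notation mu2 := (borel2 R).
Notation T2 := (@torus2 R).
Notation mT2 := (@measurable_torus2_plane R).
Notation trig_closure := (@llog_closure _ (plane R) R (lebesgue2 R) T2 (@is_trig R)).

Lemma cmeasurable_is_trig (q : plane R -> R[i]) : is_trig q -> cmeasurable T2 q.
Proof.
move=> [s [a ->]]; have [m1 m2] := cmeasurable_trig predT s a.
by split; apply: (@measurable_fun_plane _ _ _ T2); try exact: measurable_torus2;
   exact: measurable_funTS.
Qed.

Let Q0 : @is_trig R (fun=> 0). Proof. exact: is_trig_cst. Qed.
Let Q1 : @is_trig R (fun=> 1). Proof. exact: is_trig_cst. Qed.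
Let Qadd (p q : plane R -> R[i]) : is_trig p -> is_trig q -> is_trig (fun z => p z + q z).
Proof. exact: is_trigD. Qed.
Let Qscale c (q : plane R -> R[i]) : is_trig q -> is_trig (fun z => c * q z).
Proof. by move=> hq; exact: is_trigM (is_trig_cst c) hq. Qed.

(** A generating class of the Borel sets that is stable under intersection and consists of products
    of rays, so that one-variable approximants can be multiplied. *)
Definition quadrants : set (set (mR * mR)) :=
  [set S | exists b b' : R, S = `]b, +oo[ `*` `]b', +oo[].

Lemma trig_closure_quadrant (S : set (mR * mR)) : quadrants S ->
  trig_closure (cindic (S : set (plane R))).
Proof.
move=> [b [b' ->]].
have [q [q1 q2 q3]] := ray_approximation b; have [r [r1 r2 r3]] := ray_approximation b'.
have E (z : plane R) : cindic (`]b, +oo[ `*` `]b', +oo[ : set (plane R)) z =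
    (((b < z.1)%R)%:R * ((b' < z.2)%R)%:R)%:C.
  rewrite /cindic indicE; congr (_%:C).
  have -> : z \in (`]b, +oo[ `*` `]b', +oo[ : set (plane R)) = (b < z.1) && (b' < z.2).
    apply/idP/andP => [/set_mem[]|[h1 h2]]; rewrite /= ?in_itv /= ?andbT //.
    by apply/mem_set; split; rewrite /= in_itv /= ?h1 ?h2.
  by do 2 case: (_ < _); rewrite ?mulr1 ?mulr0.
have inT (z : plane R) : T2 z -> (- pi <= z.1 < pi) /\ (- pi <= z.2 < pi).
  by move=> [/=]; rewrite !in_itv.
have bool01 (c : bool) : 0 <= (c%:R : R) <= 1 by case: c; rewrite ?lexx ?ler01.
apply: (llog_closure_bounded mT2 cmeasurable_is_trig (lebesgue2_torus2_fin R)
  (g := fun n z => (q n z.1 * r n z.2)%:C)).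
- apply: cmeasurable_cindic; apply: measurable_plane.
  by apply: measurableX; exact: measurable_itv.
- move=> n; apply: (llog_closure_sub (lebesgue2 R) cmeasurable_is_trig).
  under eq_fun do rewrite rmorphM; apply: is_trigM.
    have := q1 n (1, 0); congr is_trig; apply/funext => z.
    by rewrite /phase /= mul0r addr0 mul1r.
  have := r1 n (0, 1); congr is_trig; apply/funext => z.
  by rewrite /phase /= mul0r add0r mul1r.
- move=> z /inT[z1 z2]; pose A : R := ((b < z.1)%R)%:R * ((b' < z.2)%R)%:R.
  have : A - q n z.1 * r n z.2 @[n --> \oo] --> (A - A : R).
    by apply: cvgB; [exact: cvg_cst|apply: cvgM; [exact: q3|exact: r3]].
  rewrite subrr => /cvg_norm; rewrite normr0 => H.
  by under eq_fun do rewrite E -rmorphB cabs_real; exact: H.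
- move=> n z _; rewrite E -rmorphB cabs_real ler_norml.
  have := bool01 (b < z.1); have := bool01 (b' < z.2); have := q2 n z.1; have := r2 n z.2.
  move: (_%:R) (_%:R) (q n z.1) (r n z.2) => c1 c2 c3 c4 /andP[? ?] /andP[? ?] /andP[? ?] /andP[? ?].
  by apply/andP; split; nra.
Qed.

Lemma quadrants_generate : @measurable _ (mR * mR)%type = <<s quadrants >>.
Proof.
rewrite eqEsubset; split; last first.
  apply: smallest_sub; first exact: sigma_algebra_measurable.
  by move=> _ [b [b' ->]]; apply: measurableX; exact: measurable_itv.
have G1 : measurable_fun [set: g_sigma_algebraType quadrants] (fst : g_sigma_algebraType quadrants -> mR).
  apply: (measurability (@RGenOInfty.G R)); first exact: RGenOInfty.measurableE.
  move=> _ [_ [x ->] <-]; rewrite setTI.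
  have -> : fst @^-1` `]x, +oo[ = \bigcup_n (`]x, +oo[ `*` `](- n%:R), +oo[ : set (mR * mR)).
    apply/seteqP; split=> [[u v] /= xu|[u v] [n _ [/= xu _]] //].
    exists (Num.truncn `|v|).+1 => //; split=> //=; rewrite in_itv /= andbT ltrNl.
    apply: le_lt_trans (truncnS_gt _); by rewrite -normrN ler_norm.
  by apply: bigcup_measurable => n _; apply: sub_sigma_algebra; exists x, (- n%:R).
have G2 : measurable_fun [set: g_sigma_algebraType quadrants] (snd : g_sigma_algebraType quadrants -> mR).
  apply: (measurability (@RGenOInfty.G R)); first exact: RGenOInfty.measurableE.
  move=> _ [_ [x ->] <-]; rewrite setTI.
  have -> : snd @^-1` `]x, +oo[ = \bigcup_n (`](- n%:R), +oo[ `*` `]x, +oo[ : set (mR * mR)).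
    apply/seteqP; split=> [[u v] /= xu|[u v] [n _ [/= _ xu]] //].
    exists (Num.truncn `|u|).+1 => //; split=> //=; rewrite in_itv /= andbT ltrNl.
    apply: le_lt_trans (truncnS_gt _); by rewrite -normrN ler_norm.
  by apply: bigcup_measurable => n _; apply: sub_sigma_algebra; exists (- n%:R), x.
rewrite measurable_prod_measurableType; apply: smallest_sub; first exact: smallest_sigma_algebra.
move=> _ [A mA [B mB] <-].
have -> : A `*` B = (fst @^-1` A) `&` (snd @^-1` B) by [].
apply: (@measurableI _ (g_sigma_algebraType quadrants)).
  by rewrite -[X in measurable X]setTI; exact: G1.
by rewrite -[X in measurable X]setTI; exact: G2.
Qed.

Lemma trig_closure_borel (S : set (mR * mR)) : measurable S ->
  trig_closure (cindic (S : set (plane R))).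
Proof.
rewrite quadrants_generate; move: S.
apply: (@dynkin_induction _ (mR * mR)%type quadrants
   (fun S : set (mR * mR) => trig_closure (cindic (S : set (plane R))))).
- exact: quadrants_generate.
- move=> _ _ [a [a' ->]] [b [b' ->]]; exists (Num.max a b), (Num.max a' b').
  apply/seteqP; split => -[x y]; rewrite /= !in_itv /= !andbT !gt_max.
    by move=> [[-> ->] [-> ->]].
  by move=> [/andP[-> ->] /andP[-> ->]].
- exact: llog_closure_setT cmeasurable_is_trig Q1.
- exact: trig_closure_quadrant.
- by move=> S mS hS; exact: (@llog_closure_setC _ (plane R) R (lebesgue2 R) T2 (@is_trig R) mT2 cmeasurable_is_trig Q0 Qadd Qscale Q1 S hS).
- move=> F mF tF hF; apply: (llog_closure_bigcup mT2 cmeasurable_is_trig Q0 Qadd (lebesgue2_torus2_fin R)) => //.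
  by move=> n; exact: measurable_plane.
Qed.

(** The measure of a Lebesgue set is its outer measure, an infimum over countable Borel covers;
    finiteness on the torus allows the subtraction. *)
Lemma borel_cover (A : set (plane R)) (delta : R) : 0 < delta -> measurable A ->
  A `<=` T2 -> exists B : set (mR * mR),
  [/\ measurable B, A `<=` B & (lebesgue2 R (B `\` A) <= delta%:E)%E].
Proof.
move=> d0 mA AT.
have Afin : lebesgue2 R A \is a fin_num.
  rewrite ge0_fin_numE //; apply: le_lt_trans (lebesgue2_torus2_fin R).
  by apply: le_measure; rewrite ?inE //; exact: mT2.
have [_ [F [mF AF] <-] HF] := @lb_ereal_inf_adherent R
   [set (\sum_(k <oo) mu2 (F k))%E | F in measurable_cover (A : set (mR * mR))] delta d0 Afin.
exists (\bigcup_k F k); split=> //; first exact: bigcup_measurable.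
have mU : measurable (\bigcup_k F k : set (plane R)).
  by apply: bigcup_measurable => k _; apply: measurable_plane.
have UF : (lebesgue2 R (\bigcup_k F k) <= \sum_(k <oo) mu2 (F k))%E.
  have -> : (\sum_(k <oo) mu2 (F k) = \sum_(k <oo) lebesgue2 R (F k))%E.
    by apply: eq_eseriesr => k _; rewrite lebesgue2E.
  apply: measure_sigma_subadditive => // k; exact: measurable_plane.
have lt : (lebesgue2 R (\bigcup_k F k) < lebesgue2 R A + delta%:E)%E by exact: le_lt_trans UF HF.
rewrite measureD //; last by apply: lt_trans lt _; rewrite ltey_eq fin_numD Afin.
have -> : \bigcup_k F k `&` A = A by apply/setIidPr.
by rewrite leeBlDr // addeC; exact: ltW.
Qed.

Lemma trig_closure_measurable (A : set (plane R)) : measurable A -> trig_closure (cindic A).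
Proof.
move=> mA.
have mAT : measurable (A `&` T2) by apply: measurableI => //; exact: mT2.
apply: (llog_closure_closed mT2 cmeasurable_is_trig); first exact: cmeasurable_cindic.
move=> eps delta e0 d0.
have l0 : 0 < llog eps 1 + 1 by rewrite ltr_wpDl // llog_ge0.
(* On the torus the integrand will be [llog eps 1] times the indicator of the difference of the two
   sets, hence the choice [delta / (llog eps 1 + 1)]. *)
have [B [mB AB BA]] := borel_cover (divr_gt0 d0 l0) mAT (@subIsetr _ _ _).
exists (cindic (B : set (plane R))); first exact: trig_closure_borel.
have mBp := measurable_plane mB.
have mD : measurable (B `\` (A `&` T2) : set (plane R)) by exact: measurableD.
apply: (@le_trans _ _ (\int[lebesgue2 R]_(z in T2) ((llog eps 1) * \1_(B `\` (A `&` T2)) z)%:E)%E).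
  rewrite le_eqVlt; apply/orP; left; apply/eqP; apply: eq_integral => z /set_mem Tz.
  congr (_%:E); rewrite /cindic !indicE -rmorphB cabs_real in_setD in_setI (mem_set Tz) andbT.
  case: (boolP (z \in A)) => [/set_mem zA|_].
    by rewrite (mem_set (AB z (conj zA Tz))) subrr normr0 llog0 mulr0.
  by case: (z \in B); rewrite ?subrr ?sub0r ?normrN ?normr0 ?normr1 ?llog0 ?mulr0 ?mulr1.
under eq_integral do rewrite EFinM.
rewrite ge0_integralZl_EFin ?llog_ge0 //; last 2 first.
- exact: mT2.
- by apply/measurable_EFinP; exact: measurable_indic.
rewrite integral_indic //; last exact: mT2.
apply: (@le_trans _ _ ((llog eps 1)%:E * (delta / (llog eps 1 + 1))%:E)%E).
  apply: lee_wpmul2l; first by rewrite lee_fin llog_ge0.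
  apply: le_trans BA; apply: le_measure; rewrite ?inE //.
  by apply: measurableI => //; exact: mT2.
rewrite -EFinM lee_fin mulrCA ger_pMr // ler_pdivrMr // mul1r; lra.
Qed.

Lemma trig_dense (f : plane R -> R[i]) : cmeasurable T2 f ->
  (forall eps, 0 < eps ->
    (lebesgue2 R).-integrable T2 (fun z => (llog eps (cabs (f z)))%:E)) ->
  forall eps delta : R, 0 < eps -> 0 < delta ->
  exists s a, (llog_int (lebesgue2 R) T2 eps (fun z => (f z - trig predT s a z)%R) <= delta%:E)%E.
Proof.
move=> mf hf eps delta e0 d0.
have [_ /(_ eps delta e0 d0) [q [s [a ->]] H]] := llog_closure_integrable mT2
  cmeasurable_is_trig Q0 Qadd Qscale trig_closure_measurable mf hf.
by exists s, a.
Qed.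

End Density.

(** * Almost everywhere convergence *)

(** Convexity of the exponential between 0 and [a], from the tangent at [theta * a] evaluated at
    both ends. *)
Lemma expR_theta_le (R : realType) (theta a : R) : 0 <= theta <= 1 ->
  expR (theta * a) <= 1 + theta * (expR a - 1).
Proof.
move=> /andP[t0 t1]; set E := expR (theta * a).
have E0 : 0 < E by exact: expR_gt0.
have h1 : E * (1 + (1 - theta) * a) <= expR a.
  have -> : expR a = E * expR ((1 - theta) * a) by rewrite -expRD; congr expR; ring.
  by rewrite ler_pM2l // expR_ge1Dx.
have h2 : E * (1 - theta * a) <= 1.
  rewrite [leRHS](_ : 1 = E * expR (- (theta * a))); last by rewrite -expRD subrr expR0.
  by rewrite ler_pM2l // expR_ge1Dx.
have := ler_wpM2l t0 h1; have := ler_wpM2l (_ : 0 <= 1 - theta) h2.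
by rewrite subr_ge0 => /(_ t1); nra.
Qed.

Section ExponentialMajorant.
Variables (R : realType) (psi : R -> R).
Hypothesis psi_ge0 : forall u, 0 <= u -> 0 <= psi u.
Hypothesis psi_incr : forall u v, 0 <= u -> u <= v -> psi u <= psi v.
Hypothesis psi_lim0 : psi u @[u --> 0^'+] --> psi 0.
Hypothesis psi0 : psi 0 = 0.
Hypothesis psi_limsup :
  (limf_esup (fun u : R => lne (psi u)%:E * (u^-1)%:E) (pinfty_nbhs R) < +oo)%E.

Lemma psi_le_expR : exists2 K : R, 0 < K &
  exists u0 : R, 0 < u0 /\ forall u, u0 <= u -> psi u <= expR (K * u).
Proof.
have /ereal_inf_lt[_ [V [M [Mr HM]] <-]] := psi_limsup.
set S := ereal_sup _ => Sfin.
have [K [K0 SK]] : exists K : R, 0 < K /\ (S <= K%:E)%E.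
  case: S Sfin => [x _|//|_]; last by exists 1; split => //; exact: leNye.
  by exists (`|x| + 1); rewrite lee_fin; have := ler_norm x; have := normr_ge0 x; split; lra.
exists K => //; exists (`|M| + 1); split; first by have := normr_ge0 M; lra.
move=> u Mu; have u0 : 0 < u by have := normr_ge0 M; lra.
have Vu : V u by apply: HM; have := ler_norm M; lra.
have := psi_ge0 (ltW u0); rewrite le_eqVlt => /orP[/eqP <-|p0]; first exact: expR_ge0.
have : (lne (psi u)%:E * (u^-1)%:E <= K%:E)%E.
  by apply: le_trans SK; apply: ereal_sup_ubound; exists u.
rewrite lne_EFin // -EFinM lee_fin -[_ / _]/(ln (psi u) / u) ler_pdivrMr // => h.
by rewrite -(lnK p0) ler_expR.
Qed.

(** [K] does not depend on [eta]; only [B] does, and it is beaten later by a small scale. Below [d]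
    the limit at 0 gives [eta]. Above, monotonicity gives [psi u <= psi (u0 + u) <= expR (K (u0 +
    u))], and [expR (K u) - 1] stays away from 0. *)
Lemma psi_exp_majorant : exists2 K : R, 0 < K & forall eta : R, 0 < eta ->
  exists2 B : R, 0 < B & forall u, 0 <= u -> psi u <= eta + B * (expR (K * u) - 1).
Proof.
have [K K0 [u0 [u00 Ku]]] := psi_le_expR.
exists K => // eta eta0.
have [d d0 Hd] : exists2 d : R, 0 < d & forall u, 0 <= u -> u < d -> psi u <= eta.
  have : nbhs (psi 0) [set y | y < eta] by rewrite psi0; exact: (open_nbhs_nbhs (conj (@open_lt R eta) eta0)).
  move=> /psi_lim0 /= [d /= d0 H]; exists d => // u u1 u2.
  move: u1; rewrite le_eqVlt => /orP[/eqP <-|u1]; first by rewrite psi0 ltW.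
  by apply/ltW/H => //=; rewrite sub0r normrN gtr0_norm.
have Kd : 1 < expR (K * d) by rewrite expR_gt1 mulr_gt0.
pose B := expR (K * u0) * expR (K * d) / (expR (K * d) - 1).
have B0 : 0 < B by rewrite divr_gt0 ?subr_gt0 // mulr_gt0 ?expR_gt0.
exists B => // u ug; have e1 : 1 <= expR (K * u) by rewrite -expR0 ler_expR mulr_ge0 // ltW.
have [ud|du] := ltP u d.
  by apply: le_trans (Hd u ug ud) _; rewrite lerDl mulr_ge0 ?subr_ge0 // ltW.
apply: (@le_trans _ _ (expR (K * u0) * expR (K * u))).
  rewrite -expRD -mulrDr; apply: le_trans (_ : psi (u0 + u) <= _); last by apply: Ku; lra.
  by apply: psi_incr; lra.
apply: le_trans (_ : B * (expR (K * u) - 1) <= _); last by rewrite lerDr ltW.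
have du' : expR (K * d) <= expR (K * u) by rewrite ler_expR ler_pM2l.
have -> : B * (expR (K * u) - 1) =
  expR (K * u0) * (expR (K * d) * (expR (K * u) - 1) / (expR (K * d) - 1)).
  by rewrite /B; ring.
rewrite ler_pM2l ?expR_gt0 // ler_pdivlMr ?subr_gt0 //; lra.
Qed.

(* With [y ^ theta <= 1 + theta (y - 1)], where [theta = K * lam], the exponential
   moment at scale [lam] controls the one at scale [1 / K]. *)
Lemma psi_mean_le (K eta B lam C : R) (x y : nat -> R) (t0 m : nat) :
  0 < K -> 0 < B -> 0 < lam -> K * lam <= 1 ->
  (forall u, 0 <= u -> psi u <= eta + B * (expR (K * u) - 1)) ->
  (forall n, 0 <= x n) ->
  (forall n, 0 <= y n) -> (forall n, (t0 <= n)%N -> x n <= y n + lam) ->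
  (forall i, \sum_(t < 2 ^ i) expR (y t / lam) <= C * 2 ^+ i) ->
  0 <= eta ->
  m.+1%:R^-1 * \sum_(0 <= n < m.+1) psi (x n) <=
  m.+1%:R^-1 * \sum_(0 <= n < t0) psi (x n) + eta +
  B * (expR (K * lam) * (1 + K * lam * (2 * C)) - 1).
Proof.
move=> K0 B0 lam0 Klam psiB x0 y0 xy Hexp eta0.
have Kl0 : 0 < K * lam by rewrite mulr_gt0.
pose E n := eta + B * (expR (K * lam) * (1 + K * lam * expR (y n / lam)) - 1).
have e1 : 1 <= expR (K * lam) by rewrite -expR0 ler_expR ltW.
have E0 n : 0 <= E n.
  rewrite addr_ge0 // mulr_ge0 ?(ltW B0) // subr_ge0.
  apply: le_trans e1 _; rewrite ler_peMr ?expR_ge0 // lerDl mulr_ge0 ?expR_ge0 //; exact: ltW.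
have xE : forall n, (t0 <= n)%N -> psi (x n) <= E n.
  move=> n tn; apply: le_trans (psi_incr (x0 n) (xy n tn)) _.
  apply: le_trans (psiB _ _) _; first by rewrite addr_ge0 // ltW.
  rewrite lerD2l ler_pM2l // lerD2r mulrDr addrC expRD ler_pM2l ?expR_gt0 //.
  have -> : K * y n = K * lam * (y n / lam) by field; rewrite gt_eqF.
  apply: le_trans (expR_theta_le _ _) _; first by rewrite (ltW Kl0).
  by rewrite lerD2l ler_pM2l // gerBl.
have S1 : \sum_(0 <= n < m.+1) psi (x n) <= \sum_(0 <= n < t0) psi (x n) + \sum_(0 <= n < m.+1) E n.
  have px0 n : 0 <= psi (x n) by exact: psi_ge0.
  have [mt|tm] := leqP m.+1 t0.
    rewrite (@big_cat_nat _ _ _ m.+1 0 t0) //= -addrA lerDl addr_ge0 //; exact: sumr_ge0.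
  have tm' : (t0 <= m.+1)%N by exact: ltnW.
  rewrite (@big_cat_nat _ _ _ t0 0 m.+1) //= lerD2l.
  rewrite [leRHS](@big_cat_nat _ _ _ t0 0 m.+1) //= ler_wpDl ?sumr_ge0 //.
  by rewrite big_nat [leRHS]big_nat; apply: ler_sum => n /andP[tn _]; exact: xE.
have m0 : 0 < m.+1%:R :> R by rewrite ltr0n.
apply: le_trans (ler_wpM2l _ S1) _; first by rewrite invr_ge0 ltW.
rewrite mulrDr -addrA lerD2l.
(* The range is extended to a full dyadic block of length at most [2 (m + 1)], which doubles the
   constant. *)
have S2 : \sum_(0 <= n < m.+1) expR (y n / lam) <= m.+1%:R * (2 * C).
  pose i := (trunc_log 2 m.+1).+1.
  have mi : (m.+1 <= 2 ^ i)%N by rewrite ltnW // trunc_log_ltn.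
  have im : (2 ^ i <= 2 * m.+1)%N by rewrite expnS leq_pmul2l // trunc_logP.
  rewrite big_mkord; apply: le_trans (_ : \sum_(t < 2 ^ i) expR (y t / lam) <= _).
    rewrite -(big_mkord predT (fun t => expR (y t / lam))) -(big_mkord predT (fun t => expR (y t / lam))).
    by rewrite [leRHS](@big_cat_nat _ _ _ m.+1 0 (2 ^ i)) //= lerDl sumr_ge0 // => n _; exact: expR_ge0.
  apply: le_trans (Hexp i) _.
  have C0 : 0 <= C.
    have := Hexp 0%N; rewrite expr0 mulr1; apply: le_trans; apply: sumr_ge0 => t _; exact: expR_ge0.
  rewrite mulrCA mulrA mulrC ler_wpM2r //.
  by rewrite -natrX -natrM ler_nat.
rewrite mulrC ler_pdivrMr // /E big_split /= sumr_const_nat subn0 -mulr_sumr.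
rewrite big_split /= -mulr_sumr big_split /= -mulr_sumr !sumr_const_nat !subn0.
have S3 := ler_wpM2l (ltW Kl0) S2.
have S4 := ler_wpM2l (expR_ge0 (K * lam)) S3.
have S5 := ler_wpM2l (ltW B0) S4.
rewrite -(mulr_natr eta) -(mulr_natr (- 1)).
move: S5; set S := \sum_(0 <= i < m.+1) _; move: S (expR _) (m.+1%:R) => S e N; lra.
Qed.

End ExponentialMajorant.

Section LLogGeneric.
Context {d : measure_display} {T : measurableType d} {R : realType}.
Variables (mu : {measure set T -> \bar R}) (D : set T).
Hypothesis mD : measurable D.
Hypothesis muD : (mu D < +oo)%E.
Implicit Types (f g e : T -> R[i]) (eps : R).

Lemma ge0_integral_affine_llog (A c eps : R) f : 0 <= A -> 0 <= c -> 0 < eps ->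
  cmeasurable D f ->
  (\int[mu]_(z in D) (A * (c + llog eps (cabs (f z))))%:E =
   A%:E * (c%:E * mu D + llog_int mu D eps f))%E.
Proof.
move=> A0 c0 e0 mf.
have mc : measurable_fun D (fun z => (c + llog eps (cabs (f z)))%:E).
  apply/measurable_EFinP; apply: measurable_funD; first exact: measurable_cst.
  exact/measurable_llog/measurable_cabs.
have l0 z : 0 <= llog eps (cabs (f z)) by rewrite llog_ge0 ?cabs_ge0.
under eq_integral do rewrite EFinM.
rewrite ge0_integralZl_EFin //; last by move=> z _; rewrite lee_fin addr_ge0.
congr (_ * _)%E; under eq_integral do rewrite EFinD.
rewrite ge0_integralD //.
- by rewrite integral_cst.
- by move=> z _; rewrite lee_fin l0.
- exact: measurable_llog_cabs.
Qed.

(** For [u > 1] the logarithm is at most [ln (1 + 1 / eps) + ln u], and [u <= expR 1 + u ln u]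
    absorbs the linear term. *)
Lemma llog_le_logplus eps : 0 < eps -> exists2 C : R, 0 <= C &
  forall u, 0 <= u -> llog eps u <= C * (1 + u * logplus u).
Proof.
move=> e0; pose K := 1 + ln (1 + eps^-1).
have K0 : 1 <= K by rewrite lerDl ln_ge0 // lerDl invr_ge0 ltW.
have ee : 0 < expR 1 :> R by exact: expR_gt0.
have KE : 0 <= K * expR 1 by rewrite mulr_ge0 // ?(ltW ee) //; lra.
exists (K * expR 1 + K + 1) => [|u u0]; first by lra.
rewrite /logplus; case: ltP => u1; last first.
  rewrite mulr0 addr0 mulr1; apply: le_trans (llog_homo e0 u0 u1) _.
  by rewrite /llog mul1r div1r -/K; lra.
have l0 : 0 <= ln u by rewrite ln_ge0 // ltW.
have le1 : llog eps u <= u * (K + ln u).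
  rewrite /llog ler_wpM2l // -addrA lerD2l -lnM ?posrE; last 2 first.
  - by rewrite addr_gt0 // invr_gt0.
  - by lra.
  rewrite ler_ln ?posrE; last 2 first.
  - by rewrite addr_gt0 // divr_gt0 //; lra.
  - by rewrite mulr_gt0 ?addr_gt0 ?invr_gt0 //; lra.
  by rewrite mulrDl mul1r [eps^-1 * _]mulrC lerD2r ltW.
have le2 : u <= expR 1 + u * ln u.
  have [ue|ue] := leP u (expR 1); first by have := mulr_ge0 u0 l0; lra.
  have : 1 <= ln u by rewrite -[leLHS]expRK ler_ln ?posrE //; lra.
  by move=> h; have := ler_wpM2l u0 h; lra.
apply: le_trans le1 _.
have hK : 0 <= K by exact: le_trans ler01 K0.
have h1 := ler_wpM2l hK le2; rewrite mulrDr in h1.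
have w0 := mulr_ge0 u0 l0; have h2 := mulr_ge0 KE w0.
rewrite mulrDr mulrC; move: (u * ln u) w0 h1 h2 => w; move: (expR 1) => ex in KE *.
by rewrite -[K * ex * w]mulrA; nra.
Qed.

Lemma measurable_logplus : measurable_fun [set: R] (@logplus R).
Proof.
have -> : @logplus R = (fun u => ln (Num.max 1 u)).
  apply/funext => u; rewrite /logplus; case: ltP => // _; by rewrite ln1.
apply: (measurableT_comp (@measurable_ln R)).
by apply: measurable_maxr; [exact: measurable_cst|].
Qed.

Lemma llog_integrable f eps : 0 < eps -> cmeasurable D f ->
  (\int[mu]_(z in D) (cabs (f z) * logplus (cabs (f z)))%:E < +oo)%E ->
  mu.-integrable D (fun z => (llog eps (cabs (f z)))%:E).
Proof.
move=> e0 mf If; have [C C0 HC] := llog_le_logplus e0.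
have lp0 (u : R) : 0 <= logplus u by rewrite /logplus; case: ltP => // /ltW; exact: ln_ge0.
have mfl : measurable_fun D (fun z => (cabs (f z) * logplus (cabs (f z)))%:E).
  apply/measurable_EFinP; apply: measurable_funM; first exact: measurable_cabs.
  by apply: (measurableT_comp measurable_logplus); exact: measurable_cabs.
apply/integrableP; split; first exact: measurable_llog_cabs.
apply: (@le_lt_trans _ _ (\int[mu]_(z in D) (C%:E * (1%:E + (cabs (f z) * logplus (cabs (f z)))%:E)))%E).
  apply: ge0_le_integral => //.
  - by apply: measurableT_comp => //; exact: measurable_llog_cabs.
  - by apply: measurable_funeM; apply: emeasurable_funD => //; exact: measurable_cst.
  - move=> z _; rewrite gee0_abs ?lee_fin ?llog_ge0 ?cabs_ge0 //.
    exact: HC (cabs_ge0 _).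
rewrite ge0_integralZl_EFin //; last 2 first.
- by move=> z _; rewrite adde_ge0 ?lee_fin // mulr_ge0 ?cabs_ge0.
- by apply: emeasurable_funD => //; exact: measurable_cst.
apply: lte_mul_pinfty => //.
rewrite ge0_integralD //; last by move=> z _; rewrite lee_fin mulr_ge0 ?cabs_ge0.
by rewrite integral_cst // mul1e lte_add_pinfty.
Qed.

Definition cintegrable f := cmeasurable D f /\ mu.-integrable D (fun z => (cabs (f z))%:E).

Lemma integrable_Re_Im f e : cintegrable f -> cmeasurable D e -> (forall z, cabs (e z) <= 1) ->
  mu.-integrable D (EFin \o (fun z => complex.Re (f z * e z))) /\
  mu.-integrable D (EFin \o (fun z => complex.Im (f z * e z))).
Proof.
move=> [mf If] me e1; have [m1 m2] := cmeasurableM mf me.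
have le z : cabs (f z * e z) <= cabs (f z) by rewrite cabsM ler_piMr ?cabs_ge0.
split; apply: (le_integrable mD _ _ If); try exact/measurable_EFinP.
  move=> z _; rewrite lee_fin [leRHS]ger0_norm ?cabs_ge0 //.
  exact: le_trans (normr_Re_le _) (le z).
move=> z _; rewrite lee_fin [leRHS]ger0_norm ?cabs_ge0 //.
exact: le_trans (normr_Im_le _) (le z).
Qed.

Lemma Rintegral_Re_Im_le f e : cintegrable f -> cmeasurable D e -> (forall z, cabs (e z) <= 1) ->
  `|\int[mu]_(z in D) complex.Re (f z * e z)| <= \int[mu]_(z in D) cabs (f z) /\
  `|\int[mu]_(z in D) complex.Im (f z * e z)| <= \int[mu]_(z in D) cabs (f z).
Proof.
move=> If me e1; have [i1 i2] := integrable_Re_Im If me e1.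
have le z : cabs (f z * e z) <= cabs (f z) by rewrite cabsM ler_piMr ?cabs_ge0.
case: If => _ If; split.
  apply: le_trans (le_normr_Rintegral mD i1) _; apply: le_Rintegral => //.
    exact: integrable_norm.
  by move=> z _; exact: le_trans (normr_Re_le _) (le z).
apply: le_trans (le_normr_Rintegral mD i2) _; apply: le_Rintegral => //.
  exact: integrable_norm.
by move=> z _; exact: le_trans (normr_Im_le _) (le z).
Qed.

Lemma Rintegral_Re_Im_B f g e : cintegrable f -> cintegrable g ->
  cmeasurable D e -> (forall z, cabs (e z) <= 1) ->
  \int[mu]_(z in D) complex.Re ((f z - g z) * e z) =
    \int[mu]_(z in D) complex.Re (f z * e z) - \int[mu]_(z in D) complex.Re (g z * e z) /\
  \int[mu]_(z in D) complex.Im ((f z - g z) * e z) =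
    \int[mu]_(z in D) complex.Im (f z * e z) - \int[mu]_(z in D) complex.Im (g z * e z).
Proof.
move=> If Ig me e1; have [f1 f2] := integrable_Re_Im If me e1.
have [g1 g2] := integrable_Re_Im Ig me e1.
rewrite -RintegralB // -RintegralB //; split; apply: eq_Rintegral => z _.
  by rewrite mulrBl ReB.
by rewrite mulrBl ImB.
Qed.

Lemma llog_cintegrable f eps : 0 < eps -> cmeasurable D f ->
  mu.-integrable D (fun z => (llog eps (cabs (f z)))%:E) -> cintegrable f.
Proof.
move=> e0 mf If; split=> //; apply: (le_integrable mD _ _ If).
  exact/measurable_EFinP/measurable_cabs.
by move=> z _; rewrite !gee0_abs ?lee_fin ?llog_ge0 ?cabs_ge0 // le_llog ?cabs_ge0.
Qed.

Lemma Rintegral_cabs_le f eps (delta : R) : 0 < eps -> cmeasurable D f ->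
  (llog_int mu D eps f <= delta%:E)%E -> 
  cintegrable f /\ \int[mu]_(z in D) cabs (f z) <= delta.
Proof.
move=> e0 mf fd.
have If : cintegrable f.
  apply: (llog_cintegrable e0 mf); apply/integrableP; split; first exact: measurable_llog_cabs.
  under eq_integral do rewrite gee0_abs ?lee_fin ?llog_ge0 ?cabs_ge0 //.
  by apply: le_lt_trans fd _; rewrite ltry.
split=> //; have fin : (\int[mu]_(z in D) (cabs (f z))%:E \is a fin_num)%E.
  exact: integrable_fin_num If.2.
rewrite -lee_fin fineK //; apply: le_trans fd; apply: ge0_le_integral => //.
- by move=> z _; rewrite lee_fin cabs_ge0.
- exact/measurable_EFinP/measurable_cabs.
- exact: measurable_llog_cabs.
- by move=> z _; rewrite lee_fin le_llog ?cabs_ge0.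
Qed.

Lemma chebyshev_cabs f (lam delta : R) : 0 < lam -> cmeasurable D f ->
  cintegrable f -> \int[mu]_(z in D) cabs (f z) <= delta ->
  (lam%:E * mu ([set z | (lam < cabs (f z))%R] `&` D) <= delta%:E)%E.
Proof.
move=> lam0 mf If fd.
have mE : measurable ([set z | (lam < cabs (f z))%R] `&` D).
  have := measurable_cabs mf mD (measurable_itv `]lam, +oo[).
  by congr measurable; apply/seteqP; split=> z /=; rewrite in_itv /= andbT => -[].
have fin : (\int[mu]_(z in D) (cabs (f z))%:E \is a fin_num)%E.
  exact: integrable_fin_num If.2.
apply: le_trans (_ : \int[mu]_(z in D) (cabs (f z))%:E <= _)%E; last first.
  by rewrite -(fineK fin) lee_fin.
rewrite -[X in mu X](setIidl (@subIsetr _ _ D)) -integral_indic //.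
rewrite -ge0_integralZl_EFin ?(ltW lam0) //; last first.
  by apply/measurable_EFinP; exact: measurable_indic.
apply: ge0_le_integral => //.
- by move=> z _; rewrite mule_ge0 // lee_fin ?(ltW lam0).
- by apply: measurable_funeM; apply/measurable_EFinP; exact: measurable_indic.
- exact/measurable_EFinP/measurable_cabs.
- move=> z Dz; rewrite -EFinM lee_fin indicE.
  case: (boolP (z \in _)) => [/set_mem[/= /ltW h _]|_]; rewrite ?mulr1 ?mulr0 ?cabs_ge0 //.
Qed.

End LLogGeneric.

(** * From polynomials to residuals of the approximation *)

Section FourierBounds.
Variable R : realType.
Notation T2 := (@torus2 R).
Notation mT2 := (@measurable_torus2_plane R).
Notation cintegrable := (cintegrable (lebesgue2 R) T2).
Implicit Types (f g : plane R -> R[i]).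

Definition character (j k : int) (z : plane R) : R[i] := expi (- (j%:~R * z.1 + k%:~R * z.2)).

Lemma cmeasurable_character j k : cmeasurable T2 (character j k).
Proof.
apply: cmeasurable_expi; apply: (@measurable_fun_plane _ _ _ T2); first exact: measurable_torus2.
apply: measurable_funTS; apply: measurableT_comp; first exact: oppr_measurable.
exact: (measurable_phase (j, k)).
Qed.

Lemma character_le1 j k z : cabs (character j k z) <= 1.
Proof. by rewrite cabs_expi. Qed.

Lemma fourierB f g j k : cintegrable f -> cintegrable g ->
  fourier (fun z => f z - g z) j k = fourier f j k - fourier g j k.
Proof.
move=> If Ig; rewrite /fourier -mulrBr; congr (_ * _).
have [h1 h2] := Rintegral_Re_Im_B mT2 If Ig (cmeasurable_character j k) (character_le1 j k).
by rewrite /cintegral -/(character j k) h1 h2.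
Qed.

(** The 2 comes from bounding the modulus of an integral by its real and imaginary parts. *)
Definition coef_bound : R := 2 * (4 * pi ^+ 2)^-1.

Lemma coef_bound_ge0 : 0 <= coef_bound.
Proof. by rewrite mulr_ge0 // invr_ge0 mulr_ge0 // exprn_ge0 // pi_ge0. Qed.

Lemma cabs_fourier_le f j k : cintegrable f ->
  cabs (fourier f j k) <= coef_bound * \int[lebesgue2 R]_(z in T2) cabs (f z).
Proof.
move=> If; have p0 : 0 <= (4 * pi ^+ 2)^-1 :> R by rewrite invr_ge0 mulr_ge0 // exprn_ge0 // pi_ge0.
rewrite /fourier cabs_realM // /coef_bound mulrAC [leRHS]mulrC ler_wpM2l //.
have [h1 h2] := Rintegral_Re_Im_le mT2 If (cmeasurable_character j k) (character_le1 j k).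
by apply: le_trans (cabs_le_ReIm _) _; rewrite mulr_natl mulr2n lerD.
Qed.

Lemma SnnB n (z : R * R) f g : cintegrable f -> cintegrable g ->
  Snn n z.1 z.2 (fun w => f w - g w) = Snn n z.1 z.2 f - Snn n z.1 z.2 g.
Proof.
move=> If Ig; rewrite /Snn -sumrB; apply: eq_bigr => a _; rewrite -sumrB.
by apply: eq_bigr => b _ /=; rewrite fourierB // mulrBl.
Qed.

Lemma cabs_Snn_le n (z : R * R) f : cintegrable f ->
  cabs (Snn n z.1 z.2 f) <=
  (n.*2.+1 * n.*2.+1)%:R * (coef_bound * \int[lebesgue2 R]_(z in T2) cabs (f z)).
Proof.
move=> If; set C := coef_bound * _; rewrite /Snn.
apply: le_trans (cabs_sum _ _ _) _.
apply: le_trans (_ : \sum_(0 <= a < n.*2.+1) n.*2.+1%:R * C <= _).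
  apply: ler_sum => a _; apply: le_trans (cabs_sum _ _ _) _.
  apply: le_trans (_ : \sum_(0 <= b < n.*2.+1) C <= _).
    by apply: ler_sum => b _; cbv zeta; rewrite cabsM cabs_expi mulr1; exact: cabs_fourier_le.
  by rewrite sumr_const_nat subn0 mulr_natl.
by rewrite sumr_const_nat subn0 natrM -mulrA -[leLHS]mulr_natl.
Qed.

Lemma cmeasurable_Snn n f : cmeasurable [set: plane R] (fun z => Snn n z.1 z.2 f).
Proof.
apply: cmeasurable_sum => a; apply: cmeasurable_sum => b; apply: cmeasurableM.
  exact: cmeasurable_cst.
apply: cmeasurable_expi.
apply: (@measurable_fun_plane _ _ _ setT _ measurableT).
exact: (measurable_phase (a%:Z - n%:Z, b%:Z - n%:Z)).
Qed.

(** The factor [expR 1] on top of 16 absorbs a perturbation of the partial sums by [lam]. *)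
Definition exp_mean_const : R := 16 * expR 1.

(** Only the means up to length [2 ^ r] are tested: finitely many partial sums are involved, so a
    nearby polynomial can stand in for [f]. The union over [r] is taken later. *)
Definition residual_bad f (lam : R) (r : nat) : set (plane R) :=
  \bigcup_(i in `I_r.+1) [set z | exp_mean_const * 2 ^+ i <
    \sum_(t < 2 ^ i) expR (cabs (Snn t z.1 z.2 f) / lam)].

Lemma measurable_residual_bad f lam r : measurable (residual_bad f lam r).
Proof.
apply: bigcup_measurable => i _.
pose F (z : plane R) : R := \sum_(t < 2 ^ i) expR (cabs (Snn t z.1 z.2 f) / lam).
have mF : measurable_fun [set: plane R] F.
  apply: measurable_sum => t; apply: (measurableT_comp (@measurable_expR R)).
  apply: measurable_funM; last exact: measurable_cst.
  exact: measurable_cabs (cmeasurable_Snn _ _).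
have := mF measurableT _ (measurable_itv `]exp_mean_const * 2 ^+ i, +oo[).
by rewrite setTI; congr measurable; apply/seteqP; split => z /=; rewrite in_itv /= andbT.
Qed.

End FourierBounds.

Section ResidualWeakType.
Variable R : realType.
Notation T2 := (@torus2 R).
Notation mT2 := (@measurable_torus2_plane R).
Notation mu := (lebesgue2 R).
Notation llog_int := (llog_int mu T2).
Implicit Types (f g : plane R -> R[i]).

Lemma trig_cmeasurable s a : cmeasurable T2 (trig predT s a : plane R -> R[i]).
Proof. by apply: cmeasurable_is_trig; exists s, a. Qed.

Lemma trig_cintegrable s a : cintegrable mu T2 (trig predT s a : plane R -> R[i]).
Proof.
have mt := trig_cmeasurable s a; split=> //.
apply: (@torus2_integrable_bounded _ (fun z => cabs (trig predT s a z)) (\sum_(p <- s) cabs (a p))).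
  exact: measurable_cabs.
move=> z; rewrite ger0_norm ?cabs_ge0 //; apply: le_trans (cabs_sum _ _ _) _.
by apply: ler_sum => p _; rewrite cabsM cabs_expi mulr1.
Qed.

(** If the first [2 ^ r] partial sums of [f] and of the polynomial differ by at most [lam], each
    exponential changes by at most the factor [expR 1], so the polynomial is exceptional wherever
    [f] is. *)
Lemma residual_bad_weak_type_trig : exists2 A : R, 0 < A &
  forall s a f (lam eps : R) (r : nat), 0 < lam -> 0 < eps ->
  cmeasurable T2 f -> cintegrable mu T2 f ->
  cintegrable mu T2 (fun z => f z - trig predT s a z) ->
  (forall t z, (t < 2 ^ r)%N ->
     cabs (Snn t z.1 z.2 (fun w => f w - trig predT s a w)) <= lam) ->
  (lam%:E * mu (residual_bad f lam r `&` T2) <=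
   A%:E * (eps%:E * mu T2 + llog_int eps (trig predT s a)))%E.
Proof.
have [A A0 HA] := exp_mean_weak_type R.
exists A => // s a f lam eps r lam0 eps0 mf If Ifs near.
have Is := trig_cintegrable s a.
have sub : residual_bad f lam r `<=` (exp_mean_exceptional s a lam r : set (plane R)).
  move=> z [i ir /= Hi]; exists i => //=.
  rewrite -(ltr_pM2l (expR_gt0 1)) mulrCA mulrA; apply: lt_le_trans Hi _.
  rewrite mulr_sumr; apply: ler_sum => t _.
  rewrite -expRD ler_expR; set u := cabs _; set v := cabs _.
  have -> : 1 + v / lam = (lam + v) / lam by field; rewrite gt_eqF.
  rewrite ler_pM2r ?invr_gt0 // /u /v -Snn_trig.
  have tr : (t < 2 ^ r)%N by apply: leq_trans (ltn_ord t) _; rewrite leq_pexp2l.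
  apply: le_trans (_ : cabs (Snn t z.1 z.2 (trig predT s a)
     + Snn t z.1 z.2 (fun w => f w - trig predT s a w)) <= _).
    by rewrite (SnnB _ _ If Is) addrCA subrr addr0.
  by apply: le_trans (cabs_le_add _ _) _; rewrite addrC lerD2r; exact: near.
have mE := measurable_exceptional s a lam r.
have := HA s a lam eps r lam0 eps0.
rewrite -lebesgue2E; last by apply: measurableI => //; exact: measurable_torus2.
rewrite -ge0_integral_plane; last 3 first.
- exact: measurable_torus2.
- apply: measurable_funTS; apply/measurable_EFinP; apply: measurable_funM; first exact: measurable_cst.
  apply: measurable_funD; first exact: measurable_cst.
  exact/measurable_llog/measurable_cabs/cmeasurable_trig.
- move=> z _; rewrite lee_fin mulr_ge0 ?(ltW A0) // addr_ge0 ?(ltW eps0) //.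
  by apply: llog_ge0; rewrite ?cabs_ge0.
rewrite (ge0_integral_affine_llog _ mT2); last 4 first.
- exact: ltW.
- exact: ltW.
- by [].
- exact: trig_cmeasurable.
apply: le_trans; apply: lee_wpmul2l; first by rewrite lee_fin ltW.
apply: le_measure; rewrite ?inE.
- by apply: measurableI; [exact: measurable_residual_bad|exact: mT2].
- by apply: measurableI; [exact: measurable_plane|exact: mT2].
- by apply: setSI.
Qed.

(** [h] need not be a polynomial, so for each [r] a second polynomial much closer to [f] is taken.
    Its difference with the first one has partial sums within [lam] of those of [h] up to [2 ^ r],
    and a functional of order [eps] by the quasi-triangle inequality; the bound is uniform in
    [r]. *)
Lemma residual_weak_type : exists2 A : R, 0 < A &
  forall f, cmeasurable T2 f ->
  (forall eps, 0 < eps -> mu.-integrable T2 (fun z => (llog eps (cabs (f z)))%:E)) ->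
  forall lam eps : R, 0 < lam -> 0 < eps ->
  exists s a, let h := fun z => f z - trig predT s a z in
    [/\ cintegrable mu T2 h, \int[mu]_(z in T2) cabs (h z) <= eps &
        forall r, (lam%:E * mu (residual_bad h lam r `&` T2) <= (A * eps)%:E)%E].
Proof.
have [A A0 HA] := residual_bad_weak_type_trig.
have K0 : 0 <= 4 * pi ^+ 2 :> R by rewrite mulr_ge0 // exprn_ge0 // pi_ge0.
(* [4 pi ^ 2] is the measure of the torus, which multiplies the offset [eps]; 4 comes from
   [2 eps + 2 eps] in the quasi-triangle inequality. *)
exists (A * (4 * pi ^+ 2 + 4)) => [|f mf If lam eps lam0 eps0]; first by rewrite mulr_gt0 //; lra.
have e20 : 0 < eps / 2 by rewrite divr_gt0.
have [s [a fq]] := trig_dense mf If e20 eps0.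
have mh : cmeasurable T2 (fun z => f z - trig predT s a z).
  exact: (cmeasurableB mf (trig_cmeasurable s a)).
have [Ih hle] := Rintegral_cabs_le mT2 e20 mh fq.
exists s, a; split=> // r.
(* [c] bounds partial sums of index below [2 ^ r] by the L^1 norm; the added 1 makes it positive. *)
pose c : R := ((2 ^ r).*2.+1 * (2 ^ r).*2.+1)%:R * coef_bound R + 1.
have c0 : 0 < c by rewrite ltr_wpDl // mulr_ge0 // coef_bound_ge0.
pose delta := Num.min eps (lam / c).
have d0 : 0 < delta by rewrite lt_min eps0 divr_gt0.
have [s' [a' fq']] := trig_dense mf If e20 d0.
have mk : cmeasurable T2 (fun z => f z - trig predT s' a' z).
  exact: (cmeasurableB mf (trig_cmeasurable s' a')).
have [Ik kle] := Rintegral_cabs_le mT2 e20 mk fq'.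
have [t [b qE]] : is_trig (fun z => trig predT s' a' z - trig predT s a z).
  by apply: is_trigB; [exists s', a'|exists s, a].
have hkE : (fun z => (f z - trig predT s a z) - trig predT t b z) =
    (fun z => f z - trig predT s' a' z).
  by apply/funext => z; rewrite -qE; ring.
have := HA t b (fun z => f z - trig predT s a z) lam eps r lam0 eps0 mh Ih.
rewrite hkE => /(_ Ik) H; apply: le_trans (H _) _.
  move=> n z nr; apply: le_trans (cabs_Snn_le _ _ Ik) _.
  apply: le_trans (_ : c * delta <= _); last first.
    by rewrite mulrC -ler_pdivlMr // ge_min lexx orbT.
  rewrite mulrA; apply: ler_pM => //.
  - by rewrite mulr_ge0 // coef_bound_ge0.
  - by apply: Rintegral_ge0 => // w _; exact: cabs_ge0.
  - rewrite /c ler_wpDr // ler_wpM2r ?coef_bound_ge0 // ler_nat.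
    by apply: leq_mul; rewrite ltnS leq_double ltnW.
rewrite -mulrA EFinM; apply: lee_wpmul2l; first by rewrite lee_fin ltW.
rewrite mulrDl EFinD; apply: leeD.
  by rewrite lebesgue2_torus2 -EFinM lee_fin mulrC.
have L := @llog_int_le_add _ _ _ mu T2 mT2 eps (trig predT t b)
  (fun z => f z - trig predT s a z) (fun z => f z - trig predT s' a' z) eps0
  (trig_cmeasurable t b) mh mk.
apply: le_trans (L _) _.
  move=> z _; rewrite -qE.
  have -> : trig predT s' a' z - trig predT s a z =
    (f z - trig predT s a z) - (f z - trig predT s' a' z).
    by ring.
  exact: cabs_le_sub.
apply: (@le_trans _ _ (2%:E * eps%:E + 2%:E * eps%:E)%E).
  apply: leeD; apply: lee_wpmul2l; rewrite ?lee_fin //.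
  by apply: le_trans fq' _; rewrite lee_fin ge_min lexx.
by rewrite -!EFinM -EFinD lee_fin; lra.
Qed.

End ResidualWeakType.

Section MeasureLimits.
Context {d : measure_display} {T : measurableType d} {R : realType}.
Variable mu : {measure set T -> \bar R}.

Lemma measure_bigcup_le (F : nat -> set T) (c : \bar R) :
  (forall r, measurable (F r)) -> nondecreasing_seq F ->
  (forall r, (mu (F r) <= c)%E) -> (mu (\bigcup_r F r) <= c)%E.
Proof.
move=> mF nF Fc.
have C : mu (F r) @[r --> \oo] --> mu (\bigcup_r F r).
  by apply: nondecreasing_cvg_mu => //; exact: bigcup_measurable.
rewrite -(cvg_lim _ C) //; apply: lime_le; first by apply/cvg_ex; exists (mu (\bigcup_r F r)).
by near=> r.
Unshelve. all: by end_near.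
Qed.

(** [k] will index the scale [lam], and [j] the measure of the exceptional set at that scale. *)
Lemma negligible_limsup (Bad : nat -> nat -> set T) (c : R) :
  (forall k j, measurable (Bad k j)) ->
  (forall k j, (mu (Bad k j) <= (c / j.+1%:R)%:E)%E) ->
  mu.-negligible (\bigcup_k \bigcap_j Bad k j).
Proof.
move=> mB HB; apply: negligible_bigcup => k.
have mI : measurable (\bigcap_j Bad k j) by exact: bigcapT_measurable.
exists (\bigcap_j Bad k j); split => //.
apply/eqP; rewrite eq_le measure_ge0 andbT.
have : (c / j.+1%:R)%:E @[j --> \oo] --> (0 : \bar R)%E.
  apply: cvg_EFin; first by near=> j.
  rewrite -[X in _ --> X](mulr0 c); apply: cvgM; first exact: cvg_cst.
  exact: cvg_harmonic.
move=> C; rewrite -(cvg_lim _ C) //; apply: lime_ge; first by apply/cvg_ex; exists 0%E.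
near=> j; apply: le_trans (HB k j); apply: le_measure; rewrite ?inE //.
by move=> z /(_ j I).
Unshelve. all: by end_near.
Qed.

End MeasureLimits.

Section ExceptionalSets.
Variable R : realType.
Notation T2 := (@torus2 R).
Notation mT2 := (@measurable_torus2_plane R).
Notation mu := (lebesgue2 R).
Implicit Types (f g : plane R -> R[i]).

Lemma trig_square_eq s a (n : nat) z :
  (\sum_(p <- s) (`|p.1| + `|p.2|) <= n)%N -> trig (square n) s a z = trig predT s a z :> R[i].
Proof.
move=> sn; rewrite /trig big_mkcond big_seq [RHS]big_seq; apply: eq_bigr => p ps.
have : (`|p.1| + `|p.2| <= n)%N by apply: leq_trans sn; rewrite (big_rem p) //= leq_addr.
by rewrite /square => h; rewrite !(leq_trans _ h) ?leq_addr ?leq_addl.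
Qed.

(** From its degree on, a polynomial is reproduced by [Snn], so [S_nn f - f = S_nn h - h] and [y n]
    is [|S_nn h|]. Points with [|h| > lam] are removed by Chebyshev; the sets [residual_bad]
    increase with [r], so their union obeys the uniform bound. *)
Lemma exceptional_set : exists2 A : R, 0 < A &
  forall f, cmeasurable T2 f ->
  (forall eps, 0 < eps -> mu.-integrable T2 (fun z => (llog eps (cabs (f z)))%:E)) ->
  forall lam eps : R, 0 < lam -> 0 < eps ->
  exists (Bad : set (plane R)) (t0 : nat), [/\ measurable Bad,
    (mu Bad <= (A * eps / lam)%:E)%E &
    forall z, T2 z -> ~ Bad z -> exists y : nat -> R, [/\ forall n, 0 <= y n,
      forall n, (t0 <= n)%N -> cabs (Snn n z.1 z.2 f - f z) <= y n + lam &
      forall i, \sum_(t < 2 ^ i) expR (y t / lam) <= exp_mean_const R * 2 ^+ i]].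
Proof.
have [A A0 HA] := residual_weak_type R.
exists (A + 1) => [|f mf If lam eps lam0 eps0]; first by rewrite addr_gt0.
have [s [a [Ih hle Hr]]] := HA f mf If lam eps lam0 eps0.
pose h z := f z - trig predT s a z.
pose B1 := \bigcup_r (residual_bad h lam r `&` T2).
pose B2 := [set z | (lam < cabs (h z))%R] `&` T2.
have mh : cmeasurable T2 h by case: Ih.
have mr r : measurable (residual_bad h lam r `&` T2).
  by apply: measurableI; [exact: measurable_residual_bad|exact: mT2].
have m1 : measurable B1 by exact: bigcup_measurable.
have m2 : measurable B2.
  have := measurable_cabs mh mT2 (measurable_itv `]lam, +oo[).
  by congr measurable; apply/seteqP; split=> z /=; rewrite in_itv /= andbT => -[].
have div (x : \bar R) (c : R) : (lam%:E * x <= c%:E)%E -> (x <= (c / lam)%:E)%E.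
  by rewrite muleC -lee_pdivlMr // -EFinM mulrC.
exists (B1 `|` B2), (\sum_(p <- s) (`|p.1| + `|p.2|))%N; split.
- exact: measurableU.
- apply: le_trans (measureU2 _ m1 m2) _; rewrite mulrDl mul1r mulrDl EFinD; apply: leeD.
    apply: measure_bigcup_le => // [|r]; last by apply: div; exact: Hr.
    move=> r r' rr'; apply/subsetPset; apply: setSI => z [i /= ir Hz].
    by exists i => //=; exact: leq_trans ir _.
  by apply: div; apply: (chebyshev_cabs mT2 lam0 mh Ih hle).
move=> z Tz nB; exists (fun n => cabs (Snn n z.1 z.2 h)); split.
- by move=> n; exact: cabs_ge0.
- move=> n t0n; have Ifc : cintegrable mu T2 f by exact: (llog_cintegrable mT2 ltr01 mf (If 1 ltr01)).
  have -> : Snn n z.1 z.2 f - f z = Snn n z.1 z.2 h - h z.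
    rewrite /h (SnnB _ _ Ifc (trig_cintegrable s a)) Snn_trig trig_square_eq //; ring.
  apply: le_trans (cabs_le_sub _ _) _; rewrite lerD2l leNgt; apply/negP => hz.
  by apply: nB; right.
- move=> i; rewrite leNgt; apply/negP => Hi; apply: nB; left.
  by exists i => //; split=> //; exists i => //=.
Qed.

End ExceptionalSets.

(** Three thirds of [e]: the offset [eta], the exponential term at a scale [1 / (k + 1)] chosen once
    [B] is known, and the finitely many indices below [t0], which the mean forgets. *)
Lemma cvg_psi_mean (R : realType) (psi : R -> R) (x : nat -> R) (K C : R) :
  (forall u, 0 <= u -> 0 <= psi u) ->
  (forall u v, 0 <= u -> u <= v -> psi u <= psi v) ->
  0 < K -> 0 <= C ->
  (forall eta, 0 < eta -> exists2 B : R, 0 < B &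
     forall u, 0 <= u -> psi u <= eta + B * (expR (K * u) - 1)) ->
  (forall n, 0 <= x n) ->
  (forall k : nat, exists (y : nat -> R) (t0 : nat), [/\ forall n, 0 <= y n,
     forall n, (t0 <= n)%N -> x n <= y n + k.+1%:R^-1 &
     forall i, \sum_(t < 2 ^ i) expR (y t / k.+1%:R^-1) <= C * 2 ^+ i]) ->
  (m.+1%:R^-1 * \sum_(0 <= n < m.+1) psi (x n)) @[m --> \oo] --> (0 : R).
Proof.
move=> psi_ge0 psi_incr K0 C0 maj x0 Hy.
apply/cvgrPdist_le => e e0.
have e3 : 0 < e / 3 by rewrite divr_gt0.
have [B B0 HB] := maj _ e3.
(* For [0 <= th <= 1], convexity gives [expR th * (1 + 2 C th) - 1 <= th * D]. *)
pose D : R := expR 1 * (1 + 2 * C).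
have D0 : 0 < D by rewrite /D mulr_gt0 ?expR_gt0 //; lra.
(* [W * lam <= 1] encodes both [K lam <= 1] and [B K D lam <= e / 3]. *)
pose W := K + B * K * D / (e / 3).
have W0 : 0 < W by rewrite addr_gt0 // divr_gt0 // mulr_gt0 // mulr_gt0.
pose k := Num.truncn W; pose lam : R := k.+1%:R^-1.
have lam0 : 0 < lam by rewrite invr_gt0 ltr0n.
have Wlam : W * lam <= 1.
  by rewrite ler_pdivrMr ?ltr0n // mul1r; exact: ltW (truncnS_gt _).
have BKD0 : 0 <= B * K * D / (e / 3) by rewrite divr_ge0 ?(ltW e3) // ltW // mulr_gt0 // mulr_gt0.
have Klam : K * lam <= 1.
  by apply: le_trans Wlam; rewrite ler_wpM2r ?(ltW lam0) // lerDl.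
have BKDlam : B * K * D * lam <= e / 3.
  have : B * K * D / (e / 3) * lam <= 1.
    by apply: le_trans Wlam; rewrite ler_wpM2r ?(ltW lam0) // lerDr ltW.
  by rewrite mulrAC ler_pdivrMr // mul1r.
have th0 : 0 < K * lam by rewrite mulr_gt0.
have small : B * (expR (K * lam) * (1 + K * lam * (2 * C)) - 1) <= e / 3.
  apply: le_trans BKDlam.
  have -> : B * K * D * lam = B * (K * lam * D) by ring.
  rewrite ler_pM2l // /D.
  have h : expR (K * lam) <= 1 + K * lam * (expR 1 - 1).
    by have := @expR_theta_le R (K * lam) 1; rewrite mulr1 (ltW th0) Klam => /(_ isT).
  have p : 0 <= 1 + K * lam * (2 * C) by rewrite addr_ge0 // mulr_ge0 ?mulr_ge0 // ltW.
  have ex1 : 0 <= expR 1 - 1 :> R by rewrite subr_ge0 -expR0 ler_expR.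
  have := ler_wpM2r p h.
  have : 0 <= K * lam * (1 - K * lam) * C * (expR 1 - 1).
    apply: mulr_ge0 => //; apply: mulr_ge0 => //; apply: mulr_ge0; first exact: ltW.
    by rewrite subr_ge0.
  by move: (K * lam) (expR (K * lam)) (expR 1) th0 => th E ex th0; nra.
have [y [t0 [y0 xy Hexp]]] := Hy k.
pose S0 := \sum_(0 <= n < t0) psi (x n).
have S00 : 0 <= S0 by apply: sumr_ge0 => n _; exact: psi_ge0.
near=> m.
have u0 : 0 <= m.+1%:R^-1 * \sum_(0 <= n < m.+1) psi (x n).
  by rewrite mulr_ge0 ?invr_ge0 ?ler0n //; apply: sumr_ge0 => n _; exact: psi_ge0.
rewrite sub0r normrN ger0_norm //.
apply: le_trans (psi_mean_le psi_ge0 psi_incr m K0 B0 lam0 Klam HB x0 y0 xy Hexp (ltW e3)) _.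
have first : m.+1%:R^-1 * S0 <= e / 3.
  rewrite mulrC ler_pdivrMr ?ltr0n // mulrC -ler_pdivrMr //.
  apply: le_trans (ltW (truncnS_gt _)) _; rewrite ler_nat ltnS.
  by near: m; exists (Num.truncn (S0 / (e / 3))).
apply: le_trans (lerD (lerD first (lexx _)) small) _; lra.
Unshelve. all: by end_near.
Qed.

Theorem theorem3 (R : realType) (psi : R -> R)
  (psi_ge0 : forall u, 0 <= u -> 0 <= psi u)
  (psi_incr : forall u v, 0 <= u -> u <= v -> psi u <= psi v)
  (psi_lim0 : psi u @[u --> 0^'+] --> psi 0)
  (psi0 : psi 0 = 0)
  (psi_limsup :
    (limf_esup (fun u : R => lne (psi u)%:E * (u^-1)%:E) (pinfty_nbhs R)
      < +oo)%E)
  (f : R * R -> R[i]) (f_per : periodic2 f) (f_LlogL : LlogL f) :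
  {ae lebesgue2 R, forall z : plane R, torus2 z ->
    (m.+1%:R^-1 * \sum_(0 <= n < m.+1) psi (cabs (Snn n z.1 z.2 f - f z)))
      @[m --> \oo] --> (0 : R)}.
Proof.
have [mRe mIm intf] := f_LlogL.
have mf : cmeasurable (@torus2 R) (f : plane R -> R[i]) by split.
have If eps : 0 < eps -> (lebesgue2 R).-integrable (@torus2 R)
    (fun z : plane R => (llog eps (cabs (f z)))%:E).
  move=> e0; apply: (llog_integrable (@measurable_torus2_plane R) (lebesgue2_torus2_fin R) e0 mf).
  exact: intf.
have [K K0 maj] := psi_exp_majorant psi_ge0 psi_incr psi_lim0 psi0 psi_limsup.
have [A A0 HA] := exceptional_set R.
have lam0 (k : nat) : 0 < k.+1%:R^-1 :> R by rewrite invr_gt0 ltr0n.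
have /choice[Bad HBad] : forall kj : nat * nat, exists Bad : set (plane R), [/\ measurable Bad,
    (lebesgue2 R Bad <= (A / kj.2.+1%:R)%:E)%E &
    forall z, torus2 z -> ~ Bad z -> exists (y : nat -> R) (t0 : nat), [/\ forall n, 0 <= y n,
      forall n, (t0 <= n)%N -> cabs (Snn n z.1 z.2 f - f z) <= y n + kj.1.+1%:R^-1 &
      forall i, \sum_(t < 2 ^ i) expR (y t / kj.1.+1%:R^-1) <= exp_mean_const R * 2 ^+ i]].
  move=> [k j] /=.
  (* With [lam = 1 / (k + 1)] and [eps = lam / (j + 1)] the measure bound [A eps / lam] becomes
     [A / (j + 1)]. *)
  have [Bad [t0 [mB HB Hz]]] := HA _ mf If _ _ (lam0 k) (mulr_gt0 (lam0 k) (lam0 j)).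
  exists Bad; split=> //.
    by rewrite (_ : _ / _ = A * (k.+1%:R^-1 * j.+1%:R^-1) / k.+1%:R^-1) //; rewrite mulrCA mulrAC divff ?gt_eqF // mul1r.
  by move=> z Tz nB; have [y Hy] := Hz z Tz nB; exists y, t0.
have N : (lebesgue2 R).-negligible (\bigcup_k \bigcap_j Bad (k, j)).
  apply: (@negligible_limsup _ _ _ _ (fun k j => Bad (k, j)) A) => k j.
    by case: (HBad (k, j)).
  by case: (HBad (k, j)).
apply: negligibleS N => z Hz; apply: contrapT => nN; apply: Hz => Tz.
apply: (@cvg_psi_mean R psi (fun n => cabs (Snn n z.1 z.2 f - f z)) K (exp_mean_const R)) => //.
- by rewrite mulr_ge0 // expR_ge0.
- by move=> n; exact: cabs_ge0.
move=> k; have [j nB] : exists j, ~ Bad (k, j) z.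
  apply: contrapT => H; apply: nN; exists k => // j _; apply: contrapT => nB.
  by apply: H; exists j.
by have [_ _ /(_ z Tz nB)] := HBad (k, j).
Qed.
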